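(* Let $W$ be a mean zero random variable with finite, non-zero variance $\sigma^2$, and let $W^{*(n)}$ have the $W$-zero biased distribution of order $n$. (i) The distribution function of $W^{*(n)}$ is given by $$F_{W^{*(n)}}(w)=\begin{cases}\dfrac{1}{(n-1)!\sigma^2}\mathbb{E}\Big[W^2\gamma\Big(n,\log\Big(\dfrac{W}{w}\Big)\Big)\mathbf{1}(W\leq w)\Big],&w<0,\\[10pt] 1-\dfrac{1}{(n-1)!\sigma^2}\mathbb{E}\Big[W^2\gamma\Big(n,\log\Big(\dfrac{W}{w}\Big)\Big)\mathbf{1}(W\geq w)\Big],&w\geq0,\end{cases}$$ where $\gamma(a,x)$ denotes the lower incomplete gamma function $\gamma(a,x)=\int_0^xt^{a-1}\mathrm{e}^{-t}\,\mathrm{d}t$. (ii) The distribution of $W^{*(n)}$ is unimodal about zero with density $$f_{W^{*(n)}}(w)=\begin{cases}-\dfrac{1}{(n-1)!\sigma^2}\mathbb{E}\Big[W\Big(\log\Big(\dfrac{W}{w}\Big)\Big)^{n-1}\mathbf{1}(W\leq w)\Big],&w<0,\\[10pt] \dfrac{1}{(n-1)!\sigma^2}\mathbb{E}\Big[W\Big(\log\Big(\dfrac{W}{w}\Big)\Big)^{n-1}\mathbf{1}(W\geq w)\Big],&w\geq0.\end{cases}$$ It follows that the support of $W^{*(n)}$ is the closed convex hull of the support of $W$ and that $W^{*(n)}$ is bounded whenever $W$ is bounded. Suppose now that $W$ is symmetric. Then the density of $W^{*(n)}$ is given by $$f_{W^{*(n)}}(w)=\frac{1}{(n-1)!\sigma^2}\mathbb{E}\Big[W\Big(\log\Big|\frac{W}{w}\Big|\Big)^{n-1}\mathbf{1}(W\geq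 w)\Big]=-\frac{1}{(n-1)!\sigma^2}\mathbb{E}\Big[W\Big(\log\Big|\frac{W}{w}\Big|\Big)^{n-1}\mathbf{1}(W\leq w)\Big].$$ In particular, the zero bias transformation of order $n$ preserves symmetry. (iii) For $p\geq0$ we have $$\mathbb{E}(W^{*(n)})^p=\frac{\mathbb{E}W^{p+2}}{\sigma^2(p+1)^n}\qquad\text{and}\qquad\mathbb{E}|W^{*(n)}|^p=\frac{\mathbb{E}|W|^{p+2}}{\sigma^2(p+1)^n}.$$ (iv) Suppose $W=\prod_{k=1}^nW_k$, where the $W_k$ are independent random variables with zero mean and finite, non-zero variance, and $W_1^*,\ldots,W_n^*$ are independent random variables with $W_k^*$ having the $W_k$-zero biased distribution. Then $$W^{*(n)}\stackrel{\mathcal{D}}{=}\prod_{k=1}^nW_k^*$$ has the $W$-zero biased distribution of order $n$. (v) For $c\in\mathbb{R}\setminus\{0\}$, $cW^{*(n)}$ has the $cW$-zero biased distribution of order $n$.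
   Context: $n\geq1$ is an integer. For $W$ of mean zero and finite, non-zero variance $\sigma^2$, $W^{*(n)}$ is said to have the $W$-zero biased distribution of order $n$ if for all $n$ times differentiable $f$ for which $\mathbb{E}Wf(W)$ exists, $\mathbb{E}Wf(W)=\sigma^2\mathbb{E}A_nf(W^{*(n)})$, where $A_nf(x)=x^{-1}T^nf(x)$ and $Tf(x)=xf'(x)$; passing from $W$ to $W^{*(n)}$ is the zero bias transformation of order $n$. The $W$-zero biased distribution is the case $n=1$: $\mathbb{E}Wf(W)=\sigma^2\mathbb{E}f'(W^* )$ for all differentiable $f$ for which $\mathbb{E}Wf(W)$ exists. $\mathbf{1}(\cdot)$ is the indicator function, and $\stackrel{\mathcal{D}}{=}$ is equality in distribution.
   Formalization: The zero bias identity is required only for f for which both E W f(W) and E A_n f(W^{*(n)}) exist (otherwise no W^{*(n)} exists, e.g. W=±1, f=x^2 sin(x^{-2})), and the signed moment identity in (iii) is stated for integer p≥0, since powers of negative numbers are otherwise undefined. *)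

(* Defs.v *)
From HB Require Import structures.
From mathcomp Require Import all_boot all_order all_algebra.
From mathcomp Require Import all_classical all_reals all_analysis.
From mathcomp Require Import measurable_realfun.
Import Order.TTheory GRing.Theory Num.Theory.
Import numFieldNormedType.Exports.

Set Implicit Arguments.
Unset Strict Implicit.
Unset Printing Implicit Defensive.

Local Open Scope classical_set_scope.
Local Open Scope ring_scope.

Definition n_differentiable (R : realType) (n : nat) (f : R -> R) : Prop :=
  forall k, (k < n)%N -> forall x : R, derivable (derive1n k f) x 1.

Definition opT (R : realType) (f : R -> R) : R -> R := fun x => x * derive1 f x.

(* x^-1 T^n f(x) has a removable singularity at 0: for n >= 1 and f n times
   differentiable, A_n f = (T^(n-1) f)', whose value at 0 is f'(0). With this
   value A_1 f is f' everywhere. *)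
Definition opA (R : realType) (n : nat) (f : R -> R) : R -> R :=
  fun x => if x == 0 then derive1 f 0 else x^-1 * iter n (@opT R) f x.

(* mean zero and finite, non-zero variance *)
Definition centered_nondegenerate d (T : measurableType d) (R : realType)
    (P : probability T R) (W : T -> R) : Prop :=
  [/\ W \in Lfun P 2%:E, ('E_P[W] = 0)%E & ('V_P[W] != 0)%E].

(* The identity is required for the test functions f for which both sides
   exist. Requiring it whenever E[W f(W)] alone exists would make the notion
   empty: for W = 1 or -1 with probability 1/2, V must be uniform on [-1, 1],
   and for n = 1 the derivative of x^2 sin(x^-2) is not integrable there. *)
Definition zero_biased (n : nat) (R : realType)
    d (T : measurableType d) (P : probability T R) (W : T -> R)
    d' (T' : measurableType d') (P' : probability T' R) (V : T' -> R) : Prop :=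
  forall f : R -> R, n_differentiable n f ->
    P.-integrable setT (fun x => (W x * f (W x))%:E) ->
    P'.-integrable setT (fun y => (opA n f (V y))%:E) ->
    ('E_P[fun x => (W x * f (W x))%R] =
     'V_P[W] * 'E_P'[fun y => opA n f (V y)])%E.

Definition eq_distribution (R : realType)
    d (T : measurableType d) (P : probability T R) (X : T -> R)
    d' (T' : measurableType d') (P' : probability T' R) (Y : T' -> R) : Prop :=
  forall A : set R, measurable A -> P (X @^-1` A) = P' (Y @^-1` A).

Definition symmetric_rv d (T : measurableType d) (R : realType)
    (P : probability T R) (X : T -> R) : Prop :=
  eq_distribution P X P (fun x => - X x).

Definition mutually_independent d (T : measurableType d) (R : realType)
    (P : probability T R) (I : finType) (X : I -> T -> R) : Prop :=
  forall (J : {set I}) (A : I -> set R), (forall i, measurable (A i)) ->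
    P (\bigcap_(i in [set i | i \in J]) (X i @^-1` A i)) =
    (\prod_(i in J) P (X i @^-1` A i))%E.

(* gamma(a, x) for x >= 0, with x = +oo allowed *)
Definition lower_gamma (R : realType) (a : R) (x : \bar R) : \bar R :=
  (\int[lebesgue_measure]_(t in [set t : R | (0 <= t%:E <= x)%E])
    (t `^ (a - 1) * expR (- t))%:E)%E.

(* A density may take the value +oo (on a Lebesgue-null set). *)
Definition is_density d (T : measurableType d) (R : realType)
    (P : probability T R) (V : T -> R) (f : R -> \bar R) : Prop :=
  [/\ measurable_fun [set: R] f, (forall w, 0 <= f w)%E &
      forall A : set R, measurable A ->
        P (V @^-1` A) = (\int[lebesgue_measure]_(w in A) f w)%E].

(* Khinchin's definition: the distribution function is convex to the left of
   the mode m and concave to the right of it. *)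
Definition unimodal_about d (T : measurableType d) (R : realType)
    (P : probability T R) (V : {RV P >-> R}) (m : R) : Prop :=
  convex_function (E := R^o) `]-oo, m[ (fun w => fine (cdf V w)) /\
  convex_function (E := R^o) `]m, +oo[ (fun w => - fine (cdf V w)).

Definition rv_support d (T : measurableType d) (R : realType)
    (P : probability T R) (X : T -> R) : set R :=
  [set x | forall U : set R, open U -> U x -> (0 < P (X @^-1` U))%E].

Definition closed_convex_hull (R : realType) (A : set R) : set R :=
  smallest [set C : set R | closed C /\ convex_set (M := R^o) C] A.

Definition bounded_rv d (T : measurableType d) (R : realType)
    (P : probability T R) (X : T -> R) : Prop :=
  exists M : R, {ae P, forall x, `|X x| <= M}.

(* Main.v *)
Require Import Defs.
From HB Require Import structures.
From mathcomp Require Import all_boot all_order all_algebra.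
From mathcomp Require Import all_classical all_reals all_analysis.
From mathcomp Require Import measurable_realfun.
From mathcomp Require Import ring lra.
Import Order.TTheory GRing.Theory Num.Theory.
Import numFieldNormedType.Exports.
Local Open Scope classical_set_scope.
Local Open Scope ring_scope.

(** Let U be a product of n independent variables that are uniform on [0, 1].
Everything rests on one identity, [zero_biased_integral]: for every measurable
h >= 0,

      sigma^2 E h(V) = E [W^2 E_U h(W U)],

that is, V is distributed as W U once the law of W has been tilted by the
density W^2 / sigma^2.

The identity comes from inverting A_n. The operator [avg], which maps h to
x |-> int_0^1 h(x u) du, is such that x avg g(x) is a primitive of g, so that
T (x avg g) = x g. Hence f(x) = x avg^n h(x) solves T^n f = x h, that is
A_n f = h, and for this f the defining identity of zero biasing reads
sigma^2 E h(V) = E [W^2 avg^n h(W)]; finally avg^n h(x) = E_U h(x U). For h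
continuous this f need not be n times differentiable at 0. Therefore h is taken
continuous, bounded, and zero on a half-line ]-oo, w] with w > 0
([right_supported]); then f vanishes near 0 and is a legitimate test function
([n_differentiable_test_fun], [opA_test_fun]). Such functions increase to the
indicators of the rays ]w, +oo[, which determine the law of V on ]0, +oo[. The
negative half-line follows by applying this to -W and -V, because zero biasing
commutes with dilations ([zero_biased_dilate]), and the mass at 0 follows from
the total mass ([zero_biased_law]).

The claims are then read off from the identity.

- Moments: homogeneous functions of degree p are eigenfunctions of [avg] for
  the eigenvalue 1 / (p + 1) ([iter_avg_homogeneous]).

- Density: the kernel of avg^n is explicit,
  x avg^n h(x) = int_0^x h(s) log(x / s)^(n-1) / (n-1)! ds
  ([iter_avg_kernel]), and Tonelli's theorem does the rest
  ([is_density_kernel]). The substitution s = x e^(-t) turns the mass that this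
  kernel gives to a ray into an incomplete gamma function
  ([lower_gamma_substitution]).

- Unimodality: the kernel is monotone in s on each side of 0.

- Support: W U stays in every set that contains the values of W and is
  star-shaped about 0 ([zero_biased_star_shaped]), and conversely the density is
  positive between 0 and any point of the support of W
  ([support_below_pos], [support_above_neg]).

- Symmetric W: functions that are odd in W have mean zero, which exchanges the
  events W >= w and W < w in the density ([integral_odd_split]).

- Products: [avg] commutes with dilations, so that independent factors can be
  averaged one after the other ([zero_biased_partial_prod]). *)

Set Implicit Arguments.
Unset Strict Implicit.
Unset Printing Implicit Defensive.

(** * Averaging against a uniform variable *)

Section averaging.
Context {R : realType}.
Local Open Scope ereal_scope.

Definition uniform01 : probability (measurableTypeR R) R := uniform_prob (@ltr01 R).

(** The inverse of A_1 on functions: x avg h(x) is a primitive of h. *)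
Definition avg (h : R -> \bar R) (x : R) : \bar R := \int[uniform01]_u h (x * u)%R.

Definition nonneg_measurable (h : R -> \bar R) := measurable_fun setT h /\ forall x, 0 <= h x.

Lemma avg_itv (h : R -> \bar R) x : nonneg_measurable h ->
  avg h x = \int[lebesgue_measure]_(u in `[0%R, 1%R]) h (x * u)%R.
Proof.
move=> [mh h0]; rewrite /avg integral_uniform//.
  by rewrite subr0 invr1 mul1e.
exact: measurableT_comp.
Qed.

Lemma nonneg_measurable_avg h : nonneg_measurable h -> nonneg_measurable (avg h).
Proof.
move=> [mh h0]; split; last by move=> x; exact: integral_ge0.
apply: (@measurable_fun_fubini_tonelli_F _ _ (measurableTypeR R) (measurableTypeR R) R uniform01
  (fun z => h (z.1 * z.2)%R)) => //.
apply: measurableT_comp => //; apply: measurable_funM => //=.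
Qed.

Lemma nonneg_measurable_iter_avg n h : nonneg_measurable h -> nonneg_measurable (iter n avg h).
Proof. by move=> nh; elim: n => //= n; exact: nonneg_measurable_avg. Qed.

Lemma nonneg_measurable_indic (A : set R) : measurable A -> nonneg_measurable (fun x => (\1_A x)%:E).
Proof. by move=> mA; split; [exact/measurable_EFinP/measurable_indic|move=> x; rewrite lee_fin]. Qed.

Lemma avg_dilate h y x : avg (fun z => h (y * z)%R) x = avg h (y * x)%R.
Proof. by apply: eq_integral => u _; rewrite mulrA. Qed.

Lemma iter_avg_dilate n h y x :
  iter n avg (fun z => h (y * z)%R) x = iter n avg h (y * x)%R.
Proof.
elim: n x => //= n IH x; rewrite -avg_dilate.
by apply: eq_integral => u _; exact: IH.
Qed.

Lemma iter_avg1 n x : iter n avg (fun=> 1) x = 1.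
Proof.
elim: n x => //= n IH x; rewrite /avg; under eq_integral do rewrite IH.
by rewrite integral_cst// mul1e; exact: probability_setT.
Qed.

Lemma le_iter_avg n h k : nonneg_measurable h -> nonneg_measurable k -> (forall x, h x <= k x) ->
  forall x, iter n avg h x <= iter n avg k x.
Proof.
move=> nh nk hk; elim: n => //= n IH x.
apply: ge0_le_integral => //.
- by move=> u _; have [] := nonneg_measurable_iter_avg n nh.
- by apply: measurableT_comp => //; have [] := nonneg_measurable_iter_avg n nh.
- by apply: measurableT_comp => //; have [] := nonneg_measurable_iter_avg n nk.
Qed.

Lemma avg_eq0 h x : (forall u : R, (0 <= u <= 1)%R -> h (x * u)%R = 0) -> nonneg_measurable h ->
  avg h x = 0.
Proof.
move=> h0 nh; rewrite avg_itv//; apply: integral0_eq => u /=.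
by rewrite in_itv/= => /h0.
Qed.

(** The value at x only sees h on the segment from 0 to x. *)
Lemma iter_avg_eq0 n h x : nonneg_measurable h ->
  (forall u : R, (0 <= u <= 1)%R -> h (x * u)%R = 0) -> iter n avg h x = 0.
Proof.
move=> nh; elim: n x => [|n IH] x h0 /=.
  by rewrite -[x]mulr1 h0// ler01 lexx.
apply: avg_eq0; last exact: nonneg_measurable_iter_avg.
move=> u /andP[u0 u1]; apply: IH => v /andP[v0 v1].
by rewrite -mulrA h0// mulr_ge0//= mulr_ile1.
Qed.

(** Existential, so that it can be used inside a proof for a map whose
measurability is only known from the local context. *)
Lemma image_measure d1 d2 (T1 : measurableType d1) (T2 : measurableType d2)
    (m : {measure set T1 -> \bar R}) (f : T1 -> T2) : measurable_fun setT f ->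
  exists m' : {measure set T2 -> \bar R},
    (forall A, m' A = m (f @^-1` A)) /\
    forall h : T2 -> \bar R, measurable_fun setT h -> (forall y, 0 <= h y) ->
      \int[m']_y h y = \int[m]_x h (f x).
Proof.
move=> mf.
exists (measure_function_pushforward__canonical__measure_function_Measure m mf).
by split=> // h mh h0; rewrite ge0_integral_pushforward.
Qed.

Lemma integral_dilate (x : R) (h : R -> \bar R) : (0 < x)%R -> nonneg_measurable h ->
  x%:E * \int[lebesgue_measure]_u h (x * u)%R = \int[lebesgue_measure]_s h s.
Proof.
move=> x0 [mh h0].
have mx : measurable_fun setT ( *%R x : measurableTypeR R -> measurableTypeR R).
  exact: mulrl_measurable.
have [m' [m'E m'i]] := image_measure lebesgue_measure mx.
pose xn : {nonneg R} := NngNum (ltW x0).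
rewrite -(m'i h)// -[x%:E]/(xn%:num%:E) -ge0_integral_mscale//.
apply/esym/eq_measure_integral => A mA _.
apply: (lebesgue_measure_unique (mu := mscale xn m')) => // _ [[a b]/= _ <-].
have -> : mscale xn m' `]a, b] = x%:E * lebesgue_measure (`](a / x)%R, (b / x)%R]%classic : set R).
  rewrite /mscale/= m'E; congr (_ * lebesgue_measure _).
  by apply/seteqP; split => u /=; rewrite !in_itv/= ltr_pdivrMr// ler_pdivlMr// ![(u * x)%R]mulrC.
rewrite (lebesgue_measure_itv `]a, b]) (lebesgue_measure_itv `](a / x)%R, (b / x)%R])/= !lte_fin ltr_pM2r ?invr_gt0//.
case: ifPn => [ab|_]; last by rewrite mule0.
by rewrite -!EFinB -EFinM -mulrBl mulrCA divff ?mulr1// gt_eqF.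
Qed.

Lemma avg_dilated_itv (x : R) (h : R -> \bar R) : (0 < x)%R -> nonneg_measurable h ->
  x%:E * avg h x = \int[lebesgue_measure]_(s in `[0%R, x]) h s.
Proof.
move=> x0 nh; rewrite avg_itv// integral_mkcond [RHS]integral_mkcond.
have [mh h0] := nh.
rewrite -[RHS](@integral_dilate x)//.
  congr (_ * _); apply: eq_integral => u _; rewrite /patch.
  rewrite !mem_setE/= !in_itv/= pmulr_rge0// -{3}[x]mulr1 ler_pM2l//.
split.
  by apply/(measurable_restrictT _ _).1 => //; exact: measurable_funTS.
by move=> s; rewrite patchE; case: ifP.
Qed.
End averaging.

Lemma is_derive_log_power (R : realType) n (s y : R) : 0 < y ->
  is_derive y 1 (fun y => (ln y - ln s) ^+ n.+1 / n.+1`!%:R)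
    (y^-1 * ((ln y - ln s) ^+ n / n`!%:R)).
Proof.
move=> y0; have H : is_derive y 1 ((@ln R : R -> R) - cst (ln s)) (y^-1 - 0).
  exact: (is_deriveB (is_derive1_ln y0) (is_derive_cst _ _ _)).
have H2 := is_deriveX n.+1 H.
have H3 := is_deriveM H2 (is_derive_cst (n.+1`!%:R^-1 : R^o) y 1).
have n0 : n.+1%:R != 0 :> R by rewrite pnatr_eq0.
have f0 : n`!%:R != 0 :> R by rewrite pnatr_eq0 -lt0n fact_gt0.
move: H3; set D := (X in is_derive _ _ _ X -> _) => H3.
suff <- : D = y^-1 * ((ln y - ln s) ^+ n / n`!%:R) by move: H3; rewrite exprfctE.
rewrite /D /GRing.scale/= mulr0 add0r subr0 factS natrM.
rewrite -[(_ - cst _) y]/(ln y - ln s).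
by field; rewrite f0 gt_eqF//= -[1]/(1%:R) -natrD pnatr_eq0.
Qed.

Section averaging_kernel.
Context {R : realType}.
Local Open Scope ereal_scope.
Implicit Types (h : R -> \bar R).

Lemma derivable_LRcontinuous (F : R -> R) (a b : R) : (a < b)%R ->
  (forall x, (a <= x <= b)%R -> derivable F x 1%R) -> derivable_oo_LRcontinuous F a b.
Proof.
move=> ab dF; have cF x : (a <= x <= b)%R -> {for x, continuous F}.
  by move=> axb; apply: differentiable_continuous; apply/derivable1_diffP/dF.
split; first by move=> x; rewrite in_itv/= => /andP[ax xb]; apply: dF; rewrite !ltW.
  by apply: cvg_at_right_filter; apply: cF; rewrite lexx ltW.
by apply: cvg_at_left_filter; apply: cF; rewrite lexx ltW.
Qed.

(** Up to the factor 1 / x, the density on ]0, x] of x U for a product U of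
n + 1 independent uniform variables. *)
Definition log_kernel n (x s : R) : R :=
  if (0 < s <= x)%R then ((ln x - ln s) ^+ n / n`!%:R)%R else 0%R.

Lemma log_kernel_ge0 n x s : (0 <= log_kernel n x s)%R.
Proof.
rewrite /log_kernel; case: ifPn => // /andP[s0 sx].
by rewrite divr_ge0// exprn_ge0// subr_ge0 ler_ln ?posrE// (lt_le_trans s0).
Qed.

Lemma measurable_log_kernel n :
  measurable_fun setT (fun z : measurableTypeR R * measurableTypeR R => log_kernel n z.1 z.2).
Proof.
apply: measurable_fun_if => //.
  apply: measurable_and.
    by apply: measurable_fun_ltr => //; exact: measurable_snd.
  by apply: measurable_fun_ler; [exact: measurable_snd|exact: measurable_fst].
apply: measurable_funTS; apply: measurable_funM => //.
apply: measurable_funX; apply: measurable_funB; apply: measurableT_comp => //; exact: measurable_ln.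
Qed.

Lemma integral_log_power n (s x : R) : (0 < s)%R -> (s <= x)%R ->
  \int[lebesgue_measure]_(y in `[s, x]) (y^-1 * ((ln y - ln s) ^+ n / n`!%:R))%:E =
  ((ln x - ln s) ^+ n.+1 / n.+1`!%:R)%:E.
Proof.
move=> s0; rewrite le_eqVlt => /predU1P[<-|sx].
  by rewrite set_itv1 integral_set1 subrr expr0n/= mul0r.
pose F y : R := ((ln y - ln s) ^+ n.+1 / n.+1`!%:R)%R.
have dF (y : R) : (0 < y)%R -> is_derive y 1%R F (y^-1 * ((ln y - ln s) ^+ n / n`!%:R))%R.
  exact: is_derive_log_power.
rewrite (@continuous_FTC2 _ (fun y => y^-1 * ((ln y - ln s) ^+ n / n`!%:R))%R F)//.
- by rewrite /F subrr expr0n/= mul0r sube0.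
- apply: continuous_in_subspaceT => y; rewrite inE/= in_itv/= => /andP[sy _].
  have y0 : (0 < y)%R by exact: lt_le_trans sy.
  apply: cvgM; first by apply: cvgV; [rewrite gt_eqF|exact: cvg_id].
  apply: cvgM; last exact: cvg_cst.
  apply: (@continuous_comp _ _ _ (fun y : R => ln y - ln s)%R (fun y : R => y ^+ n)%R y); last exact: exprn_continuous.
  by apply: cvgB; [exact: continuous_ln|exact: cvg_cst].
- apply: derivable_LRcontinuous => // y /andP[sy _].
  by apply: ex_derive; apply: dF; exact: lt_le_trans sy.
- move=> y; rewrite in_itv/= => /andP[sy _].
  by rewrite derive1E; apply: derive_val; apply: dF; exact: lt_trans sy.
Qed.

(** Averaging once more integrates the kernel against dy / y. *)
Lemma log_kernelS n (s x : R) :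
  \int[lebesgue_measure]_y (if (0 < y <= x)%R then (y^-1 * log_kernel n y s)%:E else 0) =
  (log_kernel n.+1 x s)%:E.
Proof.
have [/andP[s0 sx]|sx] := boolP (0 < s <= x)%R; last first.
  rewrite {2}/log_kernel (negbTE sx); apply: integral0_eq => y _.
  case: ifP => // /andP[y0 yx]; rewrite /log_kernel; case: ifPn => [/andP[s0 sy]|_].
    by rewrite s0 (le_trans sy yx) in sx.
  by rewrite mulr0.
rewrite {2}/log_kernel s0 sx/= -integral_log_power// [RHS]integral_mkcond.
apply: eq_integral => y _; rewrite patchE mem_setE/= in_itv/= /log_kernel s0/=.
have [sy|sy] := leP s y; last by rewrite mulr0; case: ifP.
by rewrite (lt_le_trans s0 sy)/=.
Qed.

(** By induction on n: x avg (avg^(n+1) h)(x) is the integral over ]0, x] of the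
previous average, Tonelli exchanges the two integrals, and [log_kernelS]
computes the inner one. *)
Lemma iter_avg_kernel n h (x : R) : (0 < x)%R -> nonneg_measurable h ->
  x%:E * iter n.+1 avg h x = \int[lebesgue_measure]_s (h s * (log_kernel n x s)%:E).
Proof.
move=> + nh; have [mh h0] := nh; elim: n x => [|n IH] x x0.
  rewrite /= avg_dilated_itv// -integral_itv_obnd_cbnd; last exact: measurable_funTS.
  rewrite integral_mkcond; apply: eq_integral => s _.
  rewrite patchE mem_setE/= in_itv/= /log_kernel expr0 fact0 divr1.
  by case: ifP; rewrite ?mule1 ?mule0.
have nI := nonneg_measurable_iter_avg n.+1 nh.
rewrite iterS avg_dilated_itv// -integral_itv_obnd_cbnd; last first.
  by case: nI => mI _; exact: measurable_funTS.
rewrite integral_mkcond.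
pose G (z : measurableTypeR R * measurableTypeR R) : \bar R :=
  h z.2 * (if (0 < z.1 <= x)%R then (z.1^-1 * log_kernel n z.1 z.2)%:E else 0).
have mif : measurable_fun setT (fun z : measurableTypeR R * measurableTypeR R => 
    if (0 < z.1 <= x)%R then (z.1^-1 * log_kernel n z.1 z.2)%:E else 0).
  rewrite (_ : (fun _ => _) = (fun z : measurableTypeR R * measurableTypeR R =>
    if (0 < z.1 <= x)%R then (z.1 `^ (-1) * log_kernel n z.1 z.2)%:E else 0)); last first.
    by apply/funext => z; case: ifP => // /andP[z0 _]; rewrite powR_inv1// ltW.
  apply: measurable_fun_if => //.
    apply: measurable_and.
      by apply: measurable_fun_ltr => //; exact: measurable_fst.
    by apply: measurable_fun_ler => //; exact: measurable_fst.
  apply: measurable_funTS; apply/measurable_EFinP; apply: measurable_funM.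
    exact: (measurableT_comp (measurable_powR _) measurable_fst).
  exact: measurable_log_kernel.
have if0 (z : measurableTypeR R * measurableTypeR R) : 
    0 <= (if (0 < z.1 <= x)%R then (z.1^-1 * log_kernel n z.1 z.2)%:E else 0).
  by case: ifP => // /andP[z0 _]; rewrite lee_fin mulr_ge0// ?log_kernel_ge0// invr_ge0 ltW.
have mG : measurable_fun setT G.
  by apply: emeasurable_funM => //; apply: measurableT_comp => //; exact: measurable_snd.
have G0 z : 0 <= G z by rewrite mule_ge0.
transitivity (\int[lebesgue_measure]_y \int[lebesgue_measure]_s G (y, s)).
  apply: eq_integral => y _; rewrite patchE mem_setE/= in_itv/= /G/=.
  case: ifPn => [/andP[y0 yx]|_]; last by rewrite integral0_eq// => s _; rewrite mule0.
  under eq_integral do rewrite EFinM muleCA.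
  rewrite ge0_integralZl//; first last.
  - by rewrite lee_fin invr_ge0 ltW.
  - by move=> s _; rewrite mule_ge0// lee_fin log_kernel_ge0.
  - apply: emeasurable_funM => //; apply/measurable_EFinP.
    exact: (measurableT_comp (measurable_log_kernel n) (measurable_pair1 y)).
  by rewrite -IH// muleA -EFinM mulVf ?mul1e// gt_eqF.
rewrite (fubini_tonelli (m1 := lebesgue_measure) (m2 := lebesgue_measure) G)//.
apply: eq_integral => s _; rewrite /G/= -(log_kernelS n) ge0_integralZl//.
- exact: (measurableT_comp mif (measurable_pair2 s)).
- by move=> y _; exact: (if0 (y, s)).
Qed.

Lemma integral_powR01 (p : R) : (0 <= p)%R ->
  \int[lebesgue_measure]_(u in `[0%R, 1%R]) (u `^ p)%:E = ((p + 1)^-1)%:E :> \bar R.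
Proof.
move=> p0; have p1 : (0 < p + 1)%R by rewrite ltr_wpDl.
pose F (u : R) : R := (u `^ (p + 1) / (p + 1))%R.
have dF (u : R) : (0 < u)%R -> is_derive u 1%R F (u `^ p)%R.
  move=> u0.
  have := is_deriveM (is_derive1_powR (p + 1) u0) (is_derive_cst ((p + 1)^-1%R : R^o) u 1%R).
  set D := (X in is_derive _ _ _ X -> _); suff -> : D = (u `^ p)%R by [].
  by rewrite /D /GRing.scale/= mulr0 add0r /cst addrK mulrA mulVf ?mul1r// gt_eqF.
have cF (u : R) : (0 < u)%R -> {for u, continuous F}.
  move=> u0; apply: differentiable_continuous; apply/derivable1_diffP.
  by apply: ex_derive; exact: dF.
have cP (u : R) : (0 < u)%R -> {for u, continuous (fun u : R => u `^ p)%R}.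
  move=> u0; apply: differentiable_continuous; apply/derivable1_diffP.
  by apply: ex_derive; exact: is_derive1_powR.
rewrite (@continuous_FTC2 _ (fun u => u `^ p)%R F)//.
- by rewrite /F powR1 powR0 ?gt_eqF// mul0r sube0 div1r.
- move: p0; rewrite le_eqVlt => /predU1P[<-|p0].
    rewrite (_ : (fun u : R => u `^ 0)%R = cst 1%R); last by apply/funext => u; rewrite powRr0.
    by apply: continuous_subspaceT => ?; exact: cst_continuous.
  apply/continuous_within_itvP; [exact: ltr01|split].
  + by move=> u; rewrite in_itv/= => /andP[u0 _]; exact: cP.
  + by rewrite powR0 ?gt_eqF//; exact: powR_cvg0.
  + by apply: cvg_at_left_filter; exact: cP.
- split.
  + by move=> u; rewrite in_itv/= => /andP[u0 _]; apply: ex_derive; exact: dF.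
  + rewrite {2}/F powR0 ?gt_eqF// mul0r -[X in _ --> X](mul0r (p + 1)^-1)%R.
    by apply: cvgM; [exact: powR_cvg0|exact: cvg_cst].
  + by apply: cvg_at_left_filter; exact: cF.
- move=> u; rewrite in_itv/= => /andP[u0 _].
  by rewrite derive1E; apply: derive_val; exact: dF.
Qed.

(** Each average contributes the factor int_0^1 u^p du = 1 / (p + 1). *)
Lemma iter_avg_homogeneous n h (p : R) : (0 <= p)%R -> nonneg_measurable h ->
  (forall x u : R, (0 <= u <= 1)%R -> h (x * u)%R = (u `^ p)%:E * h x) ->
  forall x, iter n avg h x = ((p + 1) ^- n)%:E * h x.
Proof.
move=> p0 nh hp; have [mh h0] := nh; have p1 : (0 < p + 1)%R by rewrite ltr_wpDl.
elim: n => [x|n IH x]; first by rewrite expr0 invr1 mul1e.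
rewrite iterS (_ : iter n avg h = fun x => ((p + 1) ^- n)%:E * h x); last exact/funext.
have k0 : (0 <= (p + 1) ^- n)%R by rewrite invr_ge0 exprn_ge0// ltW.
rewrite avg_itv; last first.
  by split; [exact: measurable_funeM|move=> y; rewrite mule_ge0].
under eq_integral.
  move=> u; rewrite inE/= in_itv/= => u01; rewrite hp// muleCA; over.
rewrite ge0_integralZr//; last 3 first.
- by apply/measurable_EFinP; apply: measurable_funTS; exact: measurable_powR.
- by move=> u _; rewrite lee_fin powR_ge0.
- by rewrite mule_ge0.
by rewrite integral_powR01// muleA -EFinM -invfM -exprS.
Qed.
End averaging_kernel.

(** * Measures with a density and products of uniform variables *)

Section weighted_measure.
Context d (T : measurableType d) (R : realType).
Variables (m : {measure set T -> \bar R}) (r : T -> R).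
Hypotheses (mr : measurable_fun setT r) (r0 : forall x, 0 <= r x).
Local Open Scope ereal_scope.

Definition weighted (A : set T) : \bar R := \int[m]_(x in A) (r x)%:E.

Let weighted0 : weighted set0 = 0. Proof. exact: integral_set0. Qed.

Let weighted_ge0 A : 0 <= weighted A. Proof. by apply: integral_ge0 => x _; rewrite lee_fin. Qed.

Let weighted_sigma_additive : semi_sigma_additive weighted.
Proof.
move=> F mF tF mUF; rewrite /weighted; apply: cvg_toP.
  apply: ereal_nondecreasing_is_cvgn => a b ab.
  by apply: lee_sum_nneg_natr => // k _ _; exact: weighted_ge0.
rewrite ge0_integral_bigcup//; last 2 first.
- exact/measurable_EFinP/measurable_funTS.
- by move=> x _; rewrite lee_fin.
Qed.

HB.instance Definition _ := isMeasure.Build _ _ _ weighted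
  weighted0 weighted_ge0 weighted_sigma_additive.

Import HBNNSimple.

Lemma ge0_integral_weighted (h : T -> \bar R) : measurable_fun setT h ->
  (forall x, 0 <= h x) -> \int[weighted]_x h x = \int[m]_x ((r x)%:E * h x).
Proof.
move=> mh h0; pose h_ := nnsfun_approx measurableT mh.
have h_cvg x : (fun n => (h_ n x)%:E) @ \oo --> h x by exact: cvg_nnsfun_approx.
have h_nd x : {homo (fun n => (h_ n x)%:E) : a b / (a <= b)%N >-> a <= b}.
  by move=> a b ab; rewrite lee_fin; exact/lefP/nd_nnsfun_approx.
transitivity (limn (fun n => \int[weighted]_x (h_ n x)%:E)).
  rewrite -monotone_convergence//.
  - by apply: eq_integral => x _; apply/esym/cvg_lim.
  - by move=> n; exact/measurable_EFinP.
  - by move=> n x _; rewrite lee_fin.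
transitivity (limn (fun n => \int[m]_x ((r x)%:E * (h_ n x)%:E))); last first.
  rewrite -monotone_convergence//.
  - apply: eq_integral => x _; apply/cvg_lim => //.
    apply: cvgeZl => //.
  - by move=> n; apply: emeasurable_funM; exact/measurable_EFinP.
  - by move=> n x _; rewrite mule_ge0 ?lee_fin.
  - by move=> x _ a b ab; rewrite lee_wpmul2l ?lee_fin//; exact: h_nd.
apply: congr_lim; apply/funext => n.
under [LHS]eq_integral do rewrite fimfunE -fsumEFin//.
rewrite [LHS]ge0_integral_fsum//; last 2 first.
- by move=> y; exact/measurable_EFinP/measurable_funM.
- by move=> y x _; rewrite EFinM nnfun_muleindic_ge0.
under [RHS]eq_integral.
  move=> x _; rewrite fimfunE -fsumEFin// ge0_mule_fsumr; last first.
    by move=> y; rewrite EFinM nnfun_muleindic_ge0.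
  over.
rewrite [RHS]ge0_integral_fsum//; last 2 first.
- move=> y; apply: emeasurable_funM; [exact/measurable_EFinP|exact/measurable_EFinP/measurable_funM].
- by move=> y x _; apply: mule_ge0; [rewrite lee_fin r0|rewrite EFinM nnfun_muleindic_ge0].
apply: eq_fsbigr => y; rewrite inE => -[x0 _ <-]; set y0 := h_ n x0.
under [RHS]eq_integral do rewrite EFinM muleCA.
rewrite integralZl_indic_nnsfun//= integral_indic// setIT.
rewrite ge0_integralZl//; first last.
- by rewrite lee_fin.
- by move=> x _; rewrite mule_ge0 ?lee_fin.
- by apply: emeasurable_funM; exact/measurable_EFinP.
congr (_ * _); rewrite /weighted [LHS]integral_mkcond; apply: eq_integral => x _.
by rewrite patchE indicE; case: ifP; rewrite ?mule1 ?mule0.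
Qed.

Lemma weighted_measure : exists nu : {measure set T -> \bar R},
  forall h : T -> \bar R, measurable_fun setT h -> (forall x, 0 <= h x) ->
    \int[nu]_x h x = \int[m]_x ((r x)%:E * h x).
Proof. by exists [the measure _ _ of weighted]; exact: ge0_integral_weighted. Qed.

End weighted_measure.

Section product_of_uniforms.
Context {R : realType}.
Local Open Scope ereal_scope.

(** The law of a product of n independent uniform variables. *)
Lemma iter_avg_law (n : nat) : exists pi : probability (measurableTypeR R) R,
  forall (h : R -> \bar R), nonneg_measurable h -> forall x,
    iter n avg h x = \int[pi]_u h (x * u)%R.
Proof.
elim: n => [|n [pi IH]].
  exists [the probability _ _ of \d_(1%R : measurableTypeR R)] => h [mh h0] x.
  rewrite integral_dirac//= ?diracT ?mul1e ?mulr1//.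
  exact: measurableT_comp.
have mM : measurable_fun setT
    (fun z : measurableTypeR R * measurableTypeR R => (z.1 * z.2 : measurableTypeR R)%R).
  by apply: measurable_funM => //=.
pose M : {mfun (measurableTypeR R * measurableTypeR R)%type >-> measurableTypeR R} :=
  HB.pack (fun z : measurableTypeR R * measurableTypeR R => (z.1 * z.2 : measurableTypeR R)%R)
    (isMeasurableFun.Build _ _ _ _ _ mM).
exists (distribution [the probability _ _ of uniform01 \x pi] M) => h nh x; have [mh h0] := nh.
have mhM : measurable_fun setT (fun z : measurableTypeR R * measurableTypeR R => h (x * (z.1 * z.2))%R).
  apply: measurableT_comp => //; apply: measurable_funM => //.
rewrite ge0_integral_distribution//; last by apply: measurableT_comp.
rewrite (fubini_tonelli1 (m1 := uniform01) (m2 := pi) (fun z => h (x * (z.1 * z.2))%R))//=.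
by apply: eq_integral => u _; rewrite IH//; apply: eq_integral => v _; rewrite mulrA.
Qed.
End product_of_uniforms.

(** * Iterated differentiability and test functions *)

Section differentiability.
Context {R : realType}.
Implicit Types (f g b : R -> R).

Definition has_derivative f g := forall x : R, is_derive x 1 f (g x).

Lemma has_derivative_derive1 f g : has_derivative f g -> (derive1 f) = g.
Proof. by move=> fg; apply/funext => x; rewrite derive1E; apply: derive_val. Qed.

Lemma derivable_has_derivative f : (forall x : R, derivable f x 1) ->
  has_derivative f (derive1 f).
Proof. by move=> df x; rewrite derive1E; apply: derivableP. Qed.

Lemma has_derivative_continuous f g : has_derivative f g -> continuous f.
Proof.
move=> fg x; apply: differentiable_continuous; apply/derivable1_diffP.
by have [] := fg x.
Qed.

Lemma n_differentiableS n f : n_differentiable n.+1 f <->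
  (forall x : R, derivable f x 1) /\ n_differentiable n (derive1 f).
Proof.
split=> [H|[H0 H] [_|k] // kn x]; last by rewrite derive1Sn; exact: H.
split=> [x|k kn x]; first exact: (H 0%N).
by rewrite -derive1Sn; apply: H.
Qed.

Lemma has_derivative_n_differentiable n f g : has_derivative f g ->
  n_differentiable n g -> n_differentiable n.+1 f.
Proof.
move=> fg ng; apply/n_differentiableS; rewrite (has_derivative_derive1 fg); split => // x.
by have [] := fg x.
Qed.

Lemma n_differentiable_has_derivative n f : n_differentiable n.+1 f ->
  has_derivative f (derive1 f) /\ n_differentiable n (derive1 f).
Proof. by move=> /n_differentiableS[df nf]; split => //; exact: derivable_has_derivative. Qed.

Lemma n_differentiableW n f : n_differentiable n.+1 f -> n_differentiable n f.
Proof. by move=> nf k kn; apply: nf; exact: ltnW. Qed.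

Lemma n_differentiableD n f g : n_differentiable n f -> n_differentiable n g ->
  n_differentiable n (fun x => f x + g x).
Proof.
elim: n f g => // n IH f g /n_differentiable_has_derivative[df nf].
move=> /n_differentiable_has_derivative[dg ng].
apply: (@has_derivative_n_differentiable _ _ (fun x => (derive1 f) x + (derive1 g) x)); last exact: IH.
by move=> x; apply: is_deriveD.
Qed.

Lemma n_differentiableN n f : n_differentiable n f -> n_differentiable n (fun x => - f x).
Proof.
elim: n f => // n IH f /n_differentiable_has_derivative[df nf].
apply: (@has_derivative_n_differentiable _ _ (fun x => - (derive1 f) x)); last exact: IH.
by move=> x; apply: is_deriveN.
Qed.

Lemma is_derive_mulx f (x df : R) : is_derive x 1 f df ->
  is_derive x 1 (fun y => y * f y) (f x + x * df).
Proof.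
move=> H; have := is_deriveM (is_derive_id x (1:R)) H.
by rewrite /GRing.scale/= mulr1 addrC.
Qed.

Lemma n_differentiable_mulx n f : n_differentiable n f ->
  n_differentiable n (fun x => x * f x).
Proof.
elim: n f => // n IH f nf; have [df ndf] := n_differentiable_has_derivative nf.
apply: (@has_derivative_n_differentiable _ _ (fun x => f x + x * (derive1 f) x)).
  by move=> x; exact: is_derive_mulx.
by apply: n_differentiableD; [exact: n_differentiableW|exact: IH].
Qed.

Lemma n_differentiable_opT n f : n_differentiable n.+1 f -> n_differentiable n (opT f).
Proof. by move=> /n_differentiableS[_ nf]; exact: n_differentiable_mulx. Qed.

Lemma n_differentiable_iter_opT n k f : n_differentiable (n + k) f ->
  n_differentiable n (iter k (@opT R) f).
Proof.
elim: k f => [|k IH] f; first by rewrite addn0.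
by rewrite addnS iterSr => nf; apply: IH; exact: n_differentiable_opT.
Qed.

(** A derivative is the pointwise limit of its difference quotients. *)
Lemma measurable_derive1 f : (forall x : R, derivable f x 1) -> measurable_fun setT (derive1 f).
Proof.
move=> df.
have mf : measurable_fun setT f.
  apply: continuous_measurable_fun; apply: has_derivative_continuous.
  exact: derivable_has_derivative.
(* the difference quotients of step 1 / (m + 1) *)
pose u (m : nat) (x : R) : R := m.+1%:R * (f (m.+1%:R^-1 + x) - f x).
apply: (measurable_fun_cvg (h := u)).
  move=> m; apply: measurable_funM => //; apply: measurable_funB => //.
  by apply: measurableT_comp => //; exact: measurable_funD.
move=> x _; have /cvgP := df x; rewrite derive1E /derive => _.
have H : (fun h : R => h^-1 *: (f (h *: (1 : R) + x) - f x)) @ 0^' --> 'D_1 f x by exact: df.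
have U : (fun m : nat => m.+1%:R^-1 : R) @ \oo --> (0 : R)^'.
  move=> A A0; have /= := @cvg_harmonic R _ A0.
  rewrite /nbhs/= /fmap/=; apply: filterS => m /=; apply.
  by rewrite gt_eqF// harmonic_gt0.
have := cvg_comp _ _ U H.
apply: cvg_trans; apply: near_eq_cvg; near=> m => /=.
by rewrite /u invrK /GRing.scale/= mulr1.
Unshelve. all: by end_near. Qed.

Lemma opAS n f (x : R) : x != 0 -> opA n.+1 f x = derive1 (iter n (@opT R) f) x.
Proof. by move=> x0; rewrite /opA (negbTE x0) iterS /opT mulKf. Qed.

(** Away from 0, A_(n+1) f is the derivative of T^n f. *)
Lemma measurable_opA n f : (0 < n)%N -> n_differentiable n f ->
  measurable_fun setT (opA n f).
Proof.
case: n => // n _ nf.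
have dT : forall x : R, derivable (iter n (@opT R) f) x 1.
  by have /n_differentiableS[] := @n_differentiable_iter_opT 1 n f nf.
rewrite (_ : opA _ _ = fun x : R => if x == 0 then derive1 f 0
    else derive1 (iter n (@opT R) f) x); last first.
  apply/funext => x; case: eqVneq => [->|x0]; first by rewrite /opA eqxx.
  exact: opAS.
apply: measurable_fun_if => //.
  exact: measurable_fun_eqr.
by apply: measurable_funTS; exact: measurable_derive1.
Qed.

Lemma near_is_derive (f g : R -> R) (x df : R) :
  {near x, f =1 g} -> is_derive x 1 f df -> is_derive x 1 g df.
Proof.
move=> fg [dfx Dfx]; split; first exact: near_eq_derivable dfx.
by rewrite -Dfx; apply/esym; exact: near_eq_derive.
Qed.

Lemma near_lt_eq f g (w x : R) : x < w -> (forall y, y < w -> f y = g y) ->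
  {near x, f =1 g}.
Proof. by move=> xw fg; near=> y; apply: fg; near: y; exact: lt_nbhsl. Unshelve. all: by end_near. Qed.

Lemma near_gt_eq f g (w x : R) : w < x -> (forall y, w < y -> f y = g y) ->
  {near x, f =1 g}.
Proof. by move=> xw fg; near=> y; apply: fg; near: y; exact: lt_nbhsr. Unshelve. all: by end_near. Qed.

Lemma is_derive_divx f (x df : R) : x != 0 -> is_derive x 1 f df ->
  is_derive x 1 (fun y => f y / y) (df / x - f x / x / x).
Proof.
move=> x0 H; have V := is_deriveV (f := id) x0 (is_derive_id x (1:R)).
have := is_deriveM H V.
by congr (is_derive _ _ _ _); rewrite /GRing.scale/=; field.
Qed.

(** For functions that vanish near 0, division by x costs no derivative: the
derivative b' / x - (b / x) / x is built from functions of the same kind. *)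
Lemma n_differentiable_divx n b (w : R) : 0 < w -> (forall x, x < w -> b x = 0) ->
  n_differentiable n b -> n_differentiable n (fun x => b x / x).
Proof.
move=> w0; elim: n b => // n IH b b0 nb.
have [db ndb] := n_differentiable_has_derivative nb.
have db0 x : x < w -> derive1 b x = 0.
  move=> xw; rewrite derive1E; apply: derive_val.
  apply: (@near_is_derive (cst 0)).
  by apply: (near_lt_eq xw) => y /b0 ->.
apply: (@has_derivative_n_differentiable _ _ (fun x => derive1 b x / x - b x / x / x)).
  move=> x; have [x0|x0] := leP x 0; last by apply: is_derive_divx => //; rewrite gt_eqF.
  have xw := le_lt_trans x0 w0.
  rewrite -[X in is_derive _ _ _ X]/(derive1 b x / x - b x / x / x) db0// b0// !mul0r subrr.
  apply: (@near_is_derive (cst 0)).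
  by apply: (near_lt_eq xw) => y /b0 ->; rewrite mul0r.
have nb' := n_differentiableW nb.
apply: (n_differentiableD (f := fun x => derive1 b x / x)); first exact: IH.
apply: n_differentiableN; apply: (IH); last exact: IH.
by move=> x xw; rewrite b0// mul0r.
Qed.

End differentiability.

Section test_functions.
Context {R : realType}.
Implicit Types (a h : R -> R).

(** The functions h for which the equation A_n f = h is solved: they vanish near 0,
where the solution f could fail to be n times differentiable. *)
Definition right_supported (w : R) a :=
  [/\ continuous a, forall x, 0 <= a x <= 1 & forall x, x <= w -> a x = 0].

Definition ravg a (x : R) : R := fine (avg (EFin \o a) x).

Lemma nonneg_measurable_right_supported w a : right_supported w a -> nonneg_measurable (EFin \o a).
Proof.
move=> [ca a01 _]; split; first by apply/measurable_EFinP; exact: continuous_measurable_fun.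
by move=> x; rewrite lee_fin; have /andP[] := a01 x.
Qed.

Lemma avg_le1 w a (x : R) : right_supported w a -> (0 <= avg (EFin \o a) x <= 1)%E.
Proof.
move=> aw; have nm := nonneg_measurable_right_supported aw; have [ca a01 _] := aw.
apply/andP; split; first by have [_ ->] := nonneg_measurable_avg nm.
rewrite -(@iter_avg1 R 1 x); apply: (le_iter_avg 1 nm) => [|y].
  by split => // y; rewrite lee_fin.
by rewrite lee_fin; have /andP[] := a01 y.
Qed.

Lemma avg_ravg w a : right_supported w a -> avg (EFin \o a) = EFin \o ravg a.
Proof.
move=> aw; apply/funext => x; rewrite /ravg/= fineK//.
have /andP[H0 H1] := avg_le1 x aw.
by rewrite ge0_fin_numE// (le_lt_trans H1)// ltry.
Qed.

Lemma ravg_eq0 w a x : 0 < w -> right_supported w a -> x <= w -> ravg a x = 0.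
Proof.
move=> w0 aw xw; rewrite /ravg avg_eq0//; last exact: nonneg_measurable_right_supported aw.
move=> u /andP[u0 u1] /=; have [_ _ ->//] := aw.
have [x0|x0] := leP x 0; first by rewrite (le_trans _ (ltW w0))// mulr_le0_ge0.
by rewrite (le_trans _ xw)// ler_piMr// ltW.
Qed.

(** For x > 0 this is the fundamental theorem of calculus, as
x avg a(x) = int_0^x a; left of w everything vanishes. *)
Lemma has_derivative_mulx_ravg w a : 0 < w -> right_supported w a ->
  has_derivative (fun x => x * ravg a x) a.
Proof.
move=> w0 aw x; have nm := nonneg_measurable_right_supported aw.
have [ca a01 a0] := aw.
have [xw|xw] := ltP x w.
  rewrite a0 ?ltW//; apply: (@near_is_derive _ (cst 0)).
  by apply: (near_lt_eq xw) => y yw; rewrite (ravg_eq0 w0 aw) ?mulr0// ltW.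
have x0 : 0 < x := lt_le_trans w0 xw.
pose F (y : R) : R := \int[lebesgue_measure]_(t in `[0, y]) a t.
have [] := @continuous_FTC1_closed R a 0 x (x + 1) _ _ x0 (ca x).
- by rewrite ltrDl.
- apply: continuous_compact_integrable; first exact: segment_compact.
  exact: continuous_subspaceT.
move=> dF F'; apply: (@near_is_derive _ F).
  apply: (near_gt_eq x0) => y y0.
  rewrite /F /Rintegral -(avg_dilated_itv y0 nm) (avg_ravg aw).
  by rewrite -EFinM.
by rewrite -F' derive1E; exact: derivableP.
Qed.

Lemma right_supported_ravg w a : 0 < w -> right_supported w a -> right_supported w (ravg a).
Proof.
move=> w0 aw; split; last by move=> x; exact: ravg_eq0.
- rewrite (_ : ravg a = fun x => x * ravg a x / x); last first.
    apply/funext => x; have [->|x0] := eqVneq x 0.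
      by rewrite (ravg_eq0 w0 aw) ?mul0r ?ltW.
    by rewrite mulrAC divff ?mul1r.
  have dF := has_derivative_mulx_ravg w0 aw.
  have n1 : n_differentiable 1 (fun x => x * ravg a x).
    exact: (has_derivative_n_differentiable dF).
  have : n_differentiable 1 (fun x => x * ravg a x / x).
    apply: (n_differentiable_divx w0) n1 => x xw.
    by rewrite (ravg_eq0 w0 aw) ?mulr0// ltW.
  by move=> /n_differentiable_has_derivative[/has_derivative_continuous].
- by move=> x; have := avg_le1 x aw; rewrite (avg_ravg aw)/= !lee_fin.
Qed.

(** The solution of T^n f = x h that vanishes near 0. *)
Definition test_fun n h (x : R) : R := x * iter n ravg h x.

Lemma right_supported_iter_ravg w n h : 0 < w -> right_supported w h ->
  right_supported w (iter n ravg h).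
Proof. by move=> w0 hw; elim: n => //= n; exact: right_supported_ravg. Qed.

Lemma iter_avg_ravg w n h : 0 < w -> right_supported w h ->
  iter n avg (EFin \o h) = EFin \o iter n ravg h.
Proof.
move=> w0 hw; elim: n => //= n ->; apply: avg_ravg.
exact: (right_supported_iter_ravg n w0 hw).
Qed.

Lemma has_derivative_test_fun w n h : 0 < w -> right_supported w h ->
  has_derivative (test_fun n.+1 h) (iter n ravg h).
Proof.
move=> w0 hw; apply: (has_derivative_mulx_ravg w0).
exact: right_supported_iter_ravg.
Qed.

(** The derivative of [test_fun n.+1 h] is [test_fun n h] divided by x, and
[test_fun n h] vanishes left of w. *)
Lemma n_differentiable_test_fun w n h : 0 < w -> right_supported w h ->
  n_differentiable n (test_fun n h).
Proof.
move=> w0 hw; elim: n => // n IH.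
apply: (has_derivative_n_differentiable (has_derivative_test_fun _ w0 hw)).
have [_ _ i0] := right_supported_iter_ravg n w0 hw.
rewrite (_ : iter n ravg h = fun x => test_fun n h x / x).
  apply: (n_differentiable_divx w0) IH => x xw.
  by rewrite /test_fun i0 ?mulr0// ltW.
apply/funext => x; rewrite /test_fun; have [->|x0] := eqVneq x 0.
  by rewrite i0 ?mul0r// ltW.
by rewrite mulrAC divff ?mul1r.
Qed.

Lemma iter_opT_test_fun w n k h : 0 < w -> right_supported w h ->
  iter k (@opT R) (test_fun (n + k) h) = test_fun n h.
Proof.
move=> w0 hw; elim: k => [|k IH]; first by rewrite addn0.
rewrite iterSr addnS -[RHS]IH; congr (iter k _ _).
apply/funext => x; rewrite /opT.
by rewrite (has_derivative_derive1 (has_derivative_test_fun _ w0 hw)).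
Qed.

Lemma opA_test_fun w n h : (0 < n)%N -> 0 < w -> right_supported w h ->
  opA n (test_fun n h) = h.
Proof.
move=> n0 w0 hw; apply/funext => x; rewrite /opA.
have [_ _ h0] := hw.
have [->|x0] := eqVneq x 0.
  case: n n0 => // n _.
  rewrite (has_derivative_derive1 (has_derivative_test_fun _ w0 hw)).
  have [_ _ i0] := right_supported_iter_ravg n w0 hw.
  by rewrite i0 ?h0// ltW.
have := @iter_opT_test_fun w 0 n h w0 hw; rewrite add0n => ->.
by rewrite /test_fun/= mulKf.
Qed.
End test_functions.

(** * Rays on the positive half-line *)

Section second_moment.
Context d (T : measurableType d) (R : realType) (P : probability T R) (W : T -> R).
Local Open Scope ereal_scope.

Lemma expectationE (X : T -> R) : 'E_P[X] = \int[P]_x (X x)%:E.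
Proof. by rewrite unlock. Qed.

Lemma centered_second_moment : centered_nondegenerate P W ->
  [/\ measurable_fun setT W, (0 < fine 'V_P[W])%R, 'V_P[W] = (fine 'V_P[W])%:E &
      \int[P]_x ((W x) ^+ 2)%:E = (fine 'V_P[W])%:E].
Proof.
move=> [W2 EW VW].
have mW : measurable_fun setT W.
  by move: W2; rewrite inE/= => /andP[+ _]; rewrite inE.
have VE : 'V_P[W] = (fine 'V_P[W])%:E by rewrite fineK// variance_fin_num.
split => //.
  by rewrite fine_gt0// lt0e VW variance_ge0/= -ge0_fin_numE ?variance_ge0// variance_fin_num.
by rewrite -VE varianceE// EW expe2 mule0 sube0 unlock.
Qed.
End second_moment.

Section right_ray_steps.
Context {R : realType}.

(** Continuous functions that increase with m to the indicator of ]w, +oo[. *)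
Definition ramp (w : R) (m : nat) (x : R) : R :=
  Num.min 1 (m.+1%:R * Num.max 0 (x - w)).

Lemma right_supported_ramp w m : right_supported w (ramp w m).
Proof.
split.
- move=> x; have cx : {for x, continuous (fun x : R => x - w)}.
    by apply: cvgB; [exact: cvg_id|exact: cvg_cst].
  have cm : {for x, continuous (fun x : R => m.+1%:R * Num.max 0 (x - w))}.
    by apply: cvgM; [exact: cvg_cst|exact: (continuous_max (@cst_continuous _ _ _ x) cx)].
  exact: (continuous_min (@cst_continuous _ _ _ x) cm).
- move=> x; rewrite /ramp ge_min lexx/= andbT le_min ler01/= mulr_ge0//.
  by rewrite le_max lexx.
- by move=> x xw; rewrite /ramp max_l ?subr_le0// mulr0 min_r.
Qed.

Lemma ramp_nd w x : {homo (ramp w)^~ x : m n / (m <= n)%N >-> m <= n}.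
Proof.
move=> m n mn; rewrite /ramp le_min ge_min lexx/= ge_min; apply/orP; right.
by rewrite ler_wpM2r ?le_max ?lexx// ler_nat ltnS.
Qed.

Lemma ramp_cvg w x : ramp w m x @[m --> \oo] --> (\1_`]w, +oo[ x : R).
Proof.
have [xw|wx] := leP x w.
  rewrite indicE memNset/=; last by rewrite in_itv/= andbT ltNge xw.
  rewrite (_ : (fun m => ramp w m x) = cst 0); first exact: cvg_cst.
  by apply/funext => m; have [_ _ ->] := right_supported_ramp w m.
rewrite indicE mem_set/=; last by rewrite in_itv/= andbT.
apply: cvg_near_cst; near=> m; rewrite /ramp max_r ?subr_ge0 ?ltW//.
rewrite min_l// -ler_pdivrMr ?subr_gt0// div1r.
have : (x - w)^-1 <= m%:R by near: m; exact: nbhs_infty_ger.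
by move=> /le_trans; apply; rewrite ler_nat.
Unshelve. all: by end_near. Qed.

Local Open Scope ereal_scope.
Lemma integral_ramp_cvg w (mu : {measure set (measurableTypeR R) -> \bar R}) :
  \int[mu]_x (ramp w m x)%:E @[m --> \oo] --> mu `]w, +oo[%classic.
Proof.
have : \int[mu]_x (ramp w m x)%:E @[m --> \oo] --> \int[mu]_x limn (fun m => (ramp w m x)%:E).
  apply: cvg_monotone_convergence => //.
  - by move=> m; have [] := nonneg_measurable_right_supported (right_supported_ramp w m).
  - by move=> m x _; have [_ H] := nonneg_measurable_right_supported (right_supported_ramp w m); exact: (H x).
  - by move=> x _ m n mn; rewrite lee_fin ramp_nd.
suff <- : \int[mu]_x limn (fun m => (ramp w m x)%:E) = mu `]w, +oo[%classic by [].
transitivity (\int[mu]_x (\1_(`]w, +oo[%classic : set R) x)%:E); last by rewrite integral_indic// setIT.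
apply: eq_integral => x _.
apply/cvg_lim => //; apply: cvg_EFin; first exact: nearW.
exact: ramp_cvg.
Qed.

(** The rays ]w, +oo[ with w > 0 generate the Borel sets of ]0, +oo[, and the ray
at 0 is their increasing union. *)
Lemma measure_pos_unique (m1 m2 : {measure set (measurableTypeR R) -> \bar R}) :
  m1 setT < +oo ->
  (forall w : R, (0 < w)%R -> m1 `]w, +oo[%classic = m2 `]w, +oo[%classic) ->
  forall A : set R, measurable A -> m1 (A `&` `]0%R, +oo[%classic) = m2 (A `&` `]0%R, +oo[%classic).
Proof.
move=> fin1 m12.
have m0 : m1 `]0%R, +oo[%classic = m2 `]0%R, +oo[%classic.
  have E : `]0%R, +oo[%classic = \bigcup_k `](k.+1%:R^-1)%R, +oo[%classic :> set (measurableTypeR R).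
    apply/seteqP; split => x /=; rewrite in_itv/= andbT; last first.
      by move=> [k _]/=; rewrite in_itv/= andbT; apply: le_lt_trans; rewrite invr_ge0.
    move=> x0; have [k] := ltr_add_invr x0; rewrite add0r => kx.
    by exists k => //=; rewrite in_itv/= kx.
  have nd : {homo (fun k => `](k.+1%:R^-1)%R, +oo[%classic : set (measurableTypeR R)) : n m / (n <= m)%N >-> (n <= m)%O}.
    move=> i j ij; apply/subsetPset => x /=; rewrite !in_itv/= !andbT.
    by apply: le_lt_trans; rewrite lef_pV2 ?posrE// ler_nat ltnS.
  have mU : measurable (\bigcup_k `](k.+1%:R^-1)%R, +oo[%classic : set (measurableTypeR R)).
    by rewrite -E.
  pose F (k : nat) : set (measurableTypeR R) := `](k.+1%:R^-1)%R, +oo[%classic.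
  have H1 := @nondecreasing_cvg_mu _ _ _ m1 F (fun i => measurable_itv _) mU nd.
  have H2 := @nondecreasing_cvg_mu _ _ _ m2 F (fun i => measurable_itv _) mU nd.
  have F12 : m1 \o F = m2 \o F by apply/funext => k /=; apply: m12; rewrite invr_gt0.
  by rewrite F12 in H1; rewrite E; exact: (cvg_unique _ H1 H2).
have mD : measurable (`]0%R, +oo[%classic : set (measurableTypeR R)) by [].
pose r1 := [the {measure set _ -> \bar R} of mrestr m1 mD].
pose r2 := [the {measure set _ -> \bar R} of mrestr m2 mD].
move=> A mA; apply: (@measure_unique _ _ (measurableTypeR R) (@RGenOInfty.G R)
  (fun k => `](- k%:R)%R, +oo[%classic) _ _ _ _ r1 r2) => //.
- exact: RGenOInfty.measurableE.
- move=> _ _ [x ->] [y ->]; exists (Num.max x y); apply/seteqP; split => z /=;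
    rewrite !in_itv/= !andbT gt_max; first by move=> [-> ->].
  by move=> /andP[].
- by move=> k; exists (- k%:R)%R.
- apply/seteqP; split => // x _.
  exists (Num.truncn `|x|).+1 => //=; rewrite in_itv/= andbT ltrNl.
  by rewrite (le_lt_trans _ (truncnS_gt _))// -normrN ler_norm.
- move=> _ [w ->]; rewrite /r1 /r2/= /mrestr.
  have [w0|w0] := ltP 0%R w.
    rewrite (_ : _ `&` _ = `]w, +oo[%classic) ?m12//.
    by apply: setIidl => x /=; rewrite !in_itv/= !andbT; exact: lt_trans.
  rewrite (_ : _ `&` _ = `]0%R, +oo[%classic) ?m0//.
  by apply: setIidr => x /=; rewrite !in_itv/= !andbT; exact: le_lt_trans.
- by move=> k; rewrite /r1/= /mrestr (le_lt_trans _ fin1)// le_measure ?inE//; exact: measurableI.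
Qed.
End right_ray_steps.

(** * Dilations *)

Section dilation.
Context {R : realType}.
Implicit Types (f : R -> R) (a c : R).

Lemma has_derivative_dilate f g c a : has_derivative f g ->
  has_derivative (fun x => c * f (a * x)) (fun x => c * a * g (a * x)).
Proof.
move=> fg x.
have H1 : is_derive x 1 (fun x : R => a * x) a.
  by have := is_deriveZ (f := id) a (is_derive_id x (1:R)); rewrite /GRing.scale/= mulr1.
have H2 : is_derive x 1 (fun x : R => f (a * x)) (g (a * x) * a).
  exact: (@is_derive1_comp _ f ( *%R a)).
have := is_deriveZ c H2.
by congr (is_derive _ _ _ _); rewrite /GRing.scale/=; ring.
Qed.

Lemma n_differentiable_dilate n f c a : n_differentiable n f ->
  n_differentiable n (fun x => c * f (a * x)).
Proof.
elim: n f c => // n IH f c /n_differentiable_has_derivative[df nf].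
exact: (has_derivative_n_differentiable (has_derivative_dilate c a df) (IH _ _ nf)).
Qed.

Lemma iter_opT_dilate n f c a : n_differentiable n f ->
  iter n (@opT R) (fun x => c * f (a * x)) = fun x => c * iter n (@opT R) f (a * x).
Proof.
elim: n f => // n IH f nf; rewrite !iterSr -IH; last exact: n_differentiable_opT.
congr (iter n _ _); apply/funext => x; rewrite /opT.
have [df _] := n_differentiable_has_derivative nf.
by rewrite (has_derivative_derive1 (has_derivative_dilate c a df)); ring.
Qed.

(** T commutes with dilations, and 1 / x = a / (a x). *)
Lemma opA_dilate n f a (x : R) : (0 < n)%N -> a != 0 -> n_differentiable n f ->
  opA n (fun x => a * f (a * x)) x = a ^+ 2 * opA n f (a * x).
Proof.
move=> n0 a0 nf; rewrite /opA mulf_eq0 (negbTE a0)/=.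
case: eqVneq => [_|x0].
  case: n n0 nf => // n _ /n_differentiable_has_derivative[df _].
  by rewrite (has_derivative_derive1 (has_derivative_dilate a a df)) mulr0 expr2.
by rewrite iter_opT_dilate//; field; rewrite a0 x0.
Qed.
End dilation.

Section zero_biased_dilation.
Context (R : realType) (n : nat) (hn : (0 < n)%N).
Context d (T : measurableType d) (P : probability T R) (W : T -> R).
Context d' (T' : measurableType d') (P' : probability T' R) (V : T' -> R).
Hypothesis hV : zero_biased n P W P' V.
Local Open Scope ereal_scope.

Lemma variance_dilate (a : R) : W \in Lfun P 2%:E ->
  'V_P[(fun x => a * W x)%R] = (a ^+ 2)%:E * 'V_P[W].
Proof.
move=> W2; rewrite -varianceZ//; congr ('V_P[ _ ]).
by apply/funext => x /=; rewrite mulrC.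
Qed.

(** Test the identity for W and V against x |-> a f(a x). *)
Lemma zero_biased_dilate (a : R) : W \in Lfun P 2%:E -> a != 0%R ->
  zero_biased n P (fun x => a * W x)%R P' (fun y => a * V y)%R.
Proof.
move=> W2 a0 f nf iW iV.
have nfa := @n_differentiable_dilate R n f a a nf.
have WE : (fun x => (a * W x * f (a * W x))%R) = (fun x => (W x * (a * f (a * W x)))%R).
  by apply/funext => x; rewrite mulrCA mulrA.
have VE y : opA n (fun x => a * f (a * x))%R (V y) = (a ^+ 2 * opA n f (a * V y))%R.
  exact: opA_dilate.
rewrite WE (hV nfa).
- rewrite variance_dilate// (_ : (fun y => _) = (fun y => a ^+ 2 * opA n f (a * V y))%R); last exact/funext.
  rewrite [in LHS]unlock; under [in LHS]eq_integral do rewrite EFinM.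
  by rewrite integralZl// muleCA muleA unlock.
- by apply: eq_integrable iW => // x _; rewrite mulrCA mulrA.
- apply: eq_integrable (integrableZl measurableT (a ^+ 2)%R iV) => // y _.
  by rewrite VE EFinM.
Qed.
End zero_biased_dilation.

(** * The law of a zero biased variable *)

Section representation.
Context (R : realType) (n : nat) (hn : (0 < n)%N).
Context d (T : measurableType d) (P : probability T R).
Context d' (T' : measurableType d') (P' : probability T' R).
Local Open Scope ereal_scope.

(** The image, under (x, u) |-> W(x) u, of the product of W^2 dP and the law of a
product of n uniform variables. *)
Lemma squared_average_measure (W : T -> R) : measurable_fun setT W ->
  exists mu : {measure set (measurableTypeR R) -> \bar R}, forall h, nonneg_measurable h ->
    \int[mu]_x h x = \int[P]_x (((W x) ^+ 2)%:E * iter n avg h (W x)).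
Proof.
move=> mW; have [pi piE] := @iter_avg_law R n.
have mW1 : measurable_fun setT (fun z : T * measurableTypeR R => W z.1).
  exact: measurableT_comp.
have mr : measurable_fun setT (fun z : T * measurableTypeR R => (W z.1 ^+ 2)%R).
  exact: measurable_funX.
have r0 (z : T * measurableTypeR R) : (0 <= W z.1 ^+ 2)%R by exact: sqr_ge0.
have mM : measurable_fun setT (fun z : T * measurableTypeR R => (W z.1 * z.2)%R : measurableTypeR R).
  exact: measurable_funM.
have [rho rhoE] := weighted_measure (P \x pi) mr r0.
have [mu [_ muE]] := image_measure rho mM.
exists mu => h nh; have [mh h0] := nh.
have mhM : measurable_fun setT (fun z : T * measurableTypeR R => h (W z.1 * z.2)%R).
  exact: measurableT_comp.
rewrite muE// rhoE//.
rewrite (fubini_tonelli1 (m1 := P) (m2 := pi) (fun z => (W z.1 ^+ 2)%:E * h (W z.1 * z.2)%R))//=; last 2 first.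
- by apply: emeasurable_funM => //; exact/measurable_EFinP.
- by move=> z; rewrite mule_ge0// lee_fin.
apply: eq_integral => x _; rewrite /fubini_F/= piE// ge0_integralZl//.
- exact: measurableT_comp.
- by rewrite lee_fin sqr_ge0.
Qed.

Section positive_side.
Variables (W : T -> R) (V : T' -> R) (s : R).
Hypotheses (mW : measurable_fun setT W) (mV : measurable_fun setT V).
Hypotheses (s0 : (0 < s)%R) (EW2 : \int[P]_x ((W x) ^+ 2)%:E = s%:E).
Hypotheses (VW : 'V_P[W] = s%:E) (hV : zero_biased n P W P' V).

Lemma integrable_sqr : P.-integrable setT (fun x => ((W x) ^+ 2)%:E).
Proof.
apply/integrableP; split; first by apply/measurable_EFinP; exact: measurable_funX.
under eq_integral do rewrite gee0_abs ?lee_fin ?sqr_ge0//.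
by rewrite EW2 ltry.
Qed.

(** The zero bias identity for the solution of A_n f = h given by [test_fun]. *)
Lemma test_identity w h : (0 < w)%R -> right_supported w h ->
  \int[P]_x (((W x) ^+ 2)%:E * iter n avg (EFin \o h) (W x)) =
  s%:E * \int[P']_y (h (V y))%:E.
Proof.
move=> w0 hw.
have [ca a01 _] := right_supported_iter_ravg n w0 hw.
have [ch h01 _] := hw.
have fE x : (W x * test_fun n h (W x))%R = (W x ^+ 2 * iter n ravg h (W x))%R.
  by rewrite /test_fun mulrA -expr2.
have := hV (@n_differentiable_test_fun R w n h w0 hw).
rewrite (opA_test_fun hn w0 hw) !expectationE VW => <-.
- by apply: eq_integral => x _; rewrite (iter_avg_ravg n w0 hw)/= -EFinM -fE.
- rewrite (_ : (fun x => _) = (fun x => (W x ^+ 2 * iter n ravg h (W x))%:E)); last first.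
    by apply/funext => x; rewrite fE.
  apply: (le_integrable measurableT _ _ integrable_sqr).
    apply/measurable_EFinP; apply: measurable_funM; first exact: measurable_funX.
    by apply: measurableT_comp => //; exact: continuous_measurable_fun.
  move=> x _; rewrite !abse_EFin lee_fin normrM ler_piMr//.
  by have /andP[H0 H1] := a01 (W x); rewrite ger0_norm.
- apply: measurable_bounded_integrable => //.
  + by rewrite -ge0_fin_numE ?fin_num_measure.
  + by apply: measurableT_comp => //; exact: continuous_measurable_fun.
  + exists 1%R; split => // M M1 y _ /=.
    by have /andP[H0 H1] := h01 (V y); rewrite ger0_norm// (le_trans H1)// ltW.
Qed.

(** Both sides are measures of A; [test_identity] along [ramp] shows that they agree
on the rays ]w, +oo[ with w > 0. *)
Lemma positive_side (A : set R) : measurable A -> A `<=` `]0%R, +oo[ ->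
  s%:E * P' (V @^-1` A) =
  \int[P]_x (((W x) ^+ 2)%:E * iter n avg (fun z => (\1_A z)%:E) (W x)).
Proof.
move=> mA A0.
have [mu muE] := squared_average_measure mW.
have mV' : measurable_fun setT (V : T' -> measurableTypeR R) by [].
have [nu [nuE nuI]] := image_measure P' mV'.
pose sn : {nonneg R} := NngNum (ltW s0).
pose nus := [the {measure set (measurableTypeR R) -> \bar R} of mscale sn nu].
rewrite -muE; last exact: nonneg_measurable_indic.
rewrite integral_indic// setIT -nuE.
rewrite -[LHS]/(nus A) -(setIidl A0).
apply: measure_pos_unique => //.
  rewrite /nus/= /mscale/= nuE; change (s%:E * P' setT < +oo).
  by rewrite probability_setT mule1 ltry.
move=> w w0.
have H1 := @integral_ramp_cvg R w nus; have H2 := @integral_ramp_cvg R w mu.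
rewrite (_ : (fun _ => _) = (fun m => \int[mu]_x (ramp w m x)%:E)) in H1.
  exact: (cvg_unique _ H1 H2).
apply/funext => m; have rw := right_supported_ramp w m.
have [mr r0] := nonneg_measurable_right_supported rw.
rewrite /nus ge0_integral_mscale//; last by move=> x _; exact: r0.
rewrite nuI//= muE//.
by rewrite (test_identity w0 rw).
Qed.

End positive_side.

End representation.

(** The mass at 0 is what the total mass leaves. *)
Lemma measure_split_unique (R : realType)
    (N M : {measure set (measurableTypeR R) -> \bar R}) :
  (N setT < +oo)%E -> N setT = M setT ->
  (forall B : set (measurableTypeR R), measurable B -> B `<=` `]0, +oo[ -> N B = M B) ->
  (forall B : set (measurableTypeR R), measurable B -> B `<=` `]-oo, 0[ -> N B = M B) ->
  forall A : set (measurableTypeR R), measurable A -> N A = M A.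
Proof.
move=> Nfin NMT pos neg.
pose ps : set (measurableTypeR R) := `]0%R, +oo[%classic.
pose ng : set (measurableTypeR R) := `]-oo, 0%R[%classic.
pose z : set (measurableTypeR R) := [set 0].
have mps : measurable ps by exact: measurable_itv.
have mng : measurable ng by exact: measurable_itv.
have mz : measurable z by exact: measurable_set1.
have split (m : {measure set (measurableTypeR R) -> \bar R}) (B : set (measurableTypeR R)) :
    measurable B -> m B = (m (B `&` ng) + m (B `&` ps) + m (B `&` z))%E.
  move=> mB; rewrite -measureU; first 1 last.
  - exact: measurableI.
  - exact: measurableI.
  - apply/seteqP; split => // x [[_]]; rewrite /ng /ps /= !in_itv/= andbT => x0 [_] /(lt_trans x0).
    by rewrite ltxx.
  rewrite -measureU; first 1 last.
  - by apply: measurableU; exact: measurableI.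
  - exact: measurableI.
  - apply/seteqP; split => // x [[[_ xi]|[_ xi]] [_ xz]]; move: xi;
      by rewrite (xz : x = 0%R) /ng /ps /= in_itv/= ?andbT ltxx.
  congr (m _); apply/seteqP; split => x; rewrite /ng /ps /z /= !in_itv/= andbT.
    by move=> Bx; have [x0|x0|x0] := ltgtP x 0%R; [left; left|left; right|right].
  by move=> [[]|] [].
have Nps (B : set (measurableTypeR R)) : measurable B -> N (B `&` ps) = M (B `&` ps).
  by move=> mB; apply: pos; [exact: measurableI|exact: subIsetr].
have Nng (B : set (measurableTypeR R)) : measurable B -> N (B `&` ng) = M (B `&` ng).
  by move=> mB; apply: neg; [exact: measurableI|exact: subIsetr].
have N0 : N z = M z.
  have Kf : (M ng + M ps)%E \is a fin_num.
    rewrite -[ng]setTI -[ps]setTI -Nng// -Nps// fin_numD.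
    by rewrite !ge0_fin_numE// !(le_lt_trans _ Nfin)// le_measure ?inE//; exact: measurableI.
  have := NMT; rewrite (split N setT)// (split M setT)// Nps// Nng// !setTI.
  by move/(congr1 (fun u => u - (M ng + M ps))%E); rewrite ![(M ng + M ps + _)%E]addeC !addeK.
move=> A mA; rewrite (split N A)// (split M A)// Nps// Nng//; congr (_ + _)%E.
have [A0|A0] := pselect (A 0).
  by rewrite (_ : A `&` z = z)//; apply: setIidr => _ ->.
by rewrite (_ : A `&` z = set0) ?measure0//; apply/seteqP; split => // x [+ xz]; rewrite xz.
Qed.

Section law_of_zero_biased.
Context (R : realType) (n : nat) (hn : (0 < n)%N).
Context d (T : measurableType d) (P : probability T R).
Context d' (T' : measurableType d') (P' : probability T' R).
Variables (W : T -> R) (V : T' -> R).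
Hypotheses (hW : centered_nondegenerate P W) (mV : measurable_fun setT V).
Hypothesis (hV : zero_biased n P W P' V).
Local Open Scope ereal_scope.

(** [positive_side] for (W, V) and for (-W, -V) identifies the law of V on both
half-lines, and E W^2 = sigma^2 gives equality of the total masses. *)
Lemma zero_biased_law (A : set R) : measurable A ->
  (fine 'V_P[W])%:E * P' (V @^-1` A) =
  \int[P]_x (((W x) ^+ 2)%:E * iter n avg (fun z => (\1_A z)%:E) (W x)).
Proof.
have [mW s0 VW EW2] := centered_second_moment hW.
set s := fine 'V_P[W] in s0 VW EW2 *.
have [W2 _ _] := hW.
have pos := positive_side hn mW mV s0 EW2 VW hV.
have mNW : measurable_fun setT (fun x => (-1)%R * W x)%R by exact: measurable_funM.
have mNV : measurable_fun setT (fun x => (-1) * V x)%R by exact: measurable_funM.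
have N1 : (-1 : R)%R != 0%R by rewrite oppr_eq0 oner_eq0.
have EN2 : \int[P]_x (((-1) * W x) ^+ 2)%:E = s%:E.
  by rewrite -EW2; apply: eq_integral => x _; rewrite mulN1r sqrrN.
have VN : 'V_P[(fun x => (-1)%R * W x)%R] = s%:E.
  by rewrite variance_dilate// expr2 mulrNN mulr1 mul1e.
have neg := positive_side hn mNW mNV s0 EN2 VN (zero_biased_dilate hn hV W2 N1).
have [mu muE] := squared_average_measure n P mW.
have muA (B : set R) : measurable B -> \int[P]_x (((W x) ^+ 2)%:E * iter n avg (fun z => (\1_B z)%:E) (W x)) = mu B.
  by move=> mB; rewrite -muE; [rewrite integral_indic// setIT|exact: nonneg_measurable_indic].
have posE (B : set R) : measurable B -> B `<=` `]0%R, +oo[ -> s%:E * P' (V @^-1` B) = mu B.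
  by move=> mB B0; rewrite pos// muA.
have negE (B : set R) : measurable B -> B `<=` `]-oo, 0%R[ -> s%:E * P' (V @^-1` B) = mu B.
  move=> mB B0; pose NB := (fun x : R => (-1) * x)%R @^-1` B.
  have mN : measurable_fun setT (fun x : R => (-1) * x)%R by exact: measurable_funM.
  have mNB : measurable NB by rewrite -[NB]setTI; exact: mN.
  have -> : V @^-1` B = (fun x => (-1) * V x)%R @^-1` NB.
    apply/seteqP; split => y By; first by rewrite /preimage/= /NB/= mulrA mulrNN mulr1 mul1r.
    by move: By; rewrite /preimage/= /NB/= mulrA mulrNN mulr1 mul1r.
  rewrite neg//; last first.
    move=> x Bx; have := B0 _ Bx.
    by rewrite /= !in_itv/= andbT mulN1r oppr_lt0.
  have NBE : (fun z => (\1_NB ((-1) * z)%R)%:E) = (fun z => (\1_B z)%:E) :> (R -> \bar R).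
    apply/funext => z; rewrite !indicE; have -> // : ((-1) * z)%R \in NB = (z \in B).
    by apply/idP/idP; rewrite !inE /NB/= mulrA mulrNN mulr1 mul1r.
  by rewrite -muA//; apply: eq_integral => x _; rewrite -iter_avg_dilate NBE mulN1r sqrrN.
have mV' : measurable_fun setT (V : T' -> measurableTypeR R) by [].
have [nu [nuE nuI]] := image_measure P' mV'.
pose sn : {nonneg R} := NngNum (ltW s0).
pose nus := [the {measure set (measurableTypeR R) -> \bar R} of mscale sn nu].
have nusT : nus setT = s%:E.
  rewrite /nus/= /mscale/= nuE; change (s%:E * P' setT = s%:E).
  by rewrite probability_setT mule1.
move=> mA; rewrite muA// -nuE -[LHS]/(nus A).
apply: measure_split_unique => //.
- by rewrite nusT ltry.
- rewrite nusT -muA// -EW2.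
  apply: eq_integral => x _; rewrite (_ : (fun z => _) = fun=> 1).
    by rewrite iter_avg1 mule1.
  by apply/funext => z; rewrite indicT.
- by move=> B mB B0; rewrite -posE// /nus/= /mscale/= nuE.
- by move=> B mB B0; rewrite -negE// /nus/= /mscale/= nuE.
Qed.

(** V is distributed as W U under the tilted law W^2 / sigma^2 dP, where U is a
product of n independent uniform variables. *)
Lemma zero_biased_integral (h : R -> \bar R) : nonneg_measurable h ->
  (fine 'V_P[W])%:E * \int[P']_y h (V y) =
  \int[P]_x (((W x) ^+ 2)%:E * iter n avg h (W x)).
Proof.
move=> nh; have [mh h0] := nh.
have [mW s0 VW EW2] := centered_second_moment hW.
have [mu muE] := squared_average_measure n P mW.
have mV' : measurable_fun setT (V : T' -> measurableTypeR R) by [].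
have [nu [nuE nuI]] := image_measure P' mV'.
pose sn : {nonneg R} := NngNum (ltW s0).
set s := fine _ in s0 sn *.
rewrite -muE// -nuI// -[X in X%:E * _]/(sn%:num) -ge0_integral_mscale//.
apply: eq_measure_integral => A mA _.
rewrite -[LHS]/(s%:E * nu A) nuE zero_biased_law//.
by rewrite -muE; [rewrite integral_indic// setIT|exact: nonneg_measurable_indic].
Qed.
End law_of_zero_biased.

(** * Moments *)

Section moments.
Context (R : realType) (n : nat) (hn : (0 < n)%N).
Context d (T : measurableType d) (P : probability T R).
Context d' (T' : measurableType d') (P' : probability T' R).
Variables (W : T -> R) (V : T' -> R).
Hypotheses (hW : centered_nondegenerate P W) (mV : measurable_fun setT V).
Hypothesis (hV : zero_biased n P W P' V).
Local Open Scope ereal_scope.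
Let s : R := fine 'V_P[W].

Lemma zero_biased_homogeneous (h : R -> \bar R) (p : R) : (0 <= p)%R -> nonneg_measurable h ->
  (forall x u : R, (0 <= u <= 1)%R -> h (x * u)%R = (u `^ p)%:E * h x) ->
  \int[P']_y h (V y) = ((s * (p + 1) ^+ n)^-1)%:E * \int[P]_x (((W x) ^+ 2)%:E * h (W x)).
Proof.
move=> p0 nh hp; have [mh h0] := nh.
have [mW s0 VW EW2] := centered_second_moment hW.
have p1 : (0 < p + 1)%R by rewrite ltr_wpDl.
rewrite invfM EFinM -muleA -ge0_integralZl//; last 3 first.
- by apply: emeasurable_funM; [apply/measurable_EFinP; exact: measurable_funX|exact: measurableT_comp].
- by move=> x _; rewrite mule_ge0// lee_fin sqr_ge0.
- by rewrite lee_fin invr_ge0 exprn_ge0// ltW.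
under eq_integral do rewrite muleCA -(iter_avg_homogeneous n p0 nh hp).
by rewrite -(zero_biased_integral hn hW mV hV nh) muleA -EFinM mulVf ?mul1e// gt_eqF.
Qed.

(** In the case x = y = +oo both sides are -oo. *)
Lemma posr_muleBr (k : R) (x y : \bar R) : (0 < k)%R ->
  k%:E * (x - y) = k%:E * x - k%:E * y.
Proof.
move=> k0; case: x => [x||]; case: y => [y||] /=;
  rewrite ?(gt0_muley, gt0_muleNy) ?lte_fin//=.
by rewrite -[LHS]/((k * (x - y))%:E) mulrBr.
Qed.

(** The positive and negative parts of x^p are both homogeneous of degree p, and
the identity is proved for each of them; this covers infinite moments, and odd
moments for which both parts are infinite. *)
Lemma zero_biased_moment (p : nat) :
  'E_P'[fun y => (V y ^+ p)%R] =
  'E_P[fun x => (W x ^+ (p + 2))%R] / (s * (p%:R + 1) ^+ n)%:E.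
Proof.
have [mW s0 VW EW2] := centered_second_moment hW.
have p1 : (0 < p%:R + 1 :> R)%R by rewrite ltr_wpDl.
have K0 : (0 < s * (p%:R + 1) ^+ n)%R by rewrite mulr_gt0// exprn_gt0.
have mX : measurable_fun [set: R] (fun x : R => x ^+ p)%R by exact: measurable_funX.
have hom (e : R) (x u : R) : (0 <= u <= 1)%R ->
    maxe (e * (x * u) ^+ p)%:E 0 = (u `^ p%:R)%:E * maxe (e * x ^+ p)%:E 0.
  move=> /andP[u0 _]; rewrite powR_mulrn// -!EFin_max -EFinM maxr_pMr ?exprn_ge0// mulr0.
  by rewrite exprMn mulrA mulrC.
have nm (e : R) : nonneg_measurable (fun x => maxe (e * x ^+ p)%:E 0).
  split; last by move=> x; rewrite le_max lexx orbT.
  apply: measurable_maxe => //; apply/measurable_EFinP; exact: measurable_funM.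
have part (e : R) : \int[P']_y maxe (e * V y ^+ p)%:E 0 =
    ((s * (p%:R + 1) ^+ n)^-1)%:E * \int[P]_x maxe (e * W x ^+ (p + 2))%:E 0.
  rewrite (zero_biased_homogeneous _ (nm e) (hom e))//; congr (_ * _).
  apply: eq_integral => x _; rewrite -!EFin_max -EFinM maxr_pMr ?sqr_ge0// mulr0.
  by rewrite exprD mulrCA [(W x ^+ p * _)%R]mulrC.
rewrite !expectationE inver (gt_eqF K0) muleC integralE [in RHS]integralE.
rewrite posr_muleBr ?invr_gt0//; congr (_ - _).
- transitivity (\int[P']_y maxe (1 * V y ^+ p)%R%:E 0).
    by apply: eq_integral => y _; rewrite funeposE mul1r.
  by rewrite part; congr (_ * _); apply: eq_integral => x _; rewrite funeposE mul1r.
- transitivity (\int[P']_y maxe (-1 * V y ^+ p)%R%:E 0).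
    by apply: eq_integral => y _; rewrite funenegE mulN1r.
  by rewrite part; congr (_ * _); apply: eq_integral => x _; rewrite funenegE mulN1r.
Qed.

Lemma zero_biased_abs_moment (p : R) : (0 <= p)%R ->
  'E_P'[fun y => (`|V y| `^ p)%R] =
  'E_P[fun x => (`|W x| `^ (p + 2))%R] / (s * (p + 1) ^+ n)%:E.
Proof.
move=> p0.
have [mW s0 VW EW2] := centered_second_moment hW.
have p1 : (0 < p + 1 :> R)%R by rewrite ltr_wpDl.
have K0 : (0 < s * (p + 1) ^+ n)%R by rewrite mulr_gt0// exprn_gt0.
rewrite !expectationE inver (gt_eqF K0) muleC.
rewrite (@zero_biased_homogeneous (fun x => (`|x| `^ p)%:E) p)//.
- congr (_ * _); apply: eq_integral => x _; rewrite -EFinM powRD; last first.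
    by rewrite gt_eqF// ltr_wpDl.
  by rewrite powR_mulrn// real_normK ?num_real// mulrC.
- split; last by move=> x; rewrite lee_fin powR_ge0.
  apply/measurable_EFinP; apply: (measurableT_comp (measurable_powR p)).
  exact: normr_measurable.
- by move=> x u /andP[u0 u1]; rewrite -EFinM normrM powRM// mulrC (ger0_norm u0).
Qed.
End moments.

(** * Products of independent variables *)

Section pair_independence.
Context d (T : measurableType d) (R : realType) (P : probability T R).
Local Open Scope ereal_scope.

Lemma law_measure (Y : T -> R) : measurable_fun setT Y ->
  exists nu : probability (measurableTypeR R) R,
    (forall A, nu A = P (Y @^-1` A)) /\
    forall h : R -> \bar R, nonneg_measurable h -> \int[nu]_y h y = \int[P]_x h (Y x).
Proof.
move=> mY; have mY' : measurable_fun setT (Y : T -> measurableTypeR R) by [].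
pose Y' : {mfun T >-> measurableTypeR R} := HB.pack (Y : T -> measurableTypeR R)
  (isMeasurableFun.Build _ _ _ _ _ mY').
exists (distribution P Y'); split => // h [mh h0].
by rewrite ge0_integral_distribution.
Qed.

(** Here e is the probability of E. The two sides are finite measures that agree on
rectangles. *)
Lemma joint_law_on_event (Y X : T -> R) (nuY nuX : probability (measurableTypeR R) R)
    (E : set T) (e : {nonneg R}) :
  measurable_fun setT Y -> measurable_fun setT X -> measurable E ->
  (forall B A : set (measurableTypeR R), measurable B -> measurable A ->
    P (Y @^-1` B `&` X @^-1` A `&` E) = e%:num%:E * nuY B * nuX A) ->
  forall C : set (measurableTypeR R * measurableTypeR R), measurable C ->
    P ((fun t => (Y t, X t)) @^-1` C `&` E) = e%:num%:E * (nuY \x nuX) C.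
Proof.
move=> mY mX mE ind C mC.
have mYX : measurable_fun setT (fun t => (Y t, X t) : measurableTypeR R * measurableTypeR R).
  exact: measurable_fun_pair.
have [m' [m'E _]] := image_measure [the {measure set T -> \bar R} of mrestr P mE] mYX.
pose m1 := [the {sigma_finite_measure set (measurableTypeR R) -> \bar R} of mscale e nuY].
have := @product_measure_unique _ _ _ _ R m1 nuX m' _ C mC.
rewrite -[m' C]/(m' C) m'E /= /mrestr => <-.
  rewrite /product_measure1 /m1 ge0_integral_mscale//.
  exact: measurable_fun_xsection.
move=> A B mA mB; rewrite m'E /= /mrestr -ind//; congr (P _).
Qed.

Lemma independent_pair_integral (Y X : T -> R) :
  measurable_fun setT Y -> measurable_fun setT X ->
  (forall B A : set (measurableTypeR R), measurable B -> measurable A ->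
    P (Y @^-1` B `&` X @^-1` A) = P (Y @^-1` B) * P (X @^-1` A)) ->
  forall H : measurableTypeR R * measurableTypeR R -> \bar R,
    measurable_fun setT H -> (forall z, 0 <= H z) ->
    \int[P]_t H (Y t, X t) = \int[P]_t \int[P]_u H (Y t, X u).
Proof.
move=> mY mX ind H mH H0.
have [nuY [nuYE nuYI]] := law_measure mY; have [nuX [nuXE nuXI]] := law_measure mX.
have mYX : measurable_fun setT (fun t => (Y t, X t) : measurableTypeR R * measurableTypeR R).
  exact: measurable_fun_pair.
have [m' [m'E m'I]] := image_measure P mYX.
rewrite -m'I//.
have m'P C : measurable C -> m' C = (nuY \x nuX) C.
  move=> mC; pose e1 : {nonneg R} := NngNum (@ler01 R).
  have J (B A : set (measurableTypeR R)) : measurable B -> measurable A ->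
      P (Y @^-1` B `&` X @^-1` A `&` setT) = e1%:num%:E * nuY B * nuX A.
    by move=> mB mA; rewrite setIT mul1e ind// nuYE nuXE.
  have := joint_law_on_event mY mX measurableT J mC.
  by rewrite setIT mul1e m'E.
transitivity (\int[nuY \x nuX]_z H z).
  by apply: eq_measure_integral => C mC _; exact: m'P.
rewrite fubini_tonelli1//= nuYI; last first.
  split; last by move=> y; apply: integral_ge0.
  exact: measurable_fun_fubini_tonelli_F.
apply: eq_integral => t _; rewrite /fubini_F nuXI//.
split => //; exact: measurableT_comp.
Qed.
End pair_independence.

Section partial_products.
Context d (T : measurableType d) (R : realType) (P : probability T R).
Context (n : nat) (X : 'I_n -> T -> R).
Hypotheses (mX : forall k, measurable_fun setT (X k)) (indX : mutually_independent P X).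
Local Open Scope ereal_scope.

(** Restricting the range of k, rather than the index type, keeps the family of
variables fixed along an induction on m. *)
Definition partial_prod (m : nat) (x : T) : R := (\prod_(k < n | (k < m)%N) X k x)%R.

Lemma partial_prod0 x : partial_prod 0 x = 1%R.
Proof. by rewrite /partial_prod big_pred0. Qed.

Lemma partial_prod_full x : partial_prod n x = (\prod_(k < n) X k x)%R.
Proof. by apply: eq_bigl => k; rewrite ltn_ord. Qed.

Lemma partial_prodS m (hm : (m < n)%N) x :
  partial_prod m.+1 x = (partial_prod m x * X (Ordinal hm) x)%R.
Proof.
rewrite /partial_prod (bigD1 (Ordinal hm)) ?ltnSn//= mulrC; congr (_ * _)%R.
by apply: eq_bigl => k; rewrite -val_eqE/= ltnS ltn_neqAle andbC.
Qed.

Lemma measurable_partial_prod m : measurable_fun setT (partial_prod m).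
Proof.
rewrite (_ : partial_prod m = fun x => (\prod_(k <- enum 'I_n | (k < m)%N) X k x)%R).
  under eq_fun do rewrite -big_filter; exact: measurable_prod.
by apply/funext => x; rewrite big_enum_cond.
Qed.

Let tail_event (m : nat) (A : 'I_n -> set R) : set T :=
  \bigcap_(k in [set k : 'I_n | (m <= k)%N]) (X k @^-1` A k).

Let measurable_tail_event m A : (forall k, measurable (A k)) -> measurable (tail_event m A).
Proof.
move=> mA; apply: fin_bigcap_measurable => // k _.
by rewrite -[X in measurable X]setTI; exact: mX.
Qed.

Let tail_eventE m A : (forall k, measurable (A k)) ->
  P (tail_event m A) = \prod_(k < n | (m <= k)%N) P (X k @^-1` A k).
Proof.
move=> mA; have := @indX (finset (fun k : 'I_n => (m <= k)%N)) A mA.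
rewrite (eq_bigl (fun k : 'I_n => (m <= k)%N)); last by move=> k; rewrite inE.
move=> <-; rewrite /tail_event.
have -> // : [set k : 'I_n | (m <= k)%N] = [set` finset (fun k : 'I_n => (m <= k)%N)].
by apply/seteqP; split => k /=; rewrite inE.
Qed.

(** The events that concern the variables of index at least m are carried along:
at each step one of these variables moves into the partial product, and
[joint_law_on_event] gives its joint law with that product on the event that
concerns the remaining variables. *)
Lemma partial_prod_tail_independent m : (m <= n)%N ->
  forall (B : set R) (A : 'I_n -> set R), measurable B -> (forall k, measurable (A k)) ->
    P (partial_prod m @^-1` B `&` tail_event m A) =
    P (partial_prod m @^-1` B) * P (tail_event m A).
Proof.
elim: m => [_|m IH hm] B A mB mA.
  have [B1|B1] := pselect (B 1%R).
    rewrite (_ : partial_prod 0 @^-1` B = setT) ?setTI ?probability_setT ?mul1e//.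
    by apply/seteqP; split => // x _; rewrite /= partial_prod0.
  rewrite (_ : partial_prod 0 @^-1` B = set0) ?set0I ?measure0 ?mul0e//.
  by apply/seteqP; split => // x /=; rewrite partial_prod0.
pose i := Ordinal hm; have mE := measurable_tail_event m.+1 mA.
pose e : {nonneg R} := NngNum (fine_ge0 (measure_ge0 P (tail_event m.+1 A))).
have eE : e%:num%:E = P (tail_event m.+1 A) by rewrite /= fineK// fin_num_measure.
have [nuY [nuYE nuYI]] := law_measure P (measurable_partial_prod m).
have [nuX [nuXE nuXI]] := law_measure P (mX i).
have ev (C D : set R) (F : 'I_n -> set R) : measurable C -> measurable D -> (forall k, measurable (F k)) ->
    P (partial_prod m @^-1` C `&` X i @^-1` D `&` tail_event m.+1 F) =
    P (tail_event m.+1 F) * P (partial_prod m @^-1` C) * P (X i @^-1` D).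
  (* the condition on X i is absorbed into the family of conditions of index at least m *)
  move=> mC mD mF; pose G k := if k == i then D else F k.
  have mG k : measurable (G k) by rewrite /G; case: ifP.
  have tG : tail_event m G = X i @^-1` D `&` tail_event m.+1 F.
    apply/seteqP; split => x.
      move=> H; split; first by have := H i; rewrite /G eqxx; apply => /=.
      move=> k /= mk; have := H k; rewrite /G ifF; first by apply; exact: ltnW.
      by apply/negbTE; rewrite -val_eqE/= gtn_eqF.
    move=> [HD HF] k /= mk; rewrite /G; case: eqVneq => [->//|ki].
    by apply: HF => /=; rewrite ltn_neqAle mk andbT eq_sym -[m]/(val i) val_eqE.
  rewrite -setIA -tG IH//; last exact: ltnW.
  rewrite [RHS]muleAC [RHS]muleC; congr (_ * _).
  rewrite !tail_eventE// (bigD1 i)//= muleC /G eqxx; congr (_ * _).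
  rewrite (eq_bigl (fun k : 'I_n => (m < k)%N)); last first.
    by move=> k; rewrite -val_eqE/= ltn_neqAle eq_sym andbC.
  apply: eq_bigr => k mk; rewrite ifF//.
  by apply/negbTE; rewrite -val_eqE/= gtn_eqF.
have mM : measurable_fun setT (fun z : measurableTypeR R * measurableTypeR R => (z.1 * z.2)%R).
  by apply: measurable_funM.
have mC : measurable ((fun z : measurableTypeR R * measurableTypeR R => (z.1 * z.2)%R) @^-1` B).
  by rewrite -[X in measurable X]setTI; exact: mM.
have J1 (C D : set (measurableTypeR R)) : measurable C -> measurable D ->
    P (partial_prod m @^-1` C `&` X i @^-1` D `&` tail_event m.+1 A) = e%:num%:E * nuY C * nuX D.
  by move=> mC' mD; rewrite ev// nuYE nuXE eE.
pose e1 : {nonneg R} := NngNum (@ler01 R).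
have J2 (C D : set (measurableTypeR R)) : measurable C -> measurable D ->
    P (partial_prod m @^-1` C `&` X i @^-1` D `&` setT) = e1%:num%:E * nuY C * nuX D.
  (* the case where the remaining variables are unconstrained *)
  move=> mC' mD; have := @ev C D (fun=> setT) mC' mD (fun=> measurableT).
  rewrite (_ : tail_event _ _ = setT); last by apply/seteqP; split.
  by rewrite probability_setT nuYE nuXE.
have H1 := joint_law_on_event (measurable_partial_prod m) (mX i) mE J1 mC.
have H2 := joint_law_on_event (measurable_partial_prod m) (mX i) measurableT J2 mC.
have BE : partial_prod m.+1 @^-1` B = (fun t => (partial_prod m t, X i t)) @^-1`
    ((fun z : measurableTypeR R * measurableTypeR R => (z.1 * z.2)%R) @^-1` B).
  by apply/seteqP; split => x; rewrite /preimage/= (partial_prodS hm).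
rewrite BE H1 eE muleC; congr (_ * _); move: H2; rewrite setIT mul1e => H2.
by rewrite -H2.
Qed.

Lemma partial_prod_independent m (hm : (m < n)%N) (B A : set (measurableTypeR R)) :
  measurable B -> measurable A ->
  P (partial_prod m @^-1` B `&` X (Ordinal hm) @^-1` A) =
  P (partial_prod m @^-1` B) * P (X (Ordinal hm) @^-1` A).
Proof.
move=> mB mA; pose F (k : 'I_n) := if k == Ordinal hm then A else setT.
have mF k : measurable (F k) by rewrite /F; case: ifP.
have := partial_prod_tail_independent (ltnW hm) mB mF.
rewrite (_ : tail_event m F = X (Ordinal hm) @^-1` A)//.
apply/seteqP; split => x; first by move=> /(_ (Ordinal hm)); rewrite /F eqxx; apply => /=.
by move=> xA k _; rewrite /F; case: eqVneq => [->|].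
Qed.

End partial_products.

Section transfer.
Context (R : realType) (n : nat) (hn : (0 < n)%N).
Context d (T : measurableType d) (P : probability T R) (W : T -> R).
Context d' (T' : measurableType d') (P' : probability T' R) (V : T' -> R).
Context d'' (T'' : measurableType d'') (P'' : probability T'' R) (Z : T'' -> R).
Hypotheses (mV : measurable_fun setT V) (mZ : measurable_fun setT Z).
Local Open Scope ereal_scope.
Hypothesis VZ : forall h : R -> \bar R, nonneg_measurable h -> \int[P']_y h (V y) = \int[P'']_z h (Z z).

Lemma same_law_eq_distribution : eq_distribution P' V P'' Z.
Proof.
move=> A mA; have := VZ (nonneg_measurable_indic mA).
have mVA : measurable (V @^-1` A) by rewrite -[X in measurable X]setTI; exact: mV.
have mZA : measurable (Z @^-1` A) by rewrite -[X in measurable X]setTI; exact: mZ.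
have -> : (fun y => (\1_A (V y))%:E) = (fun y => (\1_(V @^-1` A) y)%:E) :> (T' -> \bar R).
  by apply/funext => y; rewrite !indicE; congr ((_ : bool)%:R%:E); apply/idP/idP; rewrite !inE.
have -> : (fun y => (\1_A (Z y))%:E) = (fun y => (\1_(Z @^-1` A) y)%:E) :> (T'' -> \bar R).
  by apply/funext => y; rewrite !indicE; congr ((_ : bool)%:R%:E); apply/idP/idP; rewrite !inE.
by rewrite !integral_indic// !setIT.
Qed.

(** Zero biasing is a property of the law of V, as A_n f is measurable. *)
Lemma same_law_zero_biased : zero_biased n P W P' V -> zero_biased n P W P'' Z.
Proof.
move=> hV f nf iW iZ; have mg := measurable_opA hn nf.
set g := opA n f in mg iZ *.
have mgE : measurable_fun setT (fun x : R => (g x)%:E) by exact/measurable_EFinP.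
have np : nonneg_measurable (fun x => maxe (g x)%:E 0).
  by split; [exact: measurable_maxe|move=> x; rewrite le_max lexx orbT].
have nn : nonneg_measurable (fun x => maxe (- (g x)%:E) 0).
  split; last by move=> x; rewrite le_max lexx orbT.
  by apply: measurable_maxe => //; apply: (measurableT_comp (f := -%E)).
have na : nonneg_measurable (fun x => `|(g x)%:E|) by split => //; exact: measurableT_comp.
have iV : P'.-integrable setT (fun y => (g (V y))%:E).
  apply/integrableP; split; first by apply/measurable_EFinP; exact: measurableT_comp.
  by rewrite (VZ na); move/integrableP : iZ => [].
rewrite hV//; congr (_ * _).
rewrite !expectationE integralE [RHS]integralE; congr (_ - _).
- transitivity (\int[P']_y maxe (g (V y))%:E 0).
    by apply: eq_integral => y _; rewrite funeposE.
  by rewrite (VZ np); apply: eq_integral => z _; rewrite funeposE.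
- transitivity (\int[P']_y maxe (- (g (V y))%:E) 0).
    by apply: eq_integral => y _; rewrite funenegE.
  by rewrite (VZ nn); apply: eq_integral => z _; rewrite funenegE.
Qed.
End transfer.

Section zero_biased_product.
Context (R : realType) (n : nat) (hn : (0 < n)%N).
Context d (T : measurableType d) (P : probability T R) (Wk : 'I_n -> T -> R).
Context d'' (T'' : measurableType d'') (P'' : probability T'' R) (Ws : 'I_n -> T'' -> R).
Hypotheses (mW : forall k, measurable_fun setT (Wk k)) (mWs : forall k, measurable_fun setT (Ws k)).
Hypotheses (indW : mutually_independent P Wk) (indWs : mutually_independent P'' Ws).
Hypothesis (cW : forall k, centered_nondegenerate P (Wk k)).
Hypothesis (hWs : forall k, zero_biased 1 P (Wk k) P'' (Ws k)).
Local Open Scope ereal_scope.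

(** By induction on m, with c the product of the first m variances. With the new
factor frozen, the induction hypothesis applies to a dilation of h; with the
old factors frozen, the zero bias identity of the new factor applies to a
dilation of avg^m h and yields avg^(m+1) h. Independence allows both. *)
Lemma zero_biased_partial_prod m : (m <= n)%N -> exists2 c : R, (0 < c)%R &
  forall h : R -> \bar R, nonneg_measurable h ->
    c%:E * \int[P'']_z h (partial_prod Ws m z) =
    \int[P]_x (((partial_prod Wk m x) ^+ 2)%:E * iter m avg h (partial_prod Wk m x)).
Proof.
elim: m => [_|m IH hm].
  exists 1%R => // h _; rewrite mul1e.
  under eq_integral do rewrite partial_prod0.
  under [RHS]eq_integral do rewrite partial_prod0 expr1n mul1e/=.
  rewrite !integral_cst//; congr (_ * _).
  by transitivity (1 : \bar R); [exact: probability_setT|exact/esym/probability_setT].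
have [c c0 IHc] := IH (ltnW hm).
set i := Ordinal hm; set s := fine 'V_P[Wk i].
have [mWi s0 VW EW2] := centered_second_moment (cW i).
exists (c * s)%R; first by rewrite mulr_gt0.
move=> h nh; have [mh h0] := nh; have nI := nonneg_measurable_iter_avg m nh; have [mI I0] := nI.
have nIS := nonneg_measurable_iter_avg m.+1 nh; have [mIS IS0] := nIS.
have mY := measurable_partial_prod mW m; have mYs := measurable_partial_prod mWs m.
under eq_integral do rewrite (partial_prodS _ hm).
under [RHS]eq_integral do rewrite (partial_prodS _ hm).
have mM2 : measurable_fun setT (fun z : measurableTypeR R * measurableTypeR R => (z.1 * z.2)%R).
  by apply: measurable_funM.
have ind1 := @partial_prod_independent _ _ _ P n Wk mW indW m hm.
have ind2 := @partial_prod_independent _ _ _ P'' n Ws mWs indWs m hm.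
rewrite (independent_pair_integral mYs (mWs i) ind2 (H := fun z => h (z.1 * z.2)%R))//=; last first.
  exact: measurableT_comp.
rewrite (independent_pair_integral mY (mW i) ind1
  (H := fun z => ((z.1 * z.2) ^+ 2)%:E * iter m.+1 avg h (z.1 * z.2)%R))//=; first last.
- by move=> z; rewrite mule_ge0 ?lee_fin ?sqr_ge0//; exact: (IS0 (z.1 * z.2)%R).
- apply: emeasurable_funM; last exact: measurableT_comp.
  by apply/measurable_EFinP; exact: measurable_funX.
have mH1 : measurable_fun setT (fun z : T'' * T'' => h (partial_prod Ws m z.1 * Ws i z.2)%R).
  apply: measurableT_comp => //; apply: measurable_funM; exact: measurableT_comp.
have mH2 : measurable_fun setT (fun z : T'' * T =>
    ((partial_prod Wk m z.2) ^+ 2)%:E * iter m avg h (Ws i z.1 * partial_prod Wk m z.2)%R).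
  apply: emeasurable_funM.
    by apply/measurable_EFinP; apply: measurable_funX; exact: measurableT_comp.
  apply: measurableT_comp => //; apply: measurable_funM; exact: measurableT_comp.
rewrite (fubini_tonelli (m1 := P'') (m2 := P'')
  (fun z => h (partial_prod Ws m z.1 * Ws i z.2)%R))//=.
rewrite mulrC EFinM -muleA -ge0_integralZl//; last 3 first.
- exact: (measurable_fun_fubini_tonelli_G (m1 := P'') _ mH1).
- by move=> u _; exact: integral_ge0.
- by rewrite lee_fin ltW.
(* the induction hypothesis, with the value of the new factor frozen *)
have step1 u : c%:E * \int[P'']_t h (partial_prod Ws m t * Ws i u)%R =
    \int[P]_t (((partial_prod Wk m t) ^+ 2)%:E * iter m avg h (Ws i u * partial_prod Wk m t)%R).
  under eq_integral do rewrite mulrC.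
  rewrite (IHc (fun z => h (Ws i u * z)%R)); last first.
    by split => //; exact: measurableT_comp.
  by apply: eq_integral => t _; rewrite iter_avg_dilate.
under eq_integral do rewrite step1.
rewrite (fubini_tonelli (m1 := P'') (m2 := P)
  (fun z => ((partial_prod Wk m z.2) ^+ 2)%:E * iter m avg h (Ws i z.1 * partial_prod Wk m z.2)%R))//=;
  last by move=> z; rewrite mule_ge0// lee_fin sqr_ge0.
rewrite -ge0_integralZl//; last 3 first.
- apply: (measurable_fun_fubini_tonelli_G (m1 := P'') _ mH2).
  by move=> z; rewrite mule_ge0// lee_fin sqr_ge0.
- by move=> t _; apply: integral_ge0 => u _; rewrite mule_ge0// lee_fin sqr_ge0.
- by rewrite lee_fin ltW.
apply: eq_integral => t _.
have mIY : measurable_fun setT (fun z => iter m avg h (partial_prod Wk m t * z)%R).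
  exact: measurableT_comp.
rewrite ge0_integralZl//; last 2 first.
- by apply: measurableT_comp => //; exact: measurable_funM.
- by rewrite lee_fin sqr_ge0.
rewrite muleCA; under eq_integral do rewrite mulrC.
rewrite (@zero_biased_integral R 1 isT _ _ P _ _ P'' (Wk i) (Ws i) (cW i) (mWs i) (@hWs i)
  (fun z => iter m avg h (partial_prod Wk m t * z)%R))//.
rewrite -ge0_integralZl//=; last 3 first.
- apply: emeasurable_funM; first by apply/measurable_EFinP; exact: measurable_funX.
  by apply: (measurableT_comp _ (mWi)); have [] := nonneg_measurable_avg (h := fun z => iter m avg h (partial_prod Wk m t * z)%R).
- move=> v _; rewrite mule_ge0// ?lee_fin ?sqr_ge0//; exact: integral_ge0.
- by rewrite lee_fin sqr_ge0.
by apply: eq_integral => v _; rewrite avg_dilate muleA -EFinM -exprMn.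
Qed.
End zero_biased_product.

(** * The density *)

Section signed_kernel.
Context {R : realType}.
Local Open Scope ereal_scope.

Lemma integral_lebesgueN (h : R -> \bar R) : nonneg_measurable h ->
  \int[lebesgue_measure]_s h (- s)%R = \int[lebesgue_measure]_s h s.
Proof.
move=> [mh h0].
have mN : measurable_fun setT (-%R : measurableTypeR R -> measurableTypeR R) by exact: oppr_measurable.
have [m' [m'E m'I]] := image_measure lebesgue_measure mN.
rewrite -(m'I h)//; apply: eq_measure_integral => A mA _.
by rewrite m'E -[RHS]lebesgue_measureN.
Qed.

(** The density of a U at w times a^2, for a product U of m + 1 uniform variables. *)
Definition signed_kernel m (a w : R) : R :=
  (`|a| * (if 0 <= a then log_kernel m a w else log_kernel m (- a) (- w)))%R.

Lemma signed_kernel_ge0 m a w : (0 <= signed_kernel m a w)%R.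
Proof. by rewrite mulr_ge0//; case: ifP => _; exact: log_kernel_ge0. Qed.

Lemma measurable_signed_kernel m : measurable_fun setT
  (fun z : measurableTypeR R * measurableTypeR R => signed_kernel m z.1 z.2).
Proof.
apply: measurable_funM.
  by apply: measurableT_comp => //; exact: measurable_fst.
apply: measurable_fun_if => //.
- by apply: measurable_fun_ler => //; exact: measurable_fst.
- by apply: measurable_funTS; exact: measurable_log_kernel.
- apply: measurable_funTS.
  apply: (measurableT_comp (measurable_log_kernel m)
    (g := fun z : measurableTypeR R * measurableTypeR R => (- z.1, - z.2)%R)).
  apply: measurable_fun_pair.
    exact: (measurableT_comp (@oppr_measurable R setT) measurable_fst).
  exact: (measurableT_comp (@oppr_measurable R setT) measurable_snd).
Qed.

Lemma signed_kernelN m a w : signed_kernel m (- a) (- w) = signed_kernel m a w.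
Proof.
rewrite /signed_kernel normrN oppr_ge0 !opprK.
have [a0|a0|->] := ltgtP a 0%R => //.
by rewrite normr0 !mul0r.
Qed.

(** For a > 0 this is [iter_avg_kernel]; for a < 0 it follows by reflection. *)
Lemma sqr_iter_avg m (h : R -> \bar R) (a : R) : nonneg_measurable h ->
  (a ^+ 2)%:E * iter m.+1 avg h a =
  \int[lebesgue_measure]_s (h s * (signed_kernel m a s)%:E).
Proof.
have pos (k : R -> \bar R) (b : R) : (0 < b)%R -> nonneg_measurable k -> (b ^+ 2)%:E * iter m.+1 avg k b =
    \int[lebesgue_measure]_s (k s * (signed_kernel m b s)%:E).
  move=> b0 nk; have [mk k0] := nk.
  rewrite expr2 EFinM -muleA iter_avg_kernel// -ge0_integralZl//; last 3 first.
  - apply: emeasurable_funM => //; apply/measurable_EFinP.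
    exact: (measurableT_comp (measurable_log_kernel m) (measurable_pair1 b)).
  - by move=> s _; rewrite mule_ge0// lee_fin log_kernel_ge0.
  - by rewrite lee_fin ltW.
  by apply: eq_integral => s _; rewrite /signed_kernel ltW// gtr0_norm// EFinM muleCA.
move=> nh; have [mh h0] := nh; have [a0|a0|->] := ltgtP a 0%R.
- have Na : (0 < - a)%R by rewrite oppr_gt0.
  have nNh : nonneg_measurable (fun z => h (-1 * z)%R).
    by split => //; apply: measurableT_comp => //; exact: measurable_funM.
  have := pos _ _ Na nNh; rewrite sqrrN iter_avg_dilate mulN1r opprK => ->.
  have nH : nonneg_measurable (fun s => h s * (signed_kernel m a s)%:E).
    split; last by move=> s; rewrite mule_ge0// lee_fin signed_kernel_ge0.
    apply: emeasurable_funM => //; apply/measurable_EFinP.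
    exact: (measurableT_comp (measurable_signed_kernel m) (measurable_pair1 a)).
  rewrite -(integral_lebesgueN nH); apply: eq_integral => s _.
  by rewrite mulN1r -[in RHS]signed_kernelN opprK.
- exact: pos.
- rewrite expr0n/= mul0e integral0_eq// => s _.
  by rewrite /signed_kernel normr0 mul0r mule0.
Qed.

Lemma signed_kernel_pos m a w : (0 < w)%R ->
  signed_kernel m a w = (if w <= a then a * ((ln a - ln w) ^+ m / m`!%:R) else 0)%R.
Proof.
move=> w0; rewrite /signed_kernel; have [wa|aw] := leP w a.
  have a0 := lt_le_trans w0 wa.
  by rewrite (ltW a0) gtr0_norm// /log_kernel w0 wa.
case: ifP => _; rewrite /log_kernel; first by rewrite w0 leNgt aw mulr0.
by rewrite oppr_gt0 ltNge (ltW w0) mulr0.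
Qed.

Lemma signed_kernel_neg m a w : (w < 0)%R ->
  signed_kernel m a w = (if a <= w then - a * ((ln (- a) - ln (- w)) ^+ m / m`!%:R) else 0)%R.
Proof.
move=> w0; rewrite -signed_kernelN signed_kernel_pos ?oppr_gt0// lerN2.
by case: ifP.
Qed.

(** One term of the exponential series. *)
Lemma expr_le_fact_exp (m : nat) (u : R) : (0 <= u)%R -> (u ^+ m <= m`!%:R * expR u)%R.
Proof.
move=> u0; case: m => [|m].
  by rewrite expr0 fact0 mul1r -expR0 ler_expR.
rewrite mulrC -ler_pdivrMr ?ltr0n ?fact_gt0//.
by apply: le_trans (expR_ge1Dxn m u0); rewrite lerDr.
Qed.

Lemma signed_kernel_le m a w : w != 0%R -> (signed_kernel m a w <= a ^+ 2 / `|w|)%R.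
Proof.
have pos b v : (0 < v)%R -> (signed_kernel m b v <= b ^+ 2 / `|v|)%R.
  move=> v0; rewrite signed_kernel_pos// gtr0_norm//; have [vb|_] := leP v b; last first.
    by rewrite divr_ge0 ?sqr_ge0// ltW.
  have b0 := lt_le_trans v0 vb.
  rewrite expr2 -mulrA ler_pM2l// ler_pdivrMr ?ltr0n ?fact_gt0// mulrC.
  have := @expr_le_fact_exp m (ln b - ln v); rewrite subr_ge0 ler_ln ?posrE// => /(_ vb).
  by rewrite -ln_div ?posrE// lnK// posrE divr_gt0.
move=> w0; have [|w1|/eqP] := ltgtP w 0%R; last by rewrite (negbTE w0).
  by move=> wN; rewrite -signed_kernelN -sqrrN -normrN; apply: pos; rewrite oppr_gt0.
exact: pos.
Qed.
End signed_kernel.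

Section density.
Context (R : realType) (m : nat).
Context d (T : measurableType d) (P : probability T R).
Context d' (T' : measurableType d') (P' : probability T' R).
Variables (W : T -> R) (V : T' -> R).
Hypotheses (hW : centered_nondegenerate P W) (mV : measurable_fun setT V).
Hypothesis (hV : zero_biased m.+1 P W P' V).
Local Open Scope ereal_scope.
Let s : R := fine 'V_P[W].

Lemma eq_integral_off_point (F G : R -> \bar R) (a : R) :
  measurable_fun setT F -> measurable_fun setT G -> (forall w, w != a -> F w = G w) ->
  \int[lebesgue_measure]_w F w = \int[lebesgue_measure]_w G w.
Proof.
move=> mF mG FG; have mD : measurable ([set: R] `\ a) by exact: measurableD.
rewrite -(integral_setD1 mD (measurable_funTS mF)) -(integral_setD1 mD (measurable_funTS mG)).
apply: eq_integral => w; rewrite inE => -[_ /= wa]; apply: FG; exact/eqP.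
Qed.

(** Tonelli's theorem. The kernel may be changed on the diagonal, because for each
value a of W this alters the inner integral at one point only; this matters for
variables W with atoms, for which W >= w and W > w lead to different
functions. *)
Lemma is_density_kernel (k : measurableTypeR R * measurableTypeR R -> R) (f : R -> \bar R) :
  measurable_fun setT k -> (forall z, 0 <= k z)%R ->
  (forall a w, w != a -> k (a, w) = signed_kernel m a w) ->
  (forall w, w != 0%R -> f w = (s^-1)%:E * \int[P]_x (k (W x, w))%:E) ->
  0 <= f 0%R ->
  is_density P' V f.
Proof.
move=> mk k0 kE fE f0.
have [mW s0 VW EW2] := centered_second_moment hW.
pose K (z : T * measurableTypeR R) : \bar R := (k (W z.1, z.2))%:E.
have mKpair : measurable_fun setT (fun z : T * measurableTypeR R => (W z.1, z.2) : measurableTypeR R * measurableTypeR R).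
  apply: measurable_fun_pair; last exact: measurable_snd.
  exact: (measurableT_comp mW measurable_fst).
have mK : measurable_fun setT K.
  by apply/measurable_EFinP; exact: measurableT_comp.
have K0 z : 0 <= K z by rewrite lee_fin.
pose g w := (s^-1)%:E * \int[P]_x (k (W x, w))%:E.
have mg : measurable_fun [set: R] g.
  apply: measurable_funeM.
  exact: (measurable_fun_fubini_tonelli_G (m1 := P) _ mK).
have s1 : (0 <= s^-1)%R by rewrite invr_ge0 ltW.
have g0 w : 0 <= g w by rewrite mule_ge0// integral_ge0// => x _; rewrite lee_fin.
have mf : measurable_fun [set: R] f.
  rewrite (_ : f = fun w => if w == 0%R then f 0%R else g w).
    apply: measurable_fun_ifT => //.
    by apply: measurable_fun_eqr.
  by apply/funext => w; case: eqVneq => [->//|w0]; exact: fE.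
split => //.
  by move=> w; have [->//|w0] := eqVneq w 0%R; rewrite fE//; exact: g0.
move=> A mA.
have mA1 : measurable_fun [set: R] (fun w => (\1_A w)%:E : \bar R).
  by apply/measurable_EFinP; exact: measurable_indic.
have -> : P' (V @^-1` A) = (s^-1)%:E * (s%:E * P' (V @^-1` A)).
  by rewrite muleA -EFinM mulVf ?mul1e// gt_eqF.
rewrite (zero_biased_law (ltn0Sn m) hW mV hV mA).
transitivity ((s^-1)%:E * \int[P]_x \int[lebesgue_measure]_w ((\1_A w)%:E * K (x, w))).
  congr (_ * _); apply: eq_integral => x _.
  rewrite sqr_iter_avg; last exact: nonneg_measurable_indic.
  apply: (@eq_integral_off_point _ _ (W x)).
  - apply: emeasurable_funM => //; apply/measurable_EFinP.
    exact: (measurableT_comp (measurable_signed_kernel m) (measurable_pair1 (W x))).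
  - apply: emeasurable_funM => //; exact: (measurableT_comp mK (measurable_pair1 x)).
  - by move=> w wW; rewrite /K/= kE.
have mAK : measurable_fun setT (fun z : T * measurableTypeR R => (\1_A z.2)%:E * K z).
  by apply: emeasurable_funM => //; exact: (measurableT_comp mA1 measurable_snd).
rewrite (fubini_tonelli (m1 := P) (m2 := lebesgue_measure) (fun z => (\1_A z.2)%:E * K z))//=;
  last by move=> z; rewrite mule_ge0// lee_fin.
rewrite -ge0_integralZl//; last 2 first.
- apply: (measurable_fun_fubini_tonelli_G (m1 := P) _ mAK).
  by move=> z; rewrite mule_ge0// lee_fin.
- by move=> w _; apply: integral_ge0 => x _; rewrite mule_ge0// lee_fin.
rewrite [RHS]integral_mkcond; apply: (@eq_integral_off_point _ _ 0%R).
- apply: measurable_funeM; apply: (measurable_fun_fubini_tonelli_G (m1 := P) _ mAK).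
  by move=> z; rewrite mule_ge0// lee_fin.
- by apply/(measurable_restrictT _ _).1 => //; exact: measurable_funTS.
move=> w w0; rewrite patchE indicE; case: ifP => _; last first.
  by under eq_integral do rewrite mul0e; rewrite integral0 mule0.
by rewrite fE//; congr (_ * _); apply: eq_integral => x _; rewrite mul1e.
Qed.
End density.

Section density_formula.
Context (R : realType) (m : nat).
Context d (T : measurableType d) (P : probability T R).
Context d' (T' : measurableType d') (P' : probability T' R).
Variables (W : T -> R) (V : T' -> R).
Hypotheses (hW : centered_nondegenerate P W) (mV : measurable_fun setT V).
Hypothesis (hV : zero_biased m.+1 P W P' V).
Local Open Scope ereal_scope.
Let s : R := fine 'V_P[W].
Let c : R := (1 / (m`!%:R * s))%R.

Lemma indic_leE (a : R) (f : T -> R) x : \1_[set y | (a <= f y)%R] x = (a <= f x)%R%:R :> R.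
Proof. by rewrite indicE; congr ((_ : bool)%:R); apply/idP/idP; rewrite inE. Qed.

Lemma indic_geE (a : R) (f : T -> R) x : \1_[set y | (f y <= a)%R] x = (f x <= a)%R%:R :> R.
Proof. by rewrite indicE; congr ((_ : bool)%:R); apply/idP/idP; rewrite inE. Qed.

Lemma lne_quotient (a w : R) : (0 < w)%R -> (w <= a)%R ->
  lne (a%:E / w%:E) = (ln a - ln w)%:E.
Proof.
move=> w0 wa; have a0 := lt_le_trans w0 wa.
by rewrite inver gt_eqF// -EFinM lne_EFin ?divr_gt0// ln_div.
Qed.

Lemma EFin_div (a w : R) : w != 0%R -> a%:E / w%:E = (a / w)%:E.
Proof. by move=> w0; rewrite inver (negbTE w0). Qed.

Lemma lne_quotientN (a w : R) : (w < 0)%R -> (a <= w)%R ->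
  lne (a%:E / w%:E) = (ln (- a) - ln (- w))%:E.
Proof.
move=> w0 wa; rewrite -lne_quotient ?oppr_gt0// ?lerN2// !EFin_div ?oppr_eq0 ?lt_eqF//.
by rewrite invrN mulrNN.
Qed.

Lemma density_term_pos (a w : R) : (0 < w)%R ->
  a%:E * lne (a%:E / w%:E) ^+ m * (w <= a)%R%:R%:E = (m`!%:R * signed_kernel m a w)%:E.
Proof.
move=> w0; rewrite signed_kernel_pos//; case: leP => [wa|_]; last by rewrite mule0 mulr0.
rewrite mule1 lne_quotient// -EFin_expe -EFinM; congr (_%:E).
by field; rewrite pnatr_eq0 -lt0n fact_gt0.
Qed.

Lemma density_term_neg (a w : R) : (w < 0)%R ->
  a%:E * lne (a%:E / w%:E) ^+ m * (a <= w)%R%:R%:E = - (m`!%:R * signed_kernel m a w)%:E.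
Proof.
move=> w0; rewrite signed_kernel_neg//; case: leP => [wa|_]; last by rewrite mule0 mulr0 oppe0.
rewrite mule1 lne_quotientN// -EFin_expe -EFinM -EFinN; congr (_%:E).
by field; rewrite pnatr_eq0 -lt0n fact_gt0.
Qed.

Lemma density_scale (k : T -> R) : measurable_fun setT k -> (forall x, 0 <= k x)%R ->
  c%:E * \int[P]_x (m`!%:R * k x)%:E = (s^-1)%:E * \int[P]_x (k x)%:E.
Proof.
move=> mk k0; under eq_integral do rewrite EFinM.
rewrite ge0_integralZl_EFin//; last 2 first.
- by move=> x _; rewrite lee_fin.
- exact/measurable_EFinP.
have [_ s0 _ _] := centered_second_moment hW.
rewrite muleA -EFinM /c; congr (_%:E * _).
by field; rewrite pnatr_eq0 -lt0n fact_gt0 gt_eqF.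
Qed.

Lemma measurable_kernel_section (w : R) : measurable_fun setT (fun x => signed_kernel m (W x) w).
Proof.
have [mW _ _ _] := centered_second_moment hW.
exact: (measurableT_comp (measurableT_comp (measurable_signed_kernel m) (measurable_pair2 w)) mW).
Qed.

Lemma quotient_at0_ge0 (a : R) : (0 <= a)%R -> 0 <= a%:E * lne (a%:E / 0) ^+ m.
Proof.
rewrite le_eqVlt => /predU1P[<-|a0]; first by rewrite mul0e.
rewrite inve0 gt0_muley ?lte_fin//= mule_ge0 ?lee_fin ?ltW//.
by rewrite expe_gt0// ltey.
Qed.

(** For w <> 0 the integrand is, up to sign, (n-1)! times [signed_kernel]; at w = 0
only nonnegativity has to be checked. *)
Lemma zero_biased_density : is_density P' V (fun w : R =>
  (if (w < 0)%R then
     - (c%:E * \int[P]_x ((W x)%:E * lne ((W x)%:E / w%:E) ^+ m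
          * (\1_[set y | (W y <= w)%R] x)%:E))
   else
     c%:E * \int[P]_x ((W x)%:E * lne ((W x)%:E / w%:E) ^+ m
          * (\1_[set y | (w <= W y)%R] x)%:E))).
Proof.
have [_ s0 _ _] := centered_second_moment hW.
have c0 : (0 <= c)%R by rewrite divr_ge0// mulr_ge0// ltW.
apply: (is_density_kernel hW mV hV (measurable_signed_kernel m)) => //.
- by move=> z; exact: signed_kernel_ge0.
- move=> w w0; rewrite -/s -density_scale//; first last.
  + by move=> x; exact: signed_kernel_ge0.
  + exact: measurable_kernel_section.
  case: ltP => [wN|wP].
    under eq_integral do rewrite indic_geE density_term_neg//.
    rewrite integral_ge0N ?muleN ?oppeK// => x _.
    by rewrite lee_fin mulr_ge0// signed_kernel_ge0.
  have w1 : (0 < w)%R by rewrite lt_neqAle eq_sym w0.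
  by under eq_integral do rewrite indic_leE density_term_pos//.
- rewrite ltxx mule_ge0// integral_ge0// => x _; rewrite indic_leE.
  by have [W0|_] := leP 0%R (W x); rewrite ?mule0// mule1 quotient_at0_ge0.
Qed.
End density_formula.

(** * The distribution function *)

Section lower_gamma_theory.
Context {R : realType}.
Local Open Scope ereal_scope.

Lemma lower_gammaE m (x : \bar R) :
  lower_gamma m.+1%:R x =
  \int[lebesgue_measure]_(t in [set t : R | 0 <= t%:E <= x]) (t ^+ m * expR (- t))%:E.
Proof.
apply: eq_integral => t; rewrite inE/= => /andP[t0 _].
by rewrite -natr1 addrK powR_mulrn.
Qed.

Lemma lower_gamma_EFin m (x : R) :
  lower_gamma m.+1%:R x%:E =
  \int[lebesgue_measure]_(t in `[0%R, x]) (t ^+ m * expR (- t))%:E.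
Proof.
exact: lower_gammaE.
Qed.

Lemma measurable_gamma_integrand m : measurable_fun setT (fun t : R => (t ^+ m * expR (- t))%:E : \bar R).
Proof.
apply/measurable_EFinP; apply: measurable_funM; first exact: measurable_funX.
exact: (measurableT_comp (@measurable_expR R) (@oppr_measurable R setT)).
Qed.

(** The substitution s = a e^(-t). *)
Lemma lower_gamma_substitution m (a w : R) : (0 < w)%R -> (w <= a)%R ->
  \int[lebesgue_measure]_(s in `[w, a]) ((ln a - ln s) ^+ m / m`!%:R)%:E =
  (a / m`!%:R)%:E * lower_gamma m.+1%:R (ln a - ln w)%:E.
Proof.
move=> w0 wa; have a0 := lt_le_trans w0 wa.
have L0 : (0 <= ln a - ln w)%R by rewrite subr_ge0 ler_ln.
set L := (ln a - ln w)%R in L0 *.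
(* F maps [0, L] decreasingly onto [w, a] *)
pose F (t : R) : R := (a * expR (- t))%R.
pose G (s : R) : R := ((ln a - ln s) ^+ m / m`!%:R)%R.
have F0 : F 0%R = a by rewrite /F oppr0 expR0 mulr1.
have FL : F L = w by rewrite /F opprB expRB lnK// lnK// mulrC -mulrA mulVf ?mulr1// gt_eqF.
have dF (t : R) : is_derive t 1%R F (- F t)%R.
  have H : is_derive t 1%R (fun t : R => expR (- t)) (expR (- t) * -1)%R.
    by apply: (@is_derive1_comp _ (@expR R) (@GRing.opp R)); exact: is_deriveN.
  have := is_deriveZ a H.
  by rewrite /GRing.scale/= mulrN1 mulrN.
have F'E : derive1 F = (fun t => - F t)%R by exact: has_derivative_derive1.
have cF : continuous F by exact: has_derivative_continuous dF.
have cF' : continuous (derive1 F).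
  by rewrite F'E => t; apply: cvgN; exact: cF.
transitivity (\int[lebesgue_measure]_(s in `[F L, F 0%R]) (G s)%:E); first by rewrite F0 FL.
rewrite integration_by_substitution_decreasing//.
- rewrite lower_gamma_EFin -ge0_integralZl//; last 3 first.
  + by apply: measurable_funTS; exact: measurable_gamma_integrand.
  + by move=> t; rewrite /= in_itv/= => /andP[t0 _]; rewrite lee_fin mulr_ge0 ?exprn_ge0 ?expR_ge0.
  + by rewrite lee_fin divr_ge0// ltW.
  apply: eq_integral => t; rewrite inE/= in_itv/= => /andP[t0 _].
  rewrite F'E -EFinM; congr (_%:E).
  rewrite -[LHS]/(((ln a - ln (F t)) ^+ m / m`!%:R) * - - F t)%R opprK /F.
  rewrite lnM ?posrE// ?expR_gt0// expRK opprD opprK addrA subrr add0r; ring.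
- move=> x y _ _ xy; rewrite /F ltr_pM2l// ltr_expR ltrN2//.
- by apply/cvg_ex; exists (derive1 F 0%R); apply: cvg_at_right_filter; exact: cF'.
- by apply/cvg_ex; exists (derive1 F L); apply: cvg_at_left_filter; exact: cF'.
- split; first by move=> t _; have [] := dF t.
    by apply: cvg_at_right_filter; exact: cF.
  by apply: cvg_at_left_filter; exact: cF.
- apply: continuous_in_subspaceT => y; rewrite inE/= in_itv/= FL => /andP[wy _].
  have y0 : (0 < y)%R by exact: lt_le_trans wy.
  apply: cvgM; last exact: cvg_cst.
  apply: (@continuous_comp _ _ _ (fun y : R => ln a - ln y)%R (fun y : R => y ^+ m)%R y);
    last exact: exprn_continuous.
  by apply: cvgB; [exact: cvg_cst|exact: continuous_ln].
Qed.

Lemma iter_avg_ray m (b : bool) (a w : R) : (0 < w)%R -> (w <= a)%R ->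
  iter m.+1 avg (fun z => (\1_[set` Interval (BSide b w) +oo%O] z)%:E) a =
  (m`!%:R^-1)%:E * lower_gamma m.+1%:R (ln a - ln w)%:E.
Proof.
move=> w0 wa; have a0 := lt_le_trans w0 wa.
set h := (fun z => _).
have nh : nonneg_measurable h by apply: nonneg_measurable_indic; exact: measurable_itv.
have [mh h0] := nh.
suff H : a%:E * iter m.+1 avg h a = (a / m`!%:R)%:E * lower_gamma m.+1%:R (ln a - ln w)%:E.
  have -> : iter m.+1 avg h a = (a^-1)%:E * (a%:E * iter m.+1 avg h a).
    by rewrite muleA -EFinM mulVf ?mul1e// gt_eqF.
  by rewrite H muleA -EFinM mulrA mulVf ?mul1r// gt_eqF.
rewrite iter_avg_kernel// -lower_gamma_substitution// [RHS]integral_mkcond.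
have mk : measurable_fun setT (fun s => log_kernel m a s).
  exact: (measurableT_comp (measurable_log_kernel m) (measurable_pair1 a)).
transitivity (\int[lebesgue_measure]_s ((\1_`[w, +oo[ s)%:E * (log_kernel m a s)%:E)).
  apply: (@eq_integral_off_point _ _ _ w).
  - by apply: emeasurable_funM => //; exact/measurable_EFinP.
  - by apply: emeasurable_funM; apply/measurable_EFinP => //; exact: measurable_indic.
  - move=> s sw; congr (_%:E * _); rewrite !indicE; congr ((_ : bool)%:R).
    by apply/idP/idP; rewrite !inE/= !itv_boundlr/= /<=%O/= !andbT; case: (b) => //=;
       rewrite ?lt_neqAle ?(eq_sym w) ?sw// => /andP[].
apply: eq_integral => s _; rewrite patchE indicE mem_setE/= mem_setE/= !in_itv/= andbT /log_kernel.
have [ws|sw] := leP w s; last by rewrite mul0e.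
by rewrite mul1e (lt_le_trans w0 ws)/=; case: ifP.
Qed.
End lower_gamma_theory.

Section complete_gamma.
Context {R : realType}.
Local Open Scope ereal_scope.

(** A product of uniform variables is almost surely positive. *)
Lemma iter_avg_pos_ray m (a : R) : (0 < a)%R ->
  iter m.+1 avg (fun z => (\1_(`]0%R, +oo[%classic : set R) z)%:E) a = 1.
Proof.
move=> a0; set h := (fun z => _).
have nh : nonneg_measurable h by apply: nonneg_measurable_indic; exact: measurable_itv.
suff H : a%:E * iter m.+1 avg h a = a%:E * iter m.+1 avg (fun=> 1) a.
  have : (a^-1)%:E * (a%:E * iter m.+1 avg h a) = 1.
    by rewrite H iter_avg1 mule1 -EFinM mulVf// gt_eqF.
  by rewrite muleA -EFinM mulVf ?mul1e// gt_eqF.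
rewrite !iter_avg_kernel//.
apply: eq_integral => s _; rewrite /h indicE mem_setE/= in_itv/= andbT /log_kernel.
by have [s0|s0] := ltP 0%R s; rewrite ?mule0.
Qed.

(** For a product U of m + 1 uniform variables, the mass of ]1 / (k + 1), 1] under
the law of U is gamma(m + 1, log(k + 1)) / m! by [iter_avg_ray]; let k tend to
infinity. *)
Lemma lower_gamma_pinfty m : lower_gamma m.+1%:R +oo = (m`!%:R)%:E :> \bar R.
Proof.
have [pi piE] := @iter_avg_law R m.+1.
pose w (k : nat) : R := (k.+1%:R^-1)%R.
have w0 k : (0 < w k)%R by rewrite invr_gt0.
have w1 k : (w k <= 1)%R by rewrite invf_le1// ler1n.
pose F (k : nat) : set (measurableTypeR R) := `](w k), +oo[%classic.
have FU : \bigcup_k F k = `]0%R, +oo[%classic.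
  apply/seteqP; split => x /=.
    by move=> [k _]/=; rewrite /F /= !in_itv/= !andbT; exact: lt_trans.
  rewrite in_itv/= andbT => x0; have [k] := ltr_add_invr x0; rewrite add0r => kx.
  by exists k => //=; rewrite /F/= in_itv/= kx.
have ndF : {homo F : i j / (i <= j)%N >-> (i <= j)%O}.
  move=> i j ij; apply/subsetPset => x /=; rewrite /F /= !in_itv/= !andbT.
  by apply: le_lt_trans; rewrite /w lef_pV2 ?posrE// ler_nat ltnS.
have piA (A : set (measurableTypeR R)) : measurable A -> pi A = iter m.+1 avg (fun z => (\1_A z)%:E) 1%R.
  move=> mA; rewrite piE; last exact: nonneg_measurable_indic.
  by under eq_integral do rewrite mul1r; rewrite integral_indic// setIT.
have C1 := @nondecreasing_cvg_mu _ _ _ pi F (fun i => measurable_itv _) _ ndF.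
have {}C1 := C1 ltac:(by rewrite FU; exact: measurable_itv).
have pi1 : pi (`]0%R, +oo[%classic : set (measurableTypeR R)) = 1.
  by rewrite piA; [exact: iter_avg_pos_ray|exact: measurable_itv].
have {}C1 : pi (F k) @[k --> \oo] --> (1 : \bar R) by rewrite -pi1 -FU; exact: C1.
pose f (t : R) : \bar R := (t ^+ m * expR (- t))%:E.
pose G (k : nat) : set (measurableTypeR R) := `[0%R, (ln 1 - ln (w k))%R]%classic.
have lnw k : (ln 1 - ln (w k))%R = ln (k.+1%:R : R)%R by rewrite ln1 sub0r /w lnV ?posrE// opprK.
have GU : \bigcup_k G k = [set t : R | 0 <= t%:E <= +oo].
  apply/seteqP; split => x /=.
    by move=> [k _]/=; rewrite /G /= in_itv/= => /andP[x0 _]; rewrite lee_fin x0 leey.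
  rewrite lee_fin leey andbT => x0.
  exists (Num.truncn (expR x)) => //=; rewrite /G/= in_itv/= x0/= lnw.
  by rewrite -ler_expR lnK ?posrE// ltW// truncnS_gt.
have C2 : \int[lebesgue_measure]_(t in G k) f t @[k --> \oo] --> lower_gamma m.+1%:R +oo.
  rewrite lower_gammaE -GU; apply: ge0_nondecreasing_set_cvg_integral.
  - move=> i j ij; apply/subsetPset => x /=; rewrite /G /= !in_itv/= => /andP[-> /le_trans]; apply.
    by rewrite !lnw ler_ln ?posrE// ler_nat ltnS.
  - by move=> i; exact: measurable_itv.
  - by move=> i; apply: measurable_funTS; exact: measurable_gamma_integrand.
  - move=> i x; rewrite /G /= in_itv/= => /andP[x0 _].
    by rewrite lee_fin mulr_ge0 ?exprn_ge0 ?expR_ge0.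
have m0 : (m`!%:R : R) != 0%R by rewrite pnatr_eq0 -lt0n fact_gt0.
have FG k : \int[lebesgue_measure]_(t in G k) f t = (m`!%:R)%:E * pi (F k).
  rewrite piA; last exact: measurable_itv.
  rewrite iter_avg_ray// muleA -EFinM divff// mul1e lower_gamma_EFin.
  by [].
have C3 : (m`!%:R)%:E * pi (F k) @[k --> \oo] --> (m`!%:R)%:E * (1 : \bar R).
  by apply: cvgeZl => //; exact: C1.
have FG' : (fun k => \int[lebesgue_measure]_(t in G k) f t) = (fun k => (m`!%:R)%:E * pi (F k)).
  exact/funext.
by rewrite FG' in C2; rewrite mule1 in C3; exact: (cvg_unique _ C2 C3).
Qed.
End complete_gamma.

Section distribution_function.
Context (R : realType) (m : nat).
Context d (T : measurableType d) (P : probability T R).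
Context d' (T' : measurableType d') (P' : probability T' R).
Variables (W : T -> R) (V : {RV P' >-> R}).
Hypotheses (hW : centered_nondegenerate P W).
Hypothesis (hV : zero_biased m.+1 P W P' V).
Local Open Scope ereal_scope.
Let s : R := fine 'V_P[W].
Let c : R := (1 / (m`!%:R * s))%R.

Lemma iter_avg_open_ray (a w : R) : (0 <= w)%R ->
  (a ^+ 2)%:E * iter m.+1 avg (fun z => (\1_(`]w, +oo[%classic : set R) z)%:E) a =
  (m`!%:R^-1)%:E * ((a ^+ 2)%:E * lower_gamma m.+1%:R (lne (a%:E / w%:E)) * (w <= a)%R%:R%:E).
Proof.
move=> w0; have m0 : (m`!%:R : R) != 0%R by rewrite pnatr_eq0 -lt0n fact_gt0.
have nh : nonneg_measurable (fun z : R => (\1_(`]w, +oo[%classic : set R) z)%:E) by apply: nonneg_measurable_indic; exact: measurable_itv.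
have [->|a0] := eqVneq a 0%R; first by rewrite expr0n/= !mul0e mule0.
have [wa|aw] := leP w a; last first.
  rewrite !mule0 iter_avg_eq0 ?mule0// => u /andP[u0 u1].
  rewrite indicE memNset// /= in_itv/= andbT; apply/negP; rewrite -leNgt.
  have [a1|a1] := leP a 0%R; first by rewrite (le_trans _ w0)// mulr_le0_ge0.
  by rewrite (le_trans _ (ltW aw))// ler_piMr// ltW.
rewrite mule1; have {}a0 : (0 < a)%R by rewrite lt_neqAle eq_sym a0 (le_trans w0).
move: w0; rewrite le_eqVlt => /predU1P[<-|w0].
  rewrite inve0 gt0_muley ?lte_fin// -[lne +oo]/(+oo) lower_gamma_pinfty iter_avg_pos_ray//.
  by rewrite mule1 -!EFinM; congr (_%:E); field.
by rewrite iter_avg_ray// lne_quotient// muleCA.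
Qed.

Lemma iter_avg_closed_ray_neg (a w : R) : (w < 0)%R ->
  (a ^+ 2)%:E * iter m.+1 avg (fun z => (\1_(`]-oo, w]%classic : set R) z)%:E) a =
  (m`!%:R^-1)%:E * ((a ^+ 2)%:E * lower_gamma m.+1%:R (lne (a%:E / w%:E)) * (a <= w)%R%:R%:E).
Proof.
move=> w0.
have nh : nonneg_measurable (fun z : R => (\1_(`]-oo, w]%classic : set R) z)%:E) by apply: nonneg_measurable_indic; exact: measurable_itv.
have [aw|wa] := leP a w; last first.
  rewrite !mule0 iter_avg_eq0 ?mule0// => u /andP[u0 u1].
  rewrite indicE memNset// /= in_itv/=; apply/negP; rewrite -ltNge.
  have [a1|a1] := leP 0%R a; first by rewrite (lt_le_trans w0)// mulr_ge0.
  by rewrite (lt_le_trans wa)// ler_niMr// ltW.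
rewrite mule1 lne_quotientN// muleCA; congr (_ * _).
have Nw : (0 < - w)%R by rewrite oppr_gt0.
rewrite -(iter_avg_ray m true Nw)// ?lerN2// -(mulN1r a) -iter_avg_dilate.
congr (iter _ _ _ _); apply/funext => z; rewrite !indicE; congr ((_ : bool)%:R%:E).
by apply/idP/idP; rewrite !inE/= !in_itv/= andbT mulN1r lerN2.
Qed.

Lemma zero_biased_cdf (w : R) : cdf V w =
  (if (w < 0)%R then
     c%:E * \int[P]_x (((W x) ^+ 2)%:E * lower_gamma m.+1%:R (lne ((W x)%:E / w%:E))
        * (\1_[set y | (W y <= w)%R] x)%:E)
   else
     1 - c%:E * \int[P]_x (((W x) ^+ 2)%:E * lower_gamma m.+1%:R (lne ((W x)%:E / w%:E))
        * (\1_[set y | (w <= W y)%R] x)%:E)).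
Proof.
have [mW s0 VW EW2] := centered_second_moment hW.
have m0 : (0 < (m`!%:R : R))%R by rewrite ltr0n fact_gt0.
have mV : measurable_fun setT V by [].
have law (A : set R) (r : T -> \bar R) : measurable A -> (forall x, 0 <= r x) ->
    measurable_fun setT r ->
    (forall x, ((W x) ^+ 2)%:E * iter m.+1 avg (fun z => (\1_A z)%:E) (W x) = (m`!%:R^-1)%:E * r x) ->
    P' (V @^-1` A) = c%:E * \int[P]_x r x.
  move=> mA r0 mr rE; rewrite /c mul1r invfM EFinM [X in X * _]muleC -muleA -ge0_integralZl//.
  under eq_integral do rewrite -rE.
  by rewrite -(zero_biased_law (ltn0Sn m) hW mV hV mA) muleA -EFinM mulVf ?mul1e// gt_eqF.
have law' (A : set R) (r : T -> \bar R) : measurable A ->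
    (forall x, ((W x) ^+ 2)%:E * iter m.+1 avg (fun z => (\1_A z)%:E) (W x) = (m`!%:R^-1)%:E * r x) ->
    P' (V @^-1` A) = c%:E * \int[P]_x r x.
  move=> mA rE; have rE' : r = fun x => (m`!%:R)%:E * (((W x) ^+ 2)%:E * iter m.+1 avg (fun z => (\1_A z)%:E) (W x)).
    by apply/funext => x; rewrite rE muleA -EFinM divff ?mul1e// gt_eqF.
  have [mI I0] := nonneg_measurable_iter_avg m.+1 (nonneg_measurable_indic mA).
  apply: law => //.
    by move=> x; rewrite rE' mule_ge0 ?lee_fin ?ler0n// mule_ge0// lee_fin sqr_ge0.
  rewrite rE'; apply: measurable_funeM; apply: emeasurable_funM.
    by apply/measurable_EFinP; exact: measurable_funX.
  exact: measurableT_comp.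
case: ltP => w0.
  apply: law'; first exact: measurable_itv.
  by move=> x; rewrite indic_geE iter_avg_closed_ray_neg.
have <- := law' `]w, +oo[%classic _ (measurable_itv _) _; last first.
  by move=> x; rewrite indic_leE iter_avg_open_ray.
rewrite -[P' _]/(ccdf V w) -(cdf_ccdf_1 V w) addeK// /ccdf.
exact: fin_num_measure.
Qed.
End distribution_function.

(** * Unimodality *)

Section subgradient.
Context {R : realType}.
Local Open Scope convex_scope.

(** Evaluate the two subgradient inequalities at the convex combination itself and
add them with the weights of the combination. *)
Lemma convex_function_subgradient (D : set R) (f g : R -> R) :
  (forall (t : {i01 R}) (x y : R^o), D x -> D y -> D (x <| t |> y)) ->
  (forall x y, D x -> D y -> f x + g x * (y - x) <= f y) ->
  convex_function (E := R^o) D f.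
Proof.
move=> cD sub t x y; rewrite !inE => Dx Dy.
have Dz := cD t _ _ Dx Dy; set z := x <| t |> y in Dz *.
have H1 : f z + g z * (x - (t%:num * x + (1 - t%:num) * y)) <= f x := sub _ _ Dz Dx.
have H2 : f z + g z * (y - (t%:num * x + (1 - t%:num) * y)) <= f y := sub _ _ Dz Dy.
have t0 : 0 <= t%:num :> R by [].
have t1 : 0 <= 1 - t%:num :> R by rewrite subr_ge0.
have := lerD (ler_wpM2l t0 H1) (ler_wpM2l t1 H2).
rewrite [leRHS]convRE; move: (f z) (g z) (f x) (f y) => u v a b.
set L := (X in X <= _ -> _) => H.
have -> : u = L by rewrite /L; move: (t%:num : R) => r; ring.
exact: H.
Qed.
End subgradient.

Section kernel_density.
Context (R : realType) (m : nat).
Context d (T : measurableType d) (P : probability T R).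
Variables (W : T -> R).
Hypotheses (hW : centered_nondegenerate P W).
Local Open Scope ereal_scope.
Let s : R := fine 'V_P[W].

Definition kernel_density (w : R) : \bar R :=
  (s^-1)%:E * \int[P]_x (signed_kernel m (W x) w)%:E.

Lemma kernel_density_is_density d' (T' : measurableType d') (P' : probability T' R) (V : T' -> R) :
  measurable_fun setT V -> zero_biased m.+1 P W P' V -> is_density P' V kernel_density.
Proof.
move=> mV hV; have [_ s0 _ _] := centered_second_moment hW.
apply: (is_density_kernel hW mV hV (measurable_signed_kernel m)) => //.
- by move=> z; exact: signed_kernel_ge0.
- apply: mule_ge0; first by rewrite lee_fin invr_ge0 ltW.
  by apply: integral_ge0 => x _; rewrite lee_fin signed_kernel_ge0.
Qed.

(** The kernel at w is at most W^2 / |w|. *)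
Lemma kernel_density_fin (w : R) : w != 0%R -> kernel_density w \is a fin_num.
Proof.
move=> w0; have [mW s0 VW EW2] := centered_second_moment hW.
rewrite fin_numM// ge0_fin_numE; last first.
  by apply: integral_ge0 => x _; rewrite lee_fin signed_kernel_ge0.
apply: (@le_lt_trans _ _ (\int[P]_x ((W x) ^+ 2 * `|w|^-1)%:E)).
  apply: ge0_le_integral => //.
  - by move=> x _; rewrite lee_fin signed_kernel_ge0.
  - by apply/measurable_EFinP; exact: (measurable_kernel_section m hW).
  - by apply/measurable_EFinP; apply: measurable_funM => //; exact: measurable_funX.
  - by move=> x _; rewrite lee_fin signed_kernel_le.
under eq_integral do rewrite EFinM.
rewrite ge0_integralZr//; first by rewrite EW2 -EFinM ltry.
- by apply/measurable_EFinP; exact: measurable_funX.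
- by move=> x _; rewrite lee_fin sqr_ge0.
Qed.

Lemma signed_kernel_nonincreasing (a w1 w2 : R) : (0 < w1)%R -> (w1 <= w2)%R ->
  (signed_kernel m a w2 <= signed_kernel m a w1)%R.
Proof.
move=> w10 w12; have w20 := lt_le_trans w10 w12.
rewrite [leLHS]signed_kernel_pos//; have [w2a|_] := leP w2 a; last exact: signed_kernel_ge0.
have a0 := lt_le_trans w20 w2a.
rewrite signed_kernel_pos// (le_trans w12 w2a) ler_pM2l// ler_wpM2r ?invr_ge0//.
rewrite lerXn2r// ?nnegrE ?subr_ge0 ?ler_ln ?posrE//; first exact: le_trans w2a.
by rewrite lerB// ler_ln.
Qed.

Lemma kernel_density_nonincreasing (w1 w2 : R) : (0 < w1)%R -> (w1 <= w2)%R ->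
  kernel_density w2 <= kernel_density w1.
Proof.
move=> w10 w12; have [mW s0 _ _] := centered_second_moment hW.
apply: lee_wpmul2l; first by rewrite lee_fin invr_ge0 ltW.
apply: ge0_le_integral => //.
- by move=> x _; rewrite lee_fin signed_kernel_ge0.
- by apply/measurable_EFinP; exact: (measurable_kernel_section m hW).
- by apply/measurable_EFinP; exact: (measurable_kernel_section m hW).
- by move=> x _; rewrite lee_fin signed_kernel_nonincreasing.
Qed.

Lemma kernel_density_nondecreasing (w1 w2 : R) : (w2 < 0)%R -> (w1 <= w2)%R ->
  kernel_density w1 <= kernel_density w2.
Proof.
move=> w20 w12; have [mW s0 _ _] := centered_second_moment hW.
apply: lee_wpmul2l; first by rewrite lee_fin invr_ge0 ltW.
apply: ge0_le_integral => //.
- by move=> x _; rewrite lee_fin signed_kernel_ge0.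
- by apply/measurable_EFinP; exact: (measurable_kernel_section m hW).
- by apply/measurable_EFinP; exact: (measurable_kernel_section m hW).
- move=> x _; rewrite lee_fin -signed_kernelN -[leRHS]signed_kernelN.
  by rewrite signed_kernel_nonincreasing// ?oppr_gt0// lerN2.
Qed.

End kernel_density.

Section unimodality.
Context (R : realType) (m : nat).
Context d (T : measurableType d) (P : probability T R).
Context d' (T' : measurableType d') (P' : probability T' R).
Variables (W : T -> R) (V : {RV P' >-> R}).
Hypotheses (hW : centered_nondegenerate P W).
Hypothesis (hV : zero_biased m.+1 P W P' V).
Local Open Scope ereal_scope.

Let mV : measurable_fun setT V. Proof. by []. Qed.

Let F (w : R) : R := fine (cdf V w).

Lemma cdf_increment (x y : R) : (x <= y)%R ->
  (F y - F x)%:E = \int[lebesgue_measure]_(w in `]x, y]) kernel_density m P W w.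
Proof.
move=> xy; have [_ _ dE] := kernel_density_is_density hW mV hV.
rewrite -dE; last exact: measurable_itv.
rewrite EFinB /F !fineK ?fin_num_measure// /cdf.
rewrite (_ : `]-oo, y]%classic = `]-oo, x]%classic `|` `]x, y]%classic); last first.
  by rewrite -itv_bndbnd_setU.
have disj : (`]-oo, x]%classic `&` `]x, y]%classic : set R) = set0.
  by apply/seteqP; split => // z [/=]; rewrite !in_itv/= => zx /andP[xz _]; rewrite leNgt xz in zx.
rewrite (measureU _ (measurable_itv _) (measurable_itv _) disj).
by rewrite addeAC subee ?add0e// fin_num_measure.
Qed.

Lemma cdf_increment_le (x y k : R) : (x <= y)%R ->
  (forall w, (x < w <= y)%R -> kernel_density m P W w <= k%:E) -> (F y - F x <= k * (y - x))%R.
Proof.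
move=> xy H; rewrite -lee_fin cdf_increment//.
have [md d0 _] := kernel_density_is_density hW mV hV.
have k0 : (x < y)%R -> (0 <= k)%R.
  by move=> xy'; rewrite -lee_fin (le_trans (d0 y))// H// xy' lexx.
move: xy; rewrite le_eqVlt => /predU1P[<-|xy].
  by rewrite set_itvoc0 integral_set0 subrr mulr0.
have -> : (k * (y - x))%:E = \int[lebesgue_measure]_(w in `]x, y]) k%:E.
  by rewrite integral_cst//= lebesgue_measure_itv/= lte_fin xy EFinM EFinB.
apply: ge0_le_integral => //; exact: measurable_funTS.
Qed.

Lemma cdf_increment_ge (x y k : R) : (x <= y)%R -> (0 <= k)%R ->
  (forall w, (x < w <= y)%R -> k%:E <= kernel_density m P W w) -> (k * (y - x) <= F y - F x)%R.
Proof.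
move=> xy k0 H; rewrite -lee_fin cdf_increment//.
have [md d0 _] := kernel_density_is_density hW mV hV.
move: xy; rewrite le_eqVlt => /predU1P[<-|xy].
  by rewrite set_itvoc0 integral_set0 subrr mulr0.
have -> : (k * (y - x))%:E = \int[lebesgue_measure]_(w in `]x, y]) k%:E.
  by rewrite integral_cst//= lebesgue_measure_itv/= lte_fin xy EFinM EFinB.
apply: ge0_le_integral => //; exact: measurable_funTS.
Qed.

(** The density increases up to 0 and decreases after it, hence it is a subgradient
of the distribution function on the left of 0, and its opposite is one of the
opposite function on the right. *)
Lemma zero_biased_unimodal : unimodal_about V 0%R.
Proof.
have [md d0 _] := kernel_density_is_density hW mV hV.
pose g w : R := fine (kernel_density m P W w).
have g0 w : (0 <= g w)%R by exact: fine_ge0.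
have gE w : w != 0%R -> (g w)%:E = kernel_density m P W w by move=> w0; rewrite fineK// kernel_density_fin.
split.
- apply: (@convex_function_subgradient _ _ _ g).
    move=> t x y /=; rewrite !in_itv/= => x0 y0.
    rewrite -oppr_gt0 (convN (x : R^o) (y : R^o) t); apply: convR_gt0; by rewrite oppr_gt0.
  move=> x y /=; rewrite !in_itv/= => x0 y0; rewrite -/(F x) -/(F y).
  have [xy|yx] := leP x y.
    have H : (g x * (y - x) <= F y - F x)%R.
      apply: cdf_increment_ge => // w /andP[xw wy].
      by rewrite gE ?lt_eqF// kernel_density_nondecreasing ?(ltW xw)// (le_lt_trans wy).
    lra.
  have H : (F x - F y <= g x * (x - y))%R.
    apply: cdf_increment_le (ltW yx) _ => w /andP[yw wx].
    by rewrite gE ?lt_eqF// kernel_density_nondecreasing.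
  lra.
- apply: (@convex_function_subgradient _ _ _ (fun w => - g w)%R).
    by move=> t x y /=; rewrite !in_itv/= !andbT; exact: convR_gt0.
  move=> x y /=; rewrite !in_itv/= !andbT => x0 y0; rewrite -/(F x) -/(F y).
  have [xy|yx] := leP x y.
    have H : (F y - F x <= g x * (y - x))%R.
      apply: cdf_increment_le xy _ => w /andP[xw wy].
      by rewrite gE ?gt_eqF// kernel_density_nonincreasing// ltW.
    lra.
  have H : (g x * (x - y) <= F x - F y)%R.
    apply: cdf_increment_ge (ltW yx) _ _ => // w /andP[yw wx].
    by rewrite gE ?gt_eqF// kernel_density_nonincreasing// (lt_trans y0).
  lra.
Qed.
End unimodality.

(** * The support *)

Section support.
Context d (T : measurableType d) (R : realType) (P : probability T R) (X : T -> R).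
Hypothesis mX : measurable_fun setT X.
Local Open Scope ereal_scope.

Let mpre (A : set R) : measurable A -> measurable (X @^-1` A).
Proof. by move=> mA; rewrite -[X in measurable X]setTI; exact: mX. Qed.

Lemma notin_support (x : R) : ~ rv_support P X x ->
  exists e : R, [/\ (0 < e)%R & P (X @^-1` `](x - e)%R, (x + e)%R[) = 0].
Proof.
move=> /existsNP[U /not_implyP[oU /not_implyP[Ux /negP]]].
rewrite -leNgt => PU.
have /nbhs_ballP[e /= e0 eU] : nbhs x U by exact: open_nbhs_nbhs.
exists e; split => //; apply/eqP; rewrite eq_le measure_ge0 andbT (le_trans _ PU)//.
rewrite le_measure ?inE//; [exact: mpre|by apply: mpre; exact: open_measurable|].
move=> t /=; rewrite in_itv/= => /andP[H1 H2]; apply: eU.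
by rewrite /ball/= ltr_distlC H1 H2.
Qed.

Lemma open_setC_support : open (~` rv_support P X).
Proof.
rewrite openE => x /= /notin_support[e [e0 Pe]].
apply/nbhs_ballP; exists e => //= y.
rewrite /ball/= ltr_distlC => xy Sy.
have := Sy `](x - e)%R, (x + e)%R[%classic (@interval_open _ _ _ _ _) => /(_ isT isT).
rewrite /= in_itv/= xy => /(_ isT).
by rewrite Pe ltxx.
Qed.

(** The complement of the support is covered by the intervals with rational
endpoints that have measure zero, and these are countably many. *)
Lemma support_full : P (X @^-1` (~` rv_support P X)) = 0.
Proof.
pose J (pq : rat * rat) : set R := `](ratr pq.1), (ratr pq.2)[%classic.
pose F (k : nat) : set T := if unpickle k is Some pq then
  (if P (X @^-1` (J pq)) == 0 then X @^-1` (J pq) else set0) else set0.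
have mF k : measurable (F k).
  rewrite /F; case: unpickle => // pq; case: ifP => // _.
  by apply: mpre; exact: measurable_itv.
have F0 k : P (F k) = 0.
  by rewrite /F; case: unpickle => [pq|]; [case: ifP => [/eqP//|_]|]; rewrite measure0.
have sub : X @^-1` (~` rv_support P X) `<=` \bigcup_k F k.
  move=> t /= /notin_support[e [e0 Pe]].
  have [p] := @rat_in_itvoo _ (X t - e)%R (X t) (ltac:(by rewrite ltrBlDr ltrDl)).
  rewrite in_itv/= => /andP[p1 p2].
  have [q] := @rat_in_itvoo _ (X t) (X t + e)%R (ltac:(by rewrite ltrDl)).
  rewrite in_itv/= => /andP[q1 q2].
  suff PI0 : P (X @^-1` (J (p, q))) == 0.
    by exists (pickle (p, q)); [exact: I|rewrite /F pickleK PI0 /J/= in_itv/= p2 q1].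
  rewrite -measure_le0 -Pe le_measure ?inE//; [by apply: mpre; exact: measurable_itv..|].
  move=> z; rewrite /J/= !in_itv/= => /andP[pz zq].
  by rewrite (lt_trans p1 pz) (lt_trans zq q2).
have mN : measurable (X @^-1` (~` rv_support P X)).
  by apply: mpre; apply: open_measurable; exact: open_setC_support.
apply/eqP; rewrite -measure_le0.
rewrite (le_trans (measure_sigma_subadditive P mF mN sub))//.
by rewrite eseries0// => k _ _; exact: F0.
Qed.

Lemma support_meets (A : set R) : measurable A -> 0 < P (X @^-1` A) ->
  exists2 x, rv_support P X x & A x.
Proof.
move=> mA PA; apply: contrapT => /forall2NP H.
have : P (X @^-1` A) <= P (X @^-1` (~` rv_support P X)).
  rewrite le_measure ?inE//; [exact: mpre|by apply: mpre; apply: open_measurable; exact: open_setC_support|].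
  by move=> t At; have [//|] := H (X t).
by rewrite support_full leNgt PA.
Qed.

Lemma closed_support : closed (rv_support P X).
Proof. by rewrite -[rv_support _ _]setCK; apply: open_closedC; exact: open_setC_support. Qed.

(** Otherwise -X >= 0 almost surely with mean 0, so X = 0 almost surely. *)
Lemma centered_charges_pos : P.-integrable setT (EFin \o X) -> \int[P]_x (X x)%:E = 0 ->
  \int[P]_x ((X x) ^+ 2)%:E != 0 -> 0 < P (X @^-1` `]0%R, +oo[).
Proof.
move=> iX EX; apply: contraNT; rewrite -leNgt measure_le0 => /eqP P0.
have mp : measurable (X @^-1` `]0%R, +oo[) by apply: mpre; exact: measurable_itv.
have mXE : measurable_fun setT (fun x => (X x)%:E) by exact/measurable_EFinP.
have E0 : \int[P]_x `|(X x)%:E| = 0.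
  transitivity (\int[P]_x (- (X x)%:E)).
    apply: ae_eq_integral => //.
    - exact: measurableT_comp.
    - by apply: (measurableT_comp (f := -%E)).
    - exists (X @^-1` `]0%R, +oo[); split => // x /= /not_implyP[_ H].
      rewrite in_itv/= andbT ltNge; apply/negP => X0; apply: H.
      by rewrite /= ler0_norm.
  by rewrite integralN ?EX ?oppe0//; apply: integrable_add_def.
have /(ae_eq_integral_abs _ measurableT mXE).1 [N [mN PN NE]] := E0.
apply/eqP; rewrite (@ae_eq_integral _ _ _ P setT (cst 0)) ?integral0//.
- by apply/measurable_EFinP; exact: measurable_funX.
- exists N; split => // x /= /not_implyP[_ H]; apply: NE => /= H'.
  apply: H; have [->] := H' I; by rewrite expr0n.
Qed.
End support.

Section zero_biased_support.
Context (R : realType) (m : nat).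
Context d (T : measurableType d) (P : probability T R).
Context d' (T' : measurableType d') (P' : probability T' R).
Variables (W : T -> R) (V : T' -> R).
Hypotheses (hW : centered_nondegenerate P W) (mV : measurable_fun setT V).
Hypothesis (hV : zero_biased m.+1 P W P' V).
Local Open Scope ereal_scope.

Let mW : measurable_fun setT W.
Proof. by have [] := centered_second_moment hW. Qed.

Let mpreW (A : set R) : measurable A -> measurable (W @^-1` A).
Proof. by move=> mA; rewrite -[X in measurable X]setTI; exact: mW. Qed.

Let mpreV (A : set R) : measurable A -> measurable (V @^-1` A).
Proof. by move=> mA; rewrite -[X in measurable X]setTI; exact: mV. Qed.

(** If W is in C then so is W U. *)
Lemma zero_biased_star_shaped (C : set R) : measurable C ->
  (forall a u : R, C a -> (0 <= u <= 1)%R -> C (a * u)%R) ->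
  P (W @^-1` (~` C)) = 0 -> P' (V @^-1` (~` C)) = 0.
Proof.
move=> mC sC PC; have [_ s0 _ _] := centered_second_moment hW.
have mCc : measurable (~` C) by exact: measurableC.
have H : (fine 'V_P[W])%:E * P' (V @^-1` (~` C)) = 0.
  rewrite (zero_biased_law (ltn0Sn m) hW mV hV mCc).
  have nh := nonneg_measurable_indic mCc; have [mI I0] := nonneg_measurable_iter_avg m.+1 nh.
  rewrite (@ge0_negligible_integral _ _ _ P setT (W @^-1` (~` C)))//.
  - apply: integral0_eq => x [_ Wx']; have Wx : C (W x) by exact: contrapT.
    rewrite iter_avg_eq0 ?mule0// => u u01.
    by rewrite indicE memNset// => H; apply: H; exact: sC.
  - exact: mpreW.
  - apply: emeasurable_funM; last exact: measurableT_comp.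
    by apply/measurable_EFinP; exact: measurable_funX.
  - by move=> x _; rewrite mule_ge0// lee_fin sqr_ge0.
have : (fine 'V_P[W])^-1%:E * ((fine 'V_P[W])%:E * P' (V @^-1` (~` C))) = 0 by rewrite H mule0.
by rewrite muleA -EFinM mulVf ?mul1e// gt_eqF.
Qed.

(** The kernel at w is positive where W lies beyond w. *)
Lemma kernel_density_gt0 (w : R) : w != 0%R ->
  0 < P (W @^-1` (if (0 < w)%R then `]w, +oo[%classic else `]-oo, w[%classic)) ->
  0 < kernel_density m P W w.
Proof.
move=> w0; set A := (if _ then _ else _); have [_ s0 _ _] := centered_second_moment hW.
have mA : measurable A by rewrite /A; case: ifP => _; exact: measurable_itv.
move=> PA; apply: mule_gt0; first by rewrite lte_fin invr_gt0.
have K0 x : 0 <= (signed_kernel m (W x) w)%:E by rewrite lee_fin signed_kernel_ge0.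
rewrite lt0e; apply/andP; split; last exact: integral_ge0.
apply/negP => /eqP I0.
have mK : measurable_fun setT (fun x => (signed_kernel m (W x) w)%:E).
  by apply/measurable_EFinP; exact: (measurable_kernel_section m hW).
have E0 : \int[P]_x `|(signed_kernel m (W x) w)%:E| = 0.
  by rewrite -[RHS]I0; apply: eq_integral => x _; rewrite gee0_abs.
have /(ae_eq_integral_abs _ measurableT mK).1 [N [mN PN NE]] := E0.
have : P (W @^-1` A) <= P N.
  rewrite le_measure ?inE//; first exact: mpreW.
  move=> x Ax; apply: NE => /= H; have [] := H I; apply/eqP.
  move: Ax; rewrite /A /=; case: ifP => w1.
    rewrite /= in_itv/= andbT => wW; have W0 := lt_trans w1 wW.
    rewrite signed_kernel_pos// (ltW wW) mulf_neq0 ?gt_eqF// divr_gt0 ?ltr0n ?fact_gt0//.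
    by rewrite exprn_gt0// subr_gt0 ltr_ln.
  have {}w1 : (w < 0)%R by rewrite lt_neqAle w0 leNgt w1.
  rewrite /= in_itv/= => wW; have W0 := lt_trans wW w1.
  rewrite signed_kernel_neg// (ltW wW) mulf_neq0 ?gt_eqF ?oppr_gt0// divr_gt0 ?ltr0n ?fact_gt0//.
  by rewrite exprn_gt0// subr_gt0 ltr_ln ?posrE ?oppr_gt0// ltrN2.
by rewrite PN leNgt PA.
Qed.

Lemma charges_interval (x y k : R) (U : set R) : (x < y)%R -> (0 < k)%R -> measurable U ->
  (forall w, (x < w <= y)%R -> k%:E <= kernel_density m P W w) ->
  `]x, y]%classic `<=` U -> 0 < P' (V @^-1` U).
Proof.
move=> xy k0 mU H sub; have [md d0 dE] := kernel_density_is_density hW mV hV.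
apply: (@lt_le_trans _ _ (k * (y - x))%:E); first by rewrite lte_fin mulr_gt0// subr_gt0.
apply: (@le_trans _ _ (P' (V @^-1` `]x, y]%classic))); last first.
  rewrite le_measure ?inE//; [by apply: mpreV; exact: measurable_itv|exact: mpreV|].
  by move=> t /sub.
rewrite dE; last exact: measurable_itv.
have -> : (k * (y - x))%:E = \int[lebesgue_measure]_(w in `]x, y]) k%:E.
  by rewrite integral_cst//= lebesgue_measure_itv/= lte_fin xy EFinM EFinB.
apply: ge0_le_integral => //; last exact: measurable_funTS.
by move=> w _; rewrite lee_fin ltW.
Qed.

(** On some ]w, y] contained in U the density is at least its value at y. *)
Lemma charges_near_pos (w w2 : R) (U : set R) : (0 < w)%R -> (w < w2)%R ->
  0 < P (W @^-1` `]w2, +oo[) -> open U -> U w -> 0 < P' (V @^-1` U).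
Proof.
move=> w0 ww2 Pw2 oU Uw.
have /nbhs_ballP[e /= e0 eU] : nbhs w U by exact: open_nbhs_nbhs.
pose y := Num.min w2 (w + e / 2)%R.
have wy : (w < y)%R by rewrite lt_min ww2 ltrDl divr_gt0.
have y0 := lt_trans w0 wy.
have dy : 0 < kernel_density m P W y.
  apply: kernel_density_gt0; rewrite ?gt_eqF// y0 (lt_le_trans Pw2)//.
  rewrite le_measure ?inE//; [by apply: mpreW; exact: measurable_itv..|].
  by move=> t /=; rewrite !in_itv/= !andbT; apply: le_lt_trans; rewrite ge_min lexx.
have yf : kernel_density m P W y \is a fin_num by rewrite kernel_density_fin// gt_eqF.
apply: (@charges_interval w y (fine (kernel_density m P W y))) => //.
- by rewrite fine_gt0// dy ltey_eq yf.
- exact: open_measurable.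
- by move=> v /andP[wv vy]; rewrite fineK// kernel_density_nonincreasing// (lt_trans w0).
- move=> v /=; rewrite in_itv/= => /andP[wv vy]; apply: eU; rewrite /ball/= ltr_distlC.
  rewrite (lt_trans _ wv) ?ltrBlDr ?ltrDl//= (le_lt_trans vy)// gt_min.
  by rewrite ltrD2l gtr_pMr// invf_lt1// ltr1n orbT.
Qed.

(** On some ]y, w] contained in U the density is at least its value at y. *)
Lemma charges_near_neg (w w2 : R) (U : set R) : (w < 0)%R -> (w2 < w)%R ->
  0 < P (W @^-1` `]-oo, w2[) -> open U -> U w -> 0 < P' (V @^-1` U).
Proof.
move=> w0 ww2 Pw2 oU Uw.
have /nbhs_ballP[e /= e0 eU] : nbhs w U by exact: open_nbhs_nbhs.
pose y := Num.max w2 (w - e / 2)%R.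
have wy : (y < w)%R by rewrite gt_max ww2 gtrBl divr_gt0.
have y0 := lt_trans wy w0.
have dy : 0 < kernel_density m P W y.
  have yN : (0 < y)%R = false by rewrite ltNge (ltW y0).
  apply: kernel_density_gt0; rewrite ?lt_eqF// yN (lt_le_trans Pw2)//.
  rewrite le_measure ?inE//; [by apply: mpreW; exact: measurable_itv..|].
  by move=> t /=; rewrite !in_itv/= => /lt_le_trans; apply; rewrite le_max lexx.
have yf : kernel_density m P W y \is a fin_num by rewrite kernel_density_fin// lt_eqF.
apply: (@charges_interval y w (fine (kernel_density m P W y))) => //.
- by rewrite fine_gt0// dy ltey_eq yf.
- exact: open_measurable.
- by move=> v /andP[yv vw]; rewrite fineK// kernel_density_nondecreasing ?(ltW yv)// (le_lt_trans vw).
- move=> v /=; rewrite in_itv/= => /andP[yv vw]; apply: eU; rewrite /ball/= ltr_distlC.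
  rewrite (le_lt_trans vw) ?ltrDl// andbT (le_lt_trans _ yv)// le_max.
  by apply/orP; right; lra.
Qed.
End zero_biased_support.

Section zero_biased_hull.
Context (R : realType) (m : nat).
Context d (T : measurableType d) (P : probability T R).
Context d' (T' : measurableType d') (P' : probability T' R).
Variables (W : T -> R) (V : T' -> R).
Hypotheses (hW : centered_nondegenerate P W) (mV : measurable_fun setT V).
Hypothesis (hV : zero_biased m.+1 P W P' V).
Local Open Scope ereal_scope.
Let S := rv_support P W.

Let mW : measurable_fun setT W.
Proof. by have [] := centered_second_moment hW. Qed.

Let mpreW (A : set R) : measurable A -> measurable (W @^-1` A).
Proof. by move=> mA; rewrite -[X in measurable X]setTI; exact: mW. Qed.

Lemma support_has_pos : exists2 b, S b & (0 < b)%R.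
Proof.
have [_ s0 VW EW2] := centered_second_moment hW; have [W2 EW _] := hW.
have iW : P.-integrable setT (EFin \o W).
  by apply/Lfun1_integrable; apply: Lfun_subset12 W2; rewrite fin_num_measure.
have : 0 < P (W @^-1` `]0%R, +oo[).
  apply: (centered_charges_pos mW iW); first by rewrite -expectationE.
  by rewrite EW2 eqe gt_eqF.
move=> /(support_meets mW (measurable_itv _))[b Sb]; rewrite /= in_itv/= andbT.
by exists b.
Qed.

Lemma support_has_neg : exists2 b, S b & (b < 0)%R.
Proof.
have [_ s0 VW EW2] := centered_second_moment hW; have [W2 EW _] := hW.
have iW : P.-integrable setT (EFin \o W).
  by apply/Lfun1_integrable; apply: Lfun_subset12 W2; rewrite fin_num_measure.
have mNW : measurable_fun setT (fun x => - W x)%R by exact: measurableT_comp.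
have : 0 < P ((fun x => - W x)%R @^-1` `]0%R, +oo[).
  apply: (centered_charges_pos mNW).
  - exact: (integrableN iW).
  - transitivity (- \int[P]_x (W x)%:E); last by rewrite -expectationE EW oppe0.
    by rewrite -integralN//; apply: integrable_add_def.
  - under eq_integral do rewrite sqrrN.
    by rewrite EW2 eqe gt_eqF.
rewrite (_ : _ @^-1` _ = W @^-1` `]-oo, 0%R[%classic); last first.
  by apply/seteqP; split => x /=; rewrite !in_itv/= andbT oppr_gt0.
move=> /(support_meets mW (measurable_itv _))[b Sb]; rewrite /= in_itv/=.
by exists b.
Qed.

Lemma support_sub_star_shaped (C : set R) : closed C ->
  (forall a u : R, C a -> (0 <= u <= 1)%R -> C (a * u)%R) ->
  S `<=` C -> rv_support P' V `<=` C.
Proof.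
move=> cC sC SC x Vx; apply: contrapT => Cx.
have oC : open (~` C) by exact: closed_openC.
have := Vx _ oC Cx; rewrite (zero_biased_star_shaped hW mV hV _ sC) ?ltxx//.
- by rewrite -[C]setCK; apply: measurableC; exact: open_measurable.
- apply/eqP; rewrite -measure_le0 -(support_full P mW) le_measure ?inE//.
  + by apply: mpreW; exact: open_measurable.
  + by apply: mpreW; apply: open_measurable; exact: open_setC_support.
  + by move=> t Ct St; apply: Ct; exact: SC.
Qed.

(** Near x there are points y of ]0, b[. Since b is in the support of W, the
variable W exceeds some number above y with positive probability, and
[charges_near_pos] applies at y. *)
Lemma support_below_pos (b x : R) : S b -> (0 < b)%R -> (0 <= x <= b)%R -> rv_support P' V x.
Proof.
move=> Sb b0 /andP[x0 xb] U oU Ux.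
have /nbhs_ballP[e /= e0 eU] : nbhs x U by exact: open_nbhs_nbhs.
(* moving from x a fraction t of the way to b / 2 stays within distance e, as t b <= e *)
pose t := (e / (e + b))%R.
have eb : (0 < e + b)%R by rewrite addr_gt0.
have t0 : (0 < t)%R by rewrite divr_gt0.
have t1 : (t < 1)%R by rewrite ltr_pdivrMr// mul1r ltrDl.
have tb : (t * b <= e)%R.
  by rewrite mulrAC ler_pdivrMr// ler_pM2l// lerDr ltW.
pose y := (x + t * (b / 2 - x))%R.
have y0 : (0 < y)%R by rewrite /y; nra.
have yb : (y < b)%R by rewrite /y; nra.
have Uy : U y.
  by apply: eU; rewrite /ball/= ltr_distlC /y; apply/andP; split; nra.
apply: (@charges_near_pos _ m _ _ P _ _ P' W V hW mV hV y ((y + b) / 2)%R) => //.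
- by lra.
- apply: Sb; first exact: interval_open.
  by rewrite /= in_itv/= andbT; lra.
Qed.

Lemma support_above_neg (b x : R) : S b -> (b < 0)%R -> (b <= x <= 0)%R -> rv_support P' V x.
Proof.
move=> Sb b0 /andP[bx x0] U oU Ux.
have /nbhs_ballP[e /= e0 eU] : nbhs x U by exact: open_nbhs_nbhs.
(* moving from x a fraction t of the way to b / 2 stays within distance e, as -e <= t b *)
pose t := (e / (e - b))%R.
have eb : (0 < e - b)%R by rewrite subr_gt0 (lt_trans b0).
have t0 : (0 < t)%R by rewrite divr_gt0.
have t1 : (t < 1)%R by rewrite ltr_pdivrMr// mul1r; lra.
have tb : (- e <= t * b)%R.
  rewrite mulrAC ler_pdivlMr// mulNr -mulrN ler_pM2l//; lra.
pose y := (x + t * (b / 2 - x))%R.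
have y0 : (y < 0)%R by rewrite /y; nra.
have yb : (b < y)%R by rewrite /y; nra.
have Uy : U y.
  by apply: eU; rewrite /ball/= ltr_distlC /y; apply/andP; split; nra.
apply: (@charges_near_neg _ m _ _ P _ _ P' W V hW mV hV y ((y + b) / 2)%R) => //.
- by lra.
- apply: Sb; first exact: interval_open.
  by rewrite /= in_itv/=; lra.
Qed.

Lemma support_zero : rv_support P' V 0%R.
Proof.
have [b Sb b0] := support_has_pos.
by apply: (support_below_pos Sb b0); rewrite lexx ltW.
Qed.

(** Let y lie between two points of the support of V, with y > 0 say; one of them,
z', is at least y. If W had no support beyond y, then V would be supported in
]-oo, y], which is star-shaped about 0, and z' = y. Otherwise
[support_below_pos] applies. *)
Lemma convex_support : convex_set (M := R^o) (rv_support P' V).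
Proof.
move=> x z t; rewrite !inE => Vx Vz; set y := conv _ _ _.
have yE : y = (t%:num * x + (1 - t%:num) * z)%R by [].
have t0 : (0 <= t%:num :> R)%R by []; have t1 : (t%:num <= 1 :> R)%R by [].
have [y0|y0|->] := ltgtP y (0 : R)%R; last exact: support_zero.
- have [z' Vz' zy] : exists2 z', rv_support P' V z' & (z' <= y)%R.
    have [xz|zx] := leP x z; [exists x => //|exists z => //]; rewrite yE; nra.
  move: zy; rewrite le_eqVlt => /predU1P[<-//|zy].
  suff [b Sb by_] : exists2 b, S b & (b < y)%R.
    by apply: (support_above_neg Sb (lt_trans by_ y0)); rewrite !ltW.
  apply: contrapT => /forall2NP H.
  have : `[y, +oo[%classic z'.
    apply: (support_sub_star_shaped _ _ _ Vz').
    + exact: interval_closed.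
    + move=> a u /=; rewrite !in_itv/= !andbT => ya /andP[u0 u1].
      by have [a0|a0] := leP 0%R a; nra.
    + move=> b Sb /=; rewrite in_itv/= andbT leNgt; apply/negP => b1.
      by have [//|] := H b; rewrite b1.
  by rewrite /= in_itv/= andbT leNgt zy.
- have [z' Vz' zy] : exists2 z', rv_support P' V z' & (y <= z')%R.
    have [xz|zx] := leP x z; [exists z => //|exists x => //]; rewrite yE; nra.
  move: zy; rewrite le_eqVlt => /predU1P[->//|zy].
  suff [b Sb by_] : exists2 b, S b & (y < b)%R.
    by apply: (support_below_pos Sb (lt_trans y0 by_)); rewrite !ltW.
  apply: contrapT => /forall2NP H.
  have : `]-oo, y]%classic z'.
    apply: (support_sub_star_shaped _ _ _ Vz').
    + exact: interval_closed.
    + move=> a u /=; rewrite !in_itv/= => ya /andP[u0 u1].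
      by have [a0|a0] := leP 0%R a; nra.
    + move=> b Sb /=; rewrite in_itv/= leNgt; apply/negP => b1.
      by have [//|] := H b; rewrite b1.
  by rewrite /= in_itv/= leNgt zy.
Qed.

(** A closed convex set that contains the support of W contains 0, because W takes
both signs, and so is star-shaped about 0. *)
Lemma zero_biased_support : rv_support P' V = closed_convex_hull S.
Proof.
apply/seteqP; split; last first.
  apply: smallest_sub; first by split; [exact: closed_support|exact: convex_support].
  move=> b Sb; have [b0|b0|->] := ltgtP b 0%R; last exact: support_zero.
    by apply: (support_above_neg Sb b0); rewrite lexx ltW.
  by apply: (support_below_pos Sb b0); rewrite lexx ltW.
move=> x Vx C [[cC vC] SC].
have C0 : C 0%R.
  have [a Sa a0] := support_has_neg; have [b Sb b0] := support_has_pos.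
  have ba : (0 < b - a)%R by rewrite subr_gt0 (lt_trans a0).
  have l0 : (0 <= b / (b - a))%R by rewrite divr_ge0 ?ltW.
  have l1 : (b / (b - a) <= 1)%R by rewrite ler_pdivrMr// mul1r lerBrDr gerDl ltW.
  have := vC a b (Itv01 l0 l1) (mem_set (SC _ Sa)) (mem_set (SC _ Sb)); rewrite inE.
  rewrite -[conv _ _ _]/(b / (b - a) * a + (1 - b / (b - a)) * b)%R.
  by have -> : (b / (b - a) * a + (1 - b / (b - a)) * b = 0)%R by field; rewrite gt_eqF.
apply: (support_sub_star_shaped cC _ SC Vx) => a u Ca /andP[u0 u1].
have := vC a 0%R (Itv01 u0 u1) (mem_set Ca) (mem_set C0); rewrite inE.
rewrite -[conv _ _ _]/(u * a + (1 - u) * 0)%R.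
by rewrite mulr0 addr0 mulrC.
Qed.

Lemma zero_biased_bounded : bounded_rv P W -> bounded_rv P' V.
Proof.
move=> [M [N [mN PN WN]]]; exists M.
pose C : set R := `[(- M)%R, M]%classic.
have CE x : C x <-> (`|x| <= M)%R by rewrite /C /= in_itv/= ler_norml.
have mC : measurable C by exact: measurable_itv.
have mCc : measurable (~` C) by exact: measurableC.
exists (V @^-1` (~` C)); split.
- by rewrite -[X in measurable X]setTI; exact: mV.
- apply: (zero_biased_star_shaped hW mV hV mC).
    move=> a u /CE aM /andP[u0 u1]; apply/CE; rewrite normrM (ger0_norm u0).
    by rewrite (le_trans _ aM)// ler_piMr.
  apply/eqP; rewrite -measure_le0 -PN le_measure ?inE//; first exact: mpreW.
  by move=> x Wx; apply: WN => /CE.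
- by move=> x Vx Cx; apply: Vx; exact/CE.
Qed.
End zero_biased_hull.

Section symmetry.
Context (R : realType).
Local Open Scope ereal_scope.

Lemma eq_distribution_integral d (T : measurableType d) (P : probability T R) (X : T -> R)
    d' (T' : measurableType d') (P' : probability T' R) (Y : T' -> R) (h : R -> \bar R) :
  measurable_fun setT X -> measurable_fun setT Y -> eq_distribution P X P' Y -> nonneg_measurable h ->
  \int[P]_x h (X x) = \int[P']_y h (Y y).
Proof.
move=> mX mY XY nh; have [mu [muE muI]] := law_measure P mX; have [nu [nuE nuI]] := law_measure P' mY.
rewrite -muI// -nuI//; apply: eq_measure_integral => A mA _.
by have := XY A mA; rewrite -muE -nuE; apply.
Qed.

Context (m : nat).
Context d (T : measurableType d) (P : probability T R).
Context d' (T' : measurableType d') (P' : probability T' R).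
Variables (W : T -> R) (V : T' -> R).
Hypotheses (hW : centered_nondegenerate P W) (mV : measurable_fun setT V).
Hypothesis (hV : zero_biased m.+1 P W P' V).

Lemma zero_biased_symmetric : symmetric_rv P W -> symmetric_rv P' V.
Proof.
move=> sW A mA; have [mW s0 _ _] := centered_second_moment hW.
pose NA := -%R @^-1` A.
have mNA : measurable NA by rewrite -[NA]setTI; exact: oppr_measurable.
rewrite -[RHS]/(P' (V @^-1` NA)).
suff H : (fine 'V_P[W])%:E * P' (V @^-1` A) = (fine 'V_P[W])%:E * P' (V @^-1` NA).
  have : (fine 'V_P[W])^-1%:E * ((fine 'V_P[W])%:E * P' (V @^-1` A)) = P' (V @^-1` NA).
    by rewrite H muleA -EFinM mulVf ?mul1e// gt_eqF.
  by rewrite muleA -EFinM mulVf ?mul1e// gt_eqF.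
rewrite (zero_biased_law (ltn0Sn m) hW mV hV mA) (zero_biased_law (ltn0Sn m) hW mV hV mNA).
have [mI I0] := nonneg_measurable_iter_avg m.+1 (nonneg_measurable_indic mA).
have mNW : measurable_fun setT (fun x => - W x)%R by exact: measurableT_comp.
rewrite (eq_distribution_integral (h := fun a => (a ^+ 2)%:E *
  iter m.+1 avg (fun z => (\1_A z)%:E) a) mW mNW sW); last first.
  split; last by move=> a; rewrite mule_ge0// lee_fin sqr_ge0.
  by apply: emeasurable_funM => //; apply/measurable_EFinP; exact: measurable_funX.
apply: eq_integral => x _; rewrite sqrrN -(mulN1r (W x)) -iter_avg_dilate.
congr (_ * iter m.+1 avg _ (W x)); apply/funext => z; rewrite !indicE.
have -> // : ((-1) * z)%R \in A = (z \in NA).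
by apply/idP/idP; rewrite !inE /NA/= mulN1r.
Qed.
End symmetry.

(** * Symmetric variables *)

Section symmetric_density.
Context (R : realType) (m : nat).
Context d (T : measurableType d) (P : probability T R).
Context d' (T' : measurableType d') (P' : probability T' R).
Variables (W : T -> R) (V : T' -> R).
Hypotheses (hW : centered_nondegenerate P W) (mV : measurable_fun setT V).
Hypothesis (hV : zero_biased m.+1 P W P' V).
Hypothesis (sW : symmetric_rv P W).
Local Open Scope ereal_scope.
Let s : R := fine 'V_P[W].
Let c : R := (1 / (m`!%:R * s))%R.

Let mW : measurable_fun setT W.
Proof. by have [] := centered_second_moment hW. Qed.

Lemma integral_odd (z : R -> R) : measurable_fun setT z -> (forall a, z (- a) = - z a)%R ->
  P.-integrable setT (fun x => (z (W x))%:E) -> \int[P]_x (z (W x))%:E = 0.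
Proof.
move=> mz oz iz.
have np (e : R) : nonneg_measurable (fun a => maxe (e * z a)%:E 0).
  split; last by move=> a; rewrite le_max lexx orbT.
  by apply: measurable_maxe => //; apply/measurable_EFinP; exact: measurable_funM.
have mNW : measurable_fun setT (fun x => - W x)%R by exact: measurableT_comp.
have pE : \int[P]_x (fun x => (z (W x))%:E)^\+ x = \int[P]_x maxe (1 * z (W x))%R%:E 0.
  by apply: eq_integral => x _; rewrite funeposE mul1r.
have nE : \int[P]_x (fun x => (z (W x))%:E)^\- x = \int[P]_x maxe (1 * z (W x))%R%:E 0.
  rewrite (eq_distribution_integral mW mNW sW (np 1%R)).
  by apply: eq_integral => x _; rewrite funenegE oz mul1r.
rewrite integralE nE -pE subee//.
exact: integrable_pos_fin_num.
Qed.

(** The integral of the odd function z(W) over the whole space is zero, so its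
integrals over an event and over the complement are opposite. *)
Lemma integral_odd_split (z : R -> R) (B : set R) : measurable_fun setT z ->
  (forall a, z (- a) = - z a)%R -> measurable B ->
  P.-integrable setT (fun x => (z (W x))%:E) ->
  \int[P]_x (z (W x) * \1_B (W x))%:E = - \int[P]_x (z (W x) * \1_(~` B) (W x))%:E.
Proof.
move=> mz oz mB iz.
have iB (D : set R) : measurable D -> P.-integrable setT (fun x => (z (W x) * \1_D (W x))%:E).
  move=> mD; apply: (le_integrable measurableT _ _ iz).
    apply/measurable_EFinP; apply: measurable_funM; first exact: measurableT_comp.
    by apply: (measurableT_comp _ mW); exact: measurable_indic.
  move=> x _; rewrite !abse_EFin lee_fin normrM ler_piMr// indicE.
  by case: (_ \in _); rewrite ?normr1 ?normr0.
have H := integral_odd mz oz iz.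
have HD : \int[P]_x (z (W x))%:E =
    \int[P]_x (z (W x) * \1_B (W x))%:E + \int[P]_x (z (W x) * \1_(~` B) (W x))%:E.
  rewrite -integralD//; [|exact: iB|by apply: iB; exact: measurableC].
  apply: eq_integral => x _; rewrite -EFinD -mulrDr !indicE in_setC.
  by case: (_ \in _); rewrite /= ?addr0 ?add0r mulr1.
rewrite H in HD.
have Bfin := integrable_fin_num measurableT (iB _ (measurableC mB)).
by rewrite -[LHS]adde0 -(subee Bfin) addeA -HD add0e.
Qed.

Definition log_moment (w a : R) : R := (a * ln `|a / w| ^+ m)%R.

Lemma log_momentN w a : log_moment w (- a) = (- log_moment w a)%R.
Proof. by rewrite /log_moment !mulNr normrN. Qed.

Lemma measurable_log_moment w : measurable_fun setT (log_moment w).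
Proof.
apply: measurable_funM => //; apply: measurable_funX.
apply: (measurableT_comp (@measurable_ln R)); apply: measurableT_comp => //.
exact: measurable_funM.
Qed.

(** With t = |a / w|: if t >= 1 then log(t)^m <= m! t, and if t < 1 then
log(1 / t)^m <= m! / t. *)
Lemma log_moment_le w a : w != 0%R ->
  (`|log_moment w a| <= m`!%:R * (a ^+ 2 / `|w| + `|w|))%R.
Proof.
move=> w0; have [->|a0] := eqVneq a 0%R.
  by rewrite /log_moment mul0r normr0 mulr_ge0// addr_ge0// divr_ge0// sqr_ge0.
have wp : (0 < `|w|)%R by rewrite normr_gt0.
have ap : (0 < `|a|)%R by rewrite normr_gt0.
have tp : (0 < `|a / w|)%R by rewrite normr_gt0 mulf_neq0// invr_eq0.
have f0 : (0 < m`!%:R :> R)%R by rewrite ltr0n fact_gt0.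
rewrite /log_moment normrM normrX.
have tE : (`|a / w| = `|a| / `|w|)%R by rewrite normf_div.
have [t1|t1] := leP 1%R `|a / w|%R.
  have l0 : (0 <= ln `|a / w|)%R by rewrite ln_ge0.
  rewrite (ger0_norm l0).
  have := expr_le_fact_exp m l0; rewrite lnK ?posrE// => H.
  apply: (@le_trans _ _ (`|a| * (m`!%:R * `|a / w|))%R); first by rewrite ler_pM2l.
  rewrite mulrCA ler_pM2l// tE mulrA -expr2 -normrX ger0_norm ?sqr_ge0//.
  by rewrite lerDl.
have l0 : (0 <= - ln `|a / w|)%R by rewrite oppr_ge0 ln_le0// ltW.
rewrite -(normrN (ln `|a / w|)%R) (ger0_norm l0).
have := expr_le_fact_exp m l0; rewrite expRN lnK ?posrE// => H.
apply: (@le_trans _ _ (`|a| * (m`!%:R * `|a / w|^-1))%R); first by rewrite ler_pM2l.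
rewrite mulrCA ler_pM2l// tE invf_div mulrCA divff ?gt_eqF// mulr1.
by rewrite lerDr divr_ge0// sqr_ge0.
Qed.

Lemma integrable_log_moment w : w != 0%R ->
  P.-integrable setT (fun x => (log_moment w (W x))%:E).
Proof.
move=> w0; have [_ s0 VW EW2] := centered_second_moment hW.
have i2 := integrable_sqr mW EW2.
(* the bound of log_moment_le, as a function of W *)
have i3 : P.-integrable setT (fun x => (m`!%:R)%:E * ((`|w|^-1)%:E * ((W x) ^+ 2)%:E + `|w|%:E)).
  apply: integrableZl => //; apply: integrableD => //; first exact: integrableZl.
  exact: finite_measure_integrable_cst.
apply: (le_integrable measurableT _ _ i3).
  apply/measurable_EFinP; apply: measurableT_comp => //; exact: measurable_log_moment.
move=> x _.
rewrite -[X in _ <= `|X|]/((m`!%:R * (`|w|^-1 * W x ^+ 2 + `|w|))%R%:E) !abse_EFin lee_fin.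
rewrite (le_trans (log_moment_le _ w0))// [(_^-1 * _)%R]mulrC ler_norm//.
Qed.

Lemma lne_abs_term (w a : R) : w != 0%R ->
  a%:E * lne `|a%:E / w%:E| ^+ m = (log_moment w a)%:E.
Proof.
move=> w0; have [->|a0] := eqVneq a 0%R; first by rewrite mul0e /log_moment mul0r.
rewrite EFin_div// abse_EFin lne_EFin; last by rewrite normr_gt0 mulf_neq0// invr_eq0.
by rewrite -EFin_expe -EFinM.
Qed.

Lemma log_moment_pos (w a : R) : (0 < w)%R ->
  (log_moment w a * (w <= a)%R%:R = m`!%:R * signed_kernel m a w)%R.
Proof.
move=> w0; rewrite signed_kernel_pos//; have [wa|_] := leP w a; last by rewrite !mulr0.
have a0 := lt_le_trans w0 wa.
rewrite /log_moment gtr0_norm ?divr_gt0// ln_div// mulr1.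
by field; rewrite pnatr_eq0 -lt0n fact_gt0.
Qed.

Lemma log_moment_neg (w a : R) : (w < 0)%R ->
  (log_moment w a * (a <= w)%R%:R = - (m`!%:R * signed_kernel m a w))%R.
Proof.
move=> w0; have := @log_moment_pos (- w) (- a); rewrite oppr_gt0 lerN2 signed_kernelN => /(_ w0) <-.
by rewrite /log_moment invrN mulrNN mulNr mulNr opprK.
Qed.

(** Complementing the event W >= w leaves the open event W < w, so the diagonal is
missing from the kernel on the half-line of the w that are reached through
[integral_odd_split]. *)
Definition open_kernel (e : bool) (z : measurableTypeR R * measurableTypeR R) : R :=
  if (z.1 == z.2) && (if e then z.2 < 0 else 0 < z.2)%R then 0%R else signed_kernel m z.1 z.2.

Lemma open_kernel_ge0 e z : (0 <= open_kernel e z)%R.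
Proof. by rewrite /open_kernel; case: ifP => // _; exact: signed_kernel_ge0. Qed.

Lemma measurable_open_kernel e : measurable_fun setT (open_kernel e).
Proof.
apply: measurable_fun_if => //.
- apply: measurable_and; first by apply: measurable_fun_eqr; [exact: measurable_fst|exact: measurable_snd].
  by case: e; apply: measurable_fun_ltr => //; exact: measurable_snd.
- by apply: measurable_funTS; exact: measurable_signed_kernel.
Qed.

Lemma measurable_open_kernel_section e w : measurable_fun setT (fun x => open_kernel e (W x, w)).
Proof.
exact: (measurableT_comp (measurableT_comp (measurable_open_kernel e) (measurable_pair2 w)) mW).
Qed.

Lemma open_kernel_off e a w : w != a -> open_kernel e (a, w) = signed_kernel m a w.
Proof. by move=> wa; rewrite /open_kernel/= eq_sym (negbTE wa). Qed.

Let c0 : (0 <= c)%R.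
Proof.
have [_ s0 _ _] := centered_second_moment hW.
by rewrite divr_ge0// mulr_ge0// ltW.
Qed.

Lemma abs_quotient_at0_ge0 (a : R) : (0 <= a)%R -> 0 <= a%:E * lne `|a%:E / 0| ^+ m.
Proof.
move=> a0; rewrite gee0_abs; first exact: quotient_at0_ge0.
by rewrite inve0 mule_ge0 ?lee_fin ?leey.
Qed.

(** For w > 0 this is the kernel as before. For w < 0, [integral_odd_split]
replaces the event W >= w by W < w, where the integrand has constant sign. *)
Lemma symmetric_density_right : is_density P' V (fun w : R =>
  c%:E * \int[P]_x ((W x)%:E * lne `|(W x)%:E / w%:E| ^+ m * (\1_[set y | (w <= W y)%R] x)%:E)).
Proof.
apply: (is_density_kernel hW mV hV (measurable_open_kernel true)).
- exact: open_kernel_ge0.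
- exact: open_kernel_off.
- move=> w w0; rewrite -/s -(density_scale m hW); first last.
  + by move=> x; exact: open_kernel_ge0.
  + exact: measurable_open_kernel_section.
  congr (_ * _); have [wN|wP] := ltP w 0%R; last first.
    have w1 : (0 < w)%R by rewrite lt_neqAle eq_sym w0.
    apply: eq_integral => x _; rewrite indic_leE lne_abs_term// -EFinM log_moment_pos//.
    by rewrite /open_kernel/= ltNge (ltW w1) andbF.
  transitivity (\int[P]_x (log_moment w (W x) * \1_`[w, +oo[ (W x))%:E).
    apply: eq_integral => x _; rewrite indic_leE lne_abs_term// -EFinM; congr ((_ * _)%:E)%R.
    by rewrite indicE mem_setE/= in_itv/= andbT.
  rewrite (integral_odd_split (measurable_log_moment w) (fun a => log_momentN w a)
    (measurable_itv _) (integrable_log_moment w0)).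
  rewrite (eq_integral (fun x => - (m`!%:R * open_kernel true (W x, w))%:E)); last first.
    move=> x _; rewrite -EFinN indicE in_setC mem_setE/= in_itv/= andbT -ltNge; congr (_%:E).
    rewrite /open_kernel/= wN andbT; have [->|Ww] := eqVneq (W x) w.
      by rewrite ltxx !mulr0 oppr0.
    by rewrite lt_neqAle Ww/= log_moment_neg.
  rewrite integral_ge0N ?oppeK// => x _.
  by rewrite lee_fin mulr_ge0// open_kernel_ge0.
- apply: mule_ge0; first by rewrite lee_fin.
  apply: integral_ge0 => x _; rewrite indic_leE.
  by have [W0|_] := leP 0%R (W x); rewrite ?mule0// mule1 abs_quotient_at0_ge0.
Qed.

Lemma symmetric_density_left : is_density P' V (fun w : R =>
  - (c%:E * \int[P]_x ((W x)%:E * lne `|(W x)%:E / w%:E| ^+ m * (\1_[set y | (W y <= w)%R] x)%:E))).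
Proof.
apply: (is_density_kernel hW mV hV (measurable_open_kernel false)).
- exact: open_kernel_ge0.
- exact: open_kernel_off.
- move=> w w0; rewrite -/s -(density_scale m hW); first last.
  + by move=> x; exact: open_kernel_ge0.
  + exact: measurable_open_kernel_section.
  rewrite -muleN; congr (_ * _); have [wN|wP] := ltP w 0%R.
    rewrite (eq_integral (fun x => - (m`!%:R * open_kernel false (W x, w))%:E)); last first.
      move=> x _; rewrite indic_geE lne_abs_term// -EFinM -EFinN log_moment_neg//.
      by rewrite /open_kernel/= ltNge (ltW wN) andbF.
    rewrite integral_ge0N ?oppeK// => x _.
    by rewrite lee_fin mulr_ge0// open_kernel_ge0.
  have w1 : (0 < w)%R by rewrite lt_neqAle eq_sym w0.
  transitivity (- \int[P]_x (log_moment w (W x) * \1_`]-oo, w] (W x))%:E).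
    congr (- _); apply: eq_integral => x _.
    rewrite indic_geE lne_abs_term// -EFinM; congr ((_ * _)%:E)%R.
    by rewrite indicE mem_setE/= in_itv/=.
  rewrite (integral_odd_split (measurable_log_moment w) (fun a => log_momentN w a)
    (measurable_itv _) (integrable_log_moment w0)) oppeK.
  apply: eq_integral => x _.
  rewrite indicE in_setC mem_setE/= in_itv/= -ltNge; congr (_%:E).
  rewrite /open_kernel/= w1 andbT; have [->|Ww] := eqVneq (W x) w.
    by rewrite ltxx !mulr0.
  by rewrite lt_neqAle eq_sym Ww/= log_moment_pos.
- rewrite -muleN; apply: mule_ge0; first by rewrite lee_fin.
  rewrite (eq_integral (fun x => - ((- W x)%:E * lne `|(- W x)%:E / 0| ^+ m * (W x <= 0)%R%:R%:E))); last first.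
    move=> x _; rewrite indic_geE EFinN !mulNe abseN oppeK.
    by [].
  rewrite integral_ge0N ?oppeK; last first.
    move=> x _; have [W0|_] := leP (W x) 0%R; rewrite ?mule0// mule1.
    by rewrite abs_quotient_at0_ge0 ?oppr_ge0.
  apply: integral_ge0 => x _; have [W0|_] := leP (W x) 0%R; rewrite ?mule0// mule1.
  by rewrite abs_quotient_at0_ge0 ?oppr_ge0.
Qed.
End symmetric_density.

(** * The proposition *)

Section product_of_zero_biased.
Context (R : realType) (n : nat) (hn : (0 < n)%N).
Context d (T : measurableType d) (P : probability T R) (W : T -> R) (Wk : 'I_n -> T -> R).
Context d' (T' : measurableType d') (P' : probability T' R) (V : T' -> R).
Context d'' (T'' : measurableType d'') (P'' : probability T'' R) (Ws : 'I_n -> T'' -> R).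
Hypotheses (hW : centered_nondegenerate P W) (mV : measurable_fun setT V).
Hypothesis (hV : zero_biased n P W P' V).
Hypotheses (mWk : forall k, measurable_fun setT (Wk k)) (mWs : forall k, measurable_fun setT (Ws k)).
Hypotheses (indW : mutually_independent P Wk) (indWs : mutually_independent P'' Ws).
Hypothesis (cW : forall k, centered_nondegenerate P (Wk k)).
Hypothesis (WE : forall x, W x = (\prod_(k < n) Wk k x)%R).
Hypothesis (hWs : forall k, zero_biased 1 P (Wk k) P'' (Ws k)).
Local Open Scope ereal_scope.

Let Z z := (\prod_(k < n) Ws k z)%R.

Let mZ : measurable_fun setT Z.
Proof.
rewrite (_ : Z = partial_prod Ws n); first exact: measurable_partial_prod.
by apply/funext => z; rewrite partial_prod_full.
Qed.

(** The function h = 1 shows that the product of the variances is sigma^2. *)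
Lemma zero_biased_product_law (h : R -> \bar R) : nonneg_measurable h ->
  \int[P']_y h (V y) = \int[P'']_z h (Z z).
Proof.
have [c c0 cE] := zero_biased_partial_prod mWk mWs indW indWs cW hWs (leqnn n).
have cI (k : R -> \bar R) : nonneg_measurable k -> c%:E * \int[P'']_z k (Z z) =
    (fine 'V_P[W])%:E * \int[P']_y k (V y).
  move=> nk; rewrite (zero_biased_integral hn hW mV hV nk).
  under eq_integral do rewrite -[Z _]/(Z _) /Z -partial_prod_full.
  rewrite cE//; apply: eq_integral => x _.
  by rewrite WE -partial_prod_full.
have n1 : nonneg_measurable (fun=> 1 : \bar R) by split => //.
have cs : c = fine 'V_P[W].
  have := cI _ n1; rewrite !integral_cst// !mul1e.
  change (c%:E * P'' setT = (fine 'V_P[W])%:E * P' setT -> c = fine 'V_P[W]).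
  by rewrite !probability_setT !mule1 => -[].
move=> nh; have := cI _ nh; rewrite -cs => H.
have : (c^-1)%:E * (c%:E * \int[P'']_z h (Z z)) = (c^-1)%:E * (c%:E * \int[P']_y h (V y)).
  by rewrite H.
by rewrite !muleA -EFinM mulVf ?gt_eqF// !mul1e.
Qed.

Lemma zero_biased_product : eq_distribution P' V P'' Z /\ zero_biased n P W P'' Z.
Proof.
split; first exact: (same_law_eq_distribution mV mZ zero_biased_product_law).
exact: (same_law_zero_biased hn mV zero_biased_product_law hV).
Qed.
End product_of_zero_biased.

Unset Implicit Arguments.

(* Quotients and logarithms under the expectations are extended-real valued:
   x / 0 is +oo for x > 0 and -oo for x < 0, lne +oo = +oo, and 0 * (+-oo) = 0. *)
Theorem proposition3p3 (R : realType) (n : nat) (hn : (1 <= n)%N)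
    (d : measure_display) (T : measurableType d) (P : probability T R)
    (W : {RV P >-> R}) (hW : centered_nondegenerate P W)
    (d' : measure_display) (T' : measurableType d') (P' : probability T' R)
    (V : {RV P' >-> R}) (hV : zero_biased n P W P' V) :
  let sigma2 : R := fine ('V_P[W])%E in
  let c : R := 1 / ((n.-1)`!%:R * sigma2) in
  (* (i) *)
  [/\ forall w : R,
        cdf V w =
        (if (w < 0)%R then
           c%:E * \int[P]_x (((W x) ^+ 2)%:E
                    * lower_gamma n%:R (lne ((W x)%:E / w%:E))
                    * (\1_[set y | (W y <= w)%R] x)%:E)
         else
           1 - c%:E * \int[P]_x (((W x) ^+ 2)%:E
                    * lower_gamma n%:R (lne ((W x)%:E / w%:E))
                    * (\1_[set y | (w <= W y)%R] x)%:E))%E,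
  (* (ii) *)
      [/\ unimodal_about V 0,
          is_density P' V (fun w : R =>
            (if (w < 0)%R then
               - (c%:E * \int[P]_x ((W x)%:E
                    * lne ((W x)%:E / w%:E) ^+ n.-1
                    * (\1_[set y | (W y <= w)%R] x)%:E))
             else
               c%:E * \int[P]_x ((W x)%:E
                    * lne ((W x)%:E / w%:E) ^+ n.-1
                    * (\1_[set y | (w <= W y)%R] x)%:E))%E),
          rv_support P' V = closed_convex_hull (rv_support P W),
          bounded_rv P W -> bounded_rv P' V &
          symmetric_rv P W ->
          [/\ is_density P' V (fun w : R =>
                c%:E * \int[P]_x ((W x)%:E
                    * lne `|(W x)%:E / w%:E| ^+ n.-1
                    * (\1_[set y | (w <= W y)%R] x)%:E))%E,
              is_density P' V (fun w : R =>
                - (c%:E * \int[P]_x ((W x)%:E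
                    * lne `|(W x)%:E / w%:E| ^+ n.-1
                    * (\1_[set y | (W y <= w)%R] x)%:E)))%E &
              symmetric_rv P' V]],
  (* (iii) *)
      (forall p : nat,
         ('E_P'[fun y => (V y ^+ p)%R] =
         'E_P[fun x => (W x ^+ (p + 2))%R]
            / (sigma2 * (p%:R + 1) ^+ n)%:E)%E) /\
      (forall p : R, 0 <= p ->
         ('E_P'[fun y => (`|V y| `^ p)%R] =
         'E_P[fun x => (`|W x| `^ (p + 2))%R]
            / (sigma2 * (p + 1) ^+ n)%:E)%E),
  (* (iv) *)
      forall (Wk : 'I_n -> {RV P >-> R}),
        mutually_independent P (fun k => Wk k : T -> R) ->
        (forall k, centered_nondegenerate P (Wk k)) ->
        (forall x, W x = \prod_(k < n) Wk k x) ->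
        forall (d'' : measure_display) (T'' : measurableType d'')
          (P'' : probability T'' R) (Wks : 'I_n -> {RV P'' >-> R}),
        mutually_independent P'' (fun k => Wks k : T'' -> R) ->
        (forall k, zero_biased 1 P (Wk k) P'' (Wks k)) ->
        eq_distribution P' V P'' (fun z => \prod_(k < n) Wks k z) /\
        zero_biased n P W P'' (fun z => \prod_(k < n) Wks k z) &
  (* (v) *)
      forall a : R, a != 0 ->
        zero_biased n P (fun x => a * W x) P' (fun y => a * V y)].
Proof.
case: n hn hV => // m _ hV sigma2 c.
have mV : measurable_fun setT V by [].
have W2 : (W : T -> R) \in Lfun P 2%:E by have [] := hW.
split.
- exact: (zero_biased_cdf hW hV).
- split.
  + exact: (zero_biased_unimodal hW hV).
  + exact: (zero_biased_density hW mV hV).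
  + exact: (zero_biased_support hW mV hV).
  + exact: (zero_biased_bounded hW mV hV).
  + move=> sW; split.
    * exact: (symmetric_density_right hW mV hV sW).
    * exact: (symmetric_density_left hW mV hV sW).
    * exact: (zero_biased_symmetric hW mV hV sW).
- split=> p; first exact: (zero_biased_moment (ltn0Sn m) hW mV hV).
  exact: (zero_biased_abs_moment (ltn0Sn m) hW mV hV).
- move=> Wk iW cW WE d'' T'' P'' Ws iWs hWs.
  exact: (zero_biased_product (ltn0Sn m) hW mV hV (fun k => measurable_funPT (Wk k))
    (fun k => measurable_funPT (Ws k)) iW iWs cW WE hWs).
- move=> a a0; exact: (zero_biased_dilate (ltn0Sn m) hV W2 a0).
Qed.
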